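(* The following are the complete list, up to scaling, of all closed real-valued 1-forms of the form $\sum_{i=1}^3 f(l_i)\,dg(r_i)$ (where $\theta_i=r_j+r_k$) and $\sum_{i=1}^3 f(\theta_i)\,dg(r_i)$ (where $l_i=r_j+r_k$), $\{i,j,k\}=\{1,2,3\}$, for some non-constant smooth functions $f,g$. Let $\lambda\in\mathbb R$ and $u=(u_1,u_2,u_3)$. (a) For a Euclidean triangle of angles $\theta_i$ and opposite edge lengths $r_j+r_k$, $$\eta_\lambda=\sum_{i=1}^3\frac{\int^{\theta_i}\cot^\lambda(t/2)\,dt}{r_i^{\lambda+1}}\,dr_i.$$ Its integration $\int^u\eta_\lambda$ is locally concave in $u$ where $u_i=\int_1^{r_i}t^{-\lambda-1}\,dt$. (b) For a hyperbolic triangle of angles $\theta_i$ and opposite edge lengths $r_j+r_k$, $$\eta_\lambda=\sum_{i=1}^3\frac{\int^{\theta_i}\cot^\lambda(t/2)\,dt}{\sinh^{\lambda+1}(r_i)}\,dr_i.$$ Its integration $\int^u\eta_\lambda$ is locally strictly concave in $u$ where $u_i=\int_1^{r_i}\sinh^{-\lambda-1}(t)\,dt$. (c) For a spherical triangle of angles $\theta_i$ and opposite edge lengths $r_j+r_k$, $$\eta_\lambda=\sum_{i=1}^3\frac{\int^{\theta_i}\cot^\lambda(t/2)\,dt}{\sin^{\lambda+1}(r_i)}\,dr_i.$$ (d) For a hyperbolic triangle of edge lengths $l_i$ and opposite angles $r_j+r_k$, $$\eta_\lambda=\sum_{i=1}^3\frac{\int^{l_i}\tanh^\lambda(t/2)\,dt}{\cos^{\lambda+1}(r_i)}\,dr_i.$$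 Its integration $\int^u\eta_\lambda$ is locally strictly convex in $u$ where $u_i=\int_1^{r_i}\cos^{-\lambda-1}(t)\,dt$. (e) For a spherical triangle of edge lengths $l_i$ and opposite angles $r_j+r_k$, $$\eta_\lambda=\sum_{i=1}^3\frac{\int^{l_i}\tan^\lambda(t/2)\,dt}{\cos^{\lambda+1}(r_i)}\,dr_i.$$ (f) For a hyperbolic right-angled hexagon of three pairwise non-adjacent edge lengths $l_i$ and opposite edge lengths $r_j+r_k$, $$\eta_\lambda=\sum_{i=1}^3\frac{\int^{l_i}\coth^\lambda(t/2)\,dt}{\cosh^{\lambda+1}(r_i)}\,dr_i.$$ Its integration $\int^u\eta_\lambda$ is locally strictly concave in $u$ where $u_i=\int_1^{r_i}\cosh^{-\lambda-1}(t)\,dt$.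
   Context: In each case the 1-form is on the open set of all $r=(r_1,r_2,r_3)$ arising from triangles (or hexagons) of the given type, and the quantities $\theta_i$ (in (a)–(c)) or $l_i$ (in (d)–(f)) are functions of $r$ through the cosine law of the respective geometry. For the hexagon, with opposite edge lengths $\theta_i=r_j+r_k$, $\cosh l_i=\frac{\cosh\theta_i+\cosh\theta_j\cosh\theta_k}{\sinh\theta_j\sinh\theta_k}$. $\int^{z}h(t)\,dt$ denotes an antiderivative of $h$ (arbitrary additive constant, the same for $i=1,2,3$). The map $r\mapsto u$ is a diffeomorphism onto its image and $\int^u\eta_\lambda$ denotes a primitive of $\eta_\lambda$ expressed in the variable $u$. Locally concave (resp. locally strictly concave) means that the Hessian matrix is negative semi-definite (resp. negative definite) at every point; locally strictly convex means that the Hessian is positive definite at every point.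
   Formalization: In (d) ''locally strictly convex'' is corrected to ''locally strictly concave'' (the Hessian diagonal is always negative); in (b) and (f) completeness is stated for f, g with f'·g' nonzero at some point of the domain, as merely non-constant f, g admit trivial counterexamples. *)

(* Defs.v *)
From Stdlib Require Import Reals.
From Coquelicot Require Import Coquelicot.
Open Scope R_scope.

Inductive idx := i1 | i2 | i3.

Definition nxt (i : idx) : idx :=
  match i with i1 => i2 | i2 => i3 | i3 => i1 end.

Definition vec := idx -> R.

Definition upd (p : vec) (i : idx) (x : R) : vec := fun j =>
  match i, j with
  | i1, i1 | i2, i2 | i3, i3 => x
  | _, _ => p j
  end.

Definition sum3 (a : idx -> R) : R := a i1 + a i2 + a i3.

Definition partial (i : idx) (W : vec -> R) (p : vec) : R :=
  Derive (fun x => W (upd p i x)) (p i).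

Definition ex_partial (i : idx) (W : vec -> R) (p : vec) : Prop :=
  ex_derive (fun x => W (upd p i x)) (p i).

Definition pair_sum (r : vec) : vec := fun i => r (nxt i) + r (nxt (nxt i)).

(* Only used at points where the denominators do not vanish. *)
Definition cot (x : R) : R := cos x / sin x.
Definition coth (x : R) : R := cosh x / sinh x.

(* Nondegenerate triangles with edge lengths [l] and opposite inner angles
   [th].  Having angles strictly between 0 and PI in the three cosine laws
   forces the strict triangle inequalities, and perimeter < 2 PI in the
   spherical case. *)
Definition euclidean_triangle (l th : vec) : Prop := forall i,
  let j := nxt i in let k := nxt j in
  0 < l i /\ 0 < th i < PI /\
  (l i) ^ 2 = (l j) ^ 2 + (l k) ^ 2 - 2 * l j * l k * cos (th i).

Definition hyperbolic_triangle (l th : vec) : Prop := forall i,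
  let j := nxt i in let k := nxt j in
  0 < l i /\ 0 < th i < PI /\
  cosh (l i) = cosh (l j) * cosh (l k) - sinh (l j) * sinh (l k) * cos (th i).

Definition spherical_triangle (l th : vec) : Prop := forall i,
  let j := nxt i in let k := nxt j in
  0 < l i < PI /\ 0 < th i < PI /\
  cos (l i) = cos (l j) * cos (l k) + sin (l j) * sin (l k) * cos (th i).

(* Right-angled hyperbolic hexagon: [l] and [th] are the lengths of the two
   triples of pairwise non-adjacent edges, [th i] being opposite to [l i]. *)
Definition right_angled_hexagon (l th : vec) : Prop := forall i,
  let j := nxt i in let k := nxt j in
  0 < l i /\ 0 < th i /\
  cosh (l i) =
    (cosh (th i) + cosh (th j) * cosh (th k)) / (sinh (th j) * sinh (th k)).

(* In what follows [T x y] relates the quantities [x i = r j + r k] to the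
   opposite quantities [y i]. *)
Definition arising (T : vec -> vec -> Prop) (r : vec) : Prop :=
  exists y, T (pair_sum r) y.

(* [y r] is uniquely determined for [r] arising from [T] and irrelevant
   elsewhere. *)
Definition opposite (T : vec -> vec -> Prop) (y : vec -> vec) : Prop :=
  forall r, arising T r -> T (pair_sum r) (y r).

Definition oo (a b : Rbar) (x : R) : Prop := Rbar_lt a x /\ Rbar_lt x b.

Definition smooth_on (I : R -> Prop) (f : R -> R) : Prop :=
  forall n x, I x -> ex_derive_n f n x.

Definition nonconstant_on (I : R -> Prop) (f : R -> R) : Prop :=
  exists x y, I x /\ I y /\ f x <> f y.

Definition antiderivative_on (I : R -> Prop) (h F : R -> R) : Prop :=
  forall x, I x -> is_derive F x (h x).

(* A 1-form [sum_i w_i dr_i] is given by its coefficients [w r i]. *)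
Definition form := vec -> vec.

Definition eq_form_on (D : vec -> Prop) (w w' : form) : Prop :=
  forall r, D r -> forall i, w r i = w' r i.

Definition closed_on (D : vec -> Prop) (w : form) : Prop :=
  forall r, D r -> forall i j,
    ex_partial j (fun p => w p i) r /\
    partial j (fun p => w p i) r = partial i (fun p => w p j) r.

(* [sum_i f(y_i) dg(r_i)] *)
Definition separated_form (y : vec -> vec) (f g : R -> R) : form :=
  fun r i => f (y r i) * Derive g (r i).

(* [f'(y_i) g'(r_i) <> 0] at some point.  This is automatic
   for non-constant [f] and [g] if every pair of values [(y_i, r_i)] occurs.
   For hyperbolic triangles with edge lengths [r_j + r_k]
   (where [tan (th_i / 2) ^ 2 < / (exp (2 * r_i) - 1)]) and for hexagons
   (where [coth (l_i / 2) ^ 2 < exp (2 * r_i) + 1]) some pairs do not occur,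
   and then there are non-constant [f], [g] with
   [sum_i f(y_i) dg(r_i) = K * sum_i dg(r_i)], trivially closed. *)
Definition interacting (D : vec -> Prop) (y : vec -> vec) (f g : R -> R)
  : Prop :=
  exists r i, D r /\ Derive f (y r i) <> 0 /\ Derive g (r i) <> 0.

(* [eta_lambda], where [F] is the chosen antiderivative and [s] is one of
   the functions [id, sinh, sin, cos, cosh]. *)
Definition eta (y : vec -> vec) (s F : R -> R) (lam : R) : form :=
  fun r i => F (y r i) / Rpower (s (r i)) (lam + 1).

(* [A] selects the admissible pairs [(f, g)]; [I], [J] are the ranges of the
   [y_i] and of the [r_i]. *)
Definition list_of_closed_forms (A : (R -> R) -> (R -> R) -> Prop)
  (D : vec -> Prop) (y : vec -> vec) (I J : R -> Prop) (h s : R -> R) : Prop :=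
  forall w : form,
    (closed_on D w /\
     exists f g, smooth_on I f /\ smooth_on J g /\
       nonconstant_on I f /\ nonconstant_on J g /\ A f g /\
       eq_form_on D w (separated_form y f g))
    <->
    (exists lam c F, c <> 0 /\
       antiderivative_on I (fun t => Rpower (h t) lam) F /\
       eq_form_on D w (fun r i => c * eta y s F lam r i)).

Definition all_closed_forms := list_of_closed_forms (fun _ _ => True).

Definition all_interacting_closed_forms (D : vec -> Prop) (y : vec -> vec) :=
  list_of_closed_forms (interacting D y) D y.

Definition u_coord (s : R -> R) (lam : R) (r : vec) : vec :=
  fun i => RInt (fun t => Rpower (s t) (- lam - 1)) 1 (r i).

Definition image_of (u : vec -> vec) (D : vec -> Prop) (p : vec) : Prop :=
  exists r, D r /\ p = u r.

(* [W], a function of the variable [u], pulls back to a primitive of [w].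
   Since the coefficients of the forms considered are continuous, prescribing
   the partial derivatives amounts to [d (W o u) = w]. *)
Definition primitive_in (u : vec -> vec) (D : vec -> Prop) (w : form)
  (W : vec -> R) : Prop :=
  forall r, D r -> forall i,
    is_derive (fun x => W (u (upd r i x))) (r i) (w r i).

Definition ex_hessian (W : vec -> R) (p : vec) : Prop := forall i j,
  ex_partial j W p /\ ex_partial i (partial j W) p.

Definition hessian_form (W : vec -> R) (p v : vec) : R :=
  sum3 (fun i => sum3 (fun j => v i * partial i (partial j W) p * v j)).

Definition locally_concave (U : vec -> Prop) (W : vec -> R) : Prop :=
  forall p, U p -> ex_hessian W p /\ forall v, hessian_form W p v <= 0.

Definition locally_strictly_concave (U : vec -> Prop) (W : vec -> R) : Prop :=
  forall p, U p -> ex_hessian W p /\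
    forall v, (exists i, v i <> 0) -> hessian_form W p v < 0.

(* The integration of [eta_lambda] in the variable [u] exists and has property
   [P], for every [lambda] and every choice of the antiderivative.
   A sign to watch: for hyperbolic triangles with angles [r_j + r_k], each edge
   length [l_i] is decreasing in each [r_j], so the diagonal of the Hessian is
   negative and the integration is concave, not convex. *)
Definition integration_is (P : (vec -> Prop) -> (vec -> R) -> Prop)
  (D : vec -> Prop) (y : vec -> vec) (I : R -> Prop) (h s : R -> R) : Prop :=
  forall lam F, antiderivative_on I (fun t => Rpower (h t) lam) F ->
    (exists W, primitive_in (u_coord s lam) D (eta y s F lam) W) /\
    (forall W, primitive_in (u_coord s lam) D (eta y s F lam) W ->
       P (image_of (u_coord s lam) D) W).

(* Main.v *)
(** In all six cases the cosine law takes the form [h (y i) = s (r i) * q r]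
    with a single symmetric factor
    [q r = sqrt (eps * s (r1 + r2 + r3) / (s r1 * s r2 * s r3))]; for triangles
    with edge lengths [r j + r k] this is the half-angle formula through the
    inradius. It gives [d (y i) / d (r j) = s (r i) * B i j] with [B] symmetric,
    so that [sum f (y i) dg (r i)] is closed if and only if
    [f' (y i) * g' (r i) * s (r i)] does not depend on [i].

    Varying the third coordinate in this identity shows that the logarithmic
    derivative of [f'] with respect to [log h] takes the same value at [y i]
    and [y j]. Any two values of [y] are connected through points [r] with
    equal [q], one coordinate of which is pushed to an end of its range; hence
    [f' = c h^lam], and then [g' = c' s^(-lam-1)].

    In the coordinates [u], the Hessian of the integration is [q^lam * B] up to
    a diagonal congruence, and [B] is, up to another one, the negative of the
    sum over the three pairs of [(cos t * (x^2 + z^2) - 2 K x z) / sin t], where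
    [t = r i + r j], [K = 1] or [-1], and [cos], [sin] are replaced by their
    hyperbolic or Euclidean versions. *)

Require Import Defs.
From Stdlib Require Import Reals.
From Stdlib Require Import Lra FunctionalExtensionality ClassicalEpsilon.
From Coquelicot Require Import Coquelicot.
Open Scope R_scope.

(** * Partial derivatives and the Poincare lemma *)

(** The obstacle in the classification is that the balance condition compares only points sharing
    one value of [q], while [q] varies over the domain. A filter at one end of the range of the
    [r i] bridges this: there [s] tends to [0] or to infinity, so [q0 * s] and [q1 * s] run through
    the same values near that end, and what is known about [f] for the factor [q0] transfers to
    [q1]. The same passage spreads the nonvanishing of [f'] and [g'] from one interacting point to
    the whole ranges, which is what makes the logarithmic derivative of [f'] available at all.

    The opposite quantities are given by the cosine law alone, with no regularity. They are
    recovered by inverting [h], which is monotone because [h' = kappa * (1 + sigma * h^2)] has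
    constant sign. The same equation yields closed formulas for the Jacobian: once [h = s (r i) * q]
    is inserted, [1 + sigma * h^2] factors into sines of the sums [r i + r j]. *)

Lemma idx_eq_dec (i j : idx) : {i = j} + {i <> j}.
Proof. decide equality. Qed.

Definition kron (i j : idx) : R :=
  match i, j with i1, i1 | i2, i2 | i3, i3 => 1 | _, _ => 0 end.

Lemma kron_refl i : kron i i = 1.
Proof. now destruct i. Qed.

Lemma kron_neq i j : i <> j -> kron i j = 0.
Proof. destruct i, j; simpl; congruence. Qed.

Lemma upd_eq p i x : upd p i x i = x.
Proof. destruct i; reflexivity. Qed.

Lemma upd_neq p i j x : i <> j -> upd p i x j = p j.
Proof. destruct i, j; simpl; congruence. Qed.

Lemma upd_id p i : upd p i (p i) = p.
Proof. extensionality j. destruct i, j; reflexivity. Qed.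

Definition mkvec (a b c : R) : vec :=
  fun i => match i with i1 => a | i2 => b | i3 => c end.

(** Continuity, like openness in [open_dom], is tested along every map from a uniform space whose
    coordinates are continuous. It then composes directly with segments, coordinate updates and
    two-parameter families. *)
Definition cont_on (D : vec -> Prop) (G : vec -> R) : Prop :=
  forall (X : UniformSpace) (m : X -> vec) z,
    D (m z) -> (forall i, continuous (fun z => m z i) z) ->
    continuous (fun z => G (m z)) z.

Definition open_dom (D : vec -> Prop) : Prop :=
  forall (X : UniformSpace) (m : X -> vec) z,
    D (m z) -> (forall i, continuous (fun z => m z i) z) ->
    locally z (fun z => D (m z)).

(** Differentiability in the form of the chain rule along curves. Partial derivatives alone would
    not give the derivative along a segment, where all coordinates move at once. *)
Definition grad_on (D : vec -> Prop) (G : vec -> R) (A : form) : Prop :=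
  forall (m : R -> vec) t v,
    D (m t) -> (forall i, is_derive (fun t => m t i) t (v i)) ->
    is_derive (fun t => G (m t)) t (sum3 (fun j => A (m t) j * v j)).

Lemma is_derive_upd p j x i : is_derive (fun x => upd p j x i) x (kron j i).
Proof.
  destruct (idx_eq_dec j i) as [->|n].
  - rewrite kron_refl. apply is_derive_ext with (fun x => x); [intros; now rewrite upd_eq|].
    apply (is_derive_id x).
  - rewrite kron_neq by assumption. apply is_derive_ext with (fun x => p i); [intros; now rewrite upd_neq|].
    apply (is_derive_const (p i) x).
Qed.

Lemma continuous_upd p j x i : continuous (fun x => upd p j x i) x.
Proof. apply (ex_derive_continuous (V := R_NormedModule)). eexists. apply is_derive_upd. Qed.

Lemma sum3_kron a j : sum3 (fun i => a i * kron j i) = a j.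
Proof. unfold sum3, kron. destruct j; simpl; ring. Qed.

Lemma grad_partial D G A r j : grad_on D G A -> D r ->
  is_derive (fun x => G (upd r j x)) (r j) (A r j).
Proof.
  intros H Dr.
  replace (A r j) with (sum3 (fun i => A (upd r j (r j)) i * kron j i))
    by now rewrite sum3_kron, upd_id.
  apply (H (fun x => upd r j x)); [now rewrite upd_id|].
  intros i. apply is_derive_upd.
Qed.

Lemma open_upd D r j : open_dom D -> D r -> locally (r j) (fun x => D (upd r j x)).
Proof.
  intros H Dr. apply (H R_UniformSpace (fun x => upd r j x)); [now rewrite upd_id|].
  intros i. apply continuous_upd.
Qed.

Lemma is_derive_eq (f : R -> R) (x l l' : R) : is_derive f x l -> l = l' -> is_derive f x l'.
Proof. now intros H <-. Qed.

Lemma is_derive_Rplus (f g : R -> R) (x l m : R) :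
  is_derive f x l -> is_derive g x m -> is_derive (fun x => f x + g x) x (l + m).
Proof. intros. now apply (is_derive_plus (V := R_NormedModule)). Qed.

Lemma is_derive_Rmult (f g : R -> R) (x l m : R) :
  is_derive f x l -> is_derive g x m ->
  is_derive (fun x => f x * g x) x (l * g x + f x * m).
Proof. intros. apply (is_derive_mult f g); [assumption..|]. intros; apply Rmult_comm. Qed.

Lemma is_derive_Rcomp (f g : R -> R) (x l m : R) :
  is_derive f (g x) l -> is_derive g x m -> is_derive (fun x => f (g x)) x (l * m).
Proof.
  intros Hf Hg. eapply is_derive_eq.
  - apply (is_derive_comp (V := R_NormedModule) f g); eassumption.
  - apply Rmult_comm.
Qed.

Lemma is_derive_sum3 (f : idx -> R -> R) x l :
  (forall i, is_derive (f i) x (l i)) ->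
  is_derive (fun x => sum3 (fun i => f i x)) x (sum3 l).
Proof. intros H. unfold sum3. repeat apply is_derive_Rplus; apply H. Qed.

Lemma is_derive_affine (f : R -> R) (x a t b l : R) :
  is_derive f x l -> is_derive (fun x => a + t * (f x - b)) x (t * l).
Proof.
  intros H. auto_derive; [eexists; exact H|].
  rewrite (is_derive_unique (fun x : R => f x) _ _ H). ring.
Qed.

Lemma is_derive_shift (f : R -> R) (x b l : R) :
  is_derive f x l -> is_derive (fun x => f x - b) x l.
Proof.
  intros H. auto_derive; [eexists; exact H|].
  rewrite (is_derive_unique (fun x : R => f x) _ _ H). ring.
Qed.

Lemma continuous_Rplus {X : UniformSpace} (f g : X -> R) z :
  continuous f z -> continuous g z -> continuous (fun z => f z + g z) z.
Proof. intros. now apply (continuous_plus (V := R_NormedModule)). Qed.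

Lemma continuous_Rmult {X : UniformSpace} (f g : X -> R) z :
  continuous f z -> continuous g z -> continuous (fun z => f z * g z) z.
Proof. intros. now apply (continuous_mult (K := R_AbsRing)). Qed.

Lemma continuous_Rminus {X : UniformSpace} (f g : X -> R) z :
  continuous f z -> continuous g z -> continuous (fun z => f z - g z) z.
Proof. intros. now apply (continuous_minus (V := R_NormedModule)). Qed.

Lemma continuous_sum3 {X : UniformSpace} (f : idx -> X -> R) z :
  (forall i, continuous (f i) z) -> continuous (fun z => sum3 (fun i => f i z)) z.
Proof. intros H. unfold sum3. repeat apply continuous_Rplus; apply H. Qed.

Section Poincare.

Variables (D : vec -> Prop) (a : vec) (w : form) (A : vec -> idx -> idx -> R).
Hypothesis D_open : open_dom D.
Hypothesis D_star : forall r t, D r -> 0 <= t <= 1 ->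
  D (fun i => a i + t * (r i - a i)).
Hypothesis w_grad : forall i, grad_on D (fun r => w r i) (fun r => A r i).
Hypothesis w_cont : forall i, cont_on D (fun r => w r i).
Hypothesis A_cont : forall i j, cont_on D (fun r => A r i j).
Hypothesis A_sym : forall r i j, D r -> A r i j = A r j i.

Let seg (r : vec) (t : R) : vec := fun i => a i + t * (r i - a i).
Let f (r : vec) (t : R) : R := sum3 (fun i => (r i - a i) * w (seg r t) i).
(** The partial derivative of the integrand [f] in [r j]. When [A] is symmetric it is also the
    [t]-derivative of [t * w (seg r t) j]. *)
Let g (j : idx) (r : vec) (t : R) : R :=
  w (seg r t) j + t * sum3 (fun i => (r i - a i) * A (seg r t) i j).

Let seg_continuous (X : UniformSpace) (m : X -> vec) (t : X -> R) z i :
  (forall i, continuous (fun z => m z i) z) -> continuous t z ->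
  continuous (fun z => seg (m z) (t z) i) z.
Proof.
  intros Hm Ht. unfold seg. apply continuous_Rplus; [apply continuous_const|].
  apply continuous_Rmult; [assumption|].
  apply continuous_Rminus; [apply Hm | apply continuous_const].
Qed.

Let f_continuous (X : UniformSpace) (m : X -> vec) (t : X -> R) z :
  D (seg (m z) (t z)) ->
  (forall i, continuous (fun z => m z i) z) -> continuous t z ->
  continuous (fun z => f (m z) (t z)) z.
Proof.
  intros Dz Hm Ht. unfold f.
  apply (continuous_sum3 (fun i z => _)); intros i; (apply continuous_Rmult;
   [apply continuous_Rminus; [apply Hm | apply continuous_const] |
    apply (w_cont _ X (fun z => seg (m z) (t z)) z Dz);
      intros; now apply seg_continuous]).
Qed.

Let g_continuous j (X : UniformSpace) (m : X -> vec) (t : X -> R) z :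
  D (seg (m z) (t z)) ->
  (forall i, continuous (fun z => m z i) z) -> continuous t z ->
  continuous (fun z => g j (m z) (t z)) z.
Proof.
  intros Dz Hm Ht. unfold g.
  apply continuous_Rplus.
  { apply (w_cont _ X (fun z => seg (m z) (t z)) z Dz).
    intros; now apply seg_continuous. }
  apply continuous_Rmult; [assumption|].
  apply (continuous_sum3 (fun i z => _)); intros i; (apply continuous_Rmult;
   [apply continuous_Rminus; [apply Hm | apply continuous_const] |
    apply (A_cont _ _ X (fun z => seg (m z) (t z)) z Dz);
      intros; now apply seg_continuous]).
Qed.

Let f_derive j r t u : D (seg (upd r j u) t) ->
  is_derive (fun u => f (upd r j u) t) u (g j (upd r j u) t).
Proof.
  intros Du. unfold f.
  assert (Hw : forall i, is_derive (fun u => w (seg (upd r j u) t) i) u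
                 (t * A (seg (upd r j u) t) i j)).
  { intros i. eapply is_derive_eq.
    - apply (w_grad i (fun u => seg (upd r j u) t) u (fun i => t * kron j i) Du).
      intros i'. apply (is_derive_affine (fun u => upd r j u i')), is_derive_upd.
    - simpl. transitivity (t * sum3 (fun i' => A (seg (upd r j u) t) i i' * kron j i')).
      + unfold sum3; ring.
      + now rewrite sum3_kron. }
  assert (H : forall i, is_derive (fun u => (upd r j u i - a i) * w (seg (upd r j u) t) i) u
     (kron j i * w (seg (upd r j u) t) i
      + (upd r j u i - a i) * (t * A (seg (upd r j u) t) i j))).
  { intros i. specialize (Hw i).
    apply (is_derive_mult (fun u => upd r j u i - a i));
      [| exact Hw | intros; apply Rmult_comm].
    apply (is_derive_shift (fun u => upd r j u i)), is_derive_upd. }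
  eapply is_derive_eq; [apply (is_derive_sum3 (fun i u => (upd r j u i - a i) * w (seg (upd r j u) t) i) _ _ H)|].
  unfold g. rewrite <- (sum3_kron (w (seg (upd r j u) t)) j). unfold sum3. ring.
Qed.

(** The primitive is the integral of the form along the segment from [a] to [r]. Differentiating
    under the integral sign gives the integral of [g j], which the fundamental theorem evaluates to
    [w r j]. *)
Lemma poincare : exists V : vec -> R, forall r, D r -> forall i,
  is_derive (fun x => V (upd r i x)) (r i) (w r i).
Proof.
  exists (fun r => RInt (f r) 0 1). intros r Dr j.
  assert (D_seg : forall p t, D p -> 0 <= t <= 1 -> D (seg p t)) by exact D_star.
  assert (loc := open_upd D r j D_open Dr).
  assert (m01 : Rmin 0 1 = 0) by (apply Rmin_left; lra).
  assert (M01 : Rmax 0 1 = 1) by (apply Rmax_right; lra).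
  eapply is_derive_eq.
  - apply (is_derive_RInt_param (fun u t => f (upd r j u) t)).
    + eapply filter_imp; [|exact loc]. intros u Du t Ht. rewrite m01, M01 in Ht.
      eexists. apply f_derive. now apply D_seg.
    + intros t Ht. rewrite m01, M01 in Ht.
      assert (Dt : D (seg (upd r j (r j)) t)) by (rewrite upd_id; now apply D_seg).
      (* The derivative of the integrand is known to be [g] only where the point of the segment lies
         in [D], so continuity is transferred locally. *)
      apply continuity_2d_pt_ext_loc with (fun u t => g j (upd r j u) t).
      * assert (L : locally (r j, t) (fun z : R * R => D (seg (upd r j (fst z)) (snd z)))).
        { apply (D_open (prod_UniformSpace R_UniformSpace R_UniformSpace)
            (fun z => seg (upd r j (fst z)) (snd z)) (r j, t)); [exact Dt|].
          intros i. apply seg_continuous.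
          - intros i'. apply (continuous_comp fst (fun x => upd r j x i')).
            apply continuous_fst. apply continuous_upd.
          - apply continuous_snd. }
        apply locally_2d_locally.
        eapply filter_imp; [|exact L]. intros [u v] H; simpl in *.
        symmetry. apply is_derive_unique. now apply f_derive.
      * apply continuity_2d_pt_filterlim.
        apply (g_continuous j (prod_UniformSpace R_UniformSpace R_UniformSpace)
            (fun z => upd r j (fst z)) snd (r j, t)).
        -- exact Dt.
        -- intros i'. apply (continuous_comp fst (fun x => upd r j x i')).
           apply continuous_fst. apply continuous_upd.
        -- apply continuous_snd.
    + eapply filter_imp; [|exact loc]. intros u Du.
      apply (ex_RInt_continuous (V := R_CompleteNormedModule)). intros t Ht. rewrite m01, M01 in Ht.
      apply (f_continuous R_UniformSpace (fun _ => upd r j u) (fun t => t)).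
      * now apply D_seg.
      * intros; apply continuous_const.
      * apply continuous_id.
  - rewrite (RInt_ext _ (fun t => g j r t)).
    2:{ intros t Ht. rewrite m01, M01 in Ht. apply is_derive_unique.
        assert (H : D (seg (upd r j (r j)) t)) by (rewrite upd_id; apply D_seg; [exact Dr|lra]).
        apply f_derive in H. now rewrite (upd_id r j) in H. }
    apply is_RInt_unique.
    assert (s1 : seg r 1 = r) by (extensionality i; unfold seg; ring).
    replace (w r j) with (1 * w (seg r 1) j - 0 * w (seg r 0) j) by (rewrite s1; ring).
    apply (is_RInt_derive (fun t => t * w (seg r t) j)).
    + intros t Ht. rewrite m01, M01 in Ht.
      assert (Dt : D (seg r t)) by now apply D_seg.
      eapply is_derive_eq.
      * apply (is_derive_Rmult (fun t => t) (fun t => w (seg r t) j)).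
        -- apply (is_derive_id t).
        -- apply (w_grad j (fun t => seg r t) t (fun i => r i - a i) Dt).
           intros i. unfold seg. auto_derive; [exact I | ring].
      * unfold g, one, sum3; simpl.
        (* Closedness enters here: the derivative of [w (seg r t) j] along the segment involves row
           [j] of [A], while [g j] involves column [j]. *)
        rewrite !(A_sym _ _ j Dt). ring.
    + intros t Ht. rewrite m01, M01 in Ht.
      apply (g_continuous j R_UniformSpace (fun _ => r) (fun t => t)).
      * now apply D_seg.
      * intros; apply continuous_const.
      * apply continuous_id.
Qed.

End Poincare.

(** * Classification of the closed separated forms *)

Lemma locally_oo a b x : oo a b x -> locally x (oo a b).
Proof.
  intros [Ha Hb]. apply filter_and.
  - exact (open_Rbar_gt a x Ha).
  - exact (open_Rbar_lt b x Hb).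
Qed.

Lemma oo_between a b x y t : oo a b x -> oo a b y -> x <= t <= y -> oo a b t.
Proof.
  intros [Ha _] [_ Hb] [Hx Hy]; split.
  - now apply Rbar_lt_le_trans with x.
  - now apply Rbar_le_lt_trans with y.
Qed.

Lemma oo_MVT a b (f df : R -> R) x y :
  (forall t, oo a b t -> is_derive f t (df t)) -> oo a b x -> oo a b y ->
  exists t, oo a b t /\ f y - f x = df t * (y - x).
Proof.
  intros Hf Hx Hy.
  assert (B : forall t, Rmin x y <= t <= Rmax x y -> oo a b t).
  { intros t. unfold Rmin, Rmax. destruct (Rle_dec x y); intros Ht.
    - now apply (oo_between a b x y).
    - now apply (oo_between a b y x). }
  destruct (MVT_gen f x y df) as [t [Ht E]].
  - intros t Ht. apply Hf, B. lra.
  - intros t Ht. apply continuity_pt_filterlim, (ex_derive_continuous f).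
    eexists. apply Hf, B, Ht.
  - exists t. auto.
Qed.

Lemma oo_constant a b (f : R -> R) x y :
  (forall t, oo a b t -> is_derive f t 0) -> oo a b x -> oo a b y -> f x = f y.
Proof.
  intros Hf Hx Hy. destruct (oo_MVT a b f (fun _ => 0) x y Hf Hx Hy) as [t [_ E]]. lra.
Qed.

Lemma is_derive_Rpower f nu (x l : R) : is_derive f x l -> 0 < f x ->
  is_derive (fun x => Rpower (f x) nu) x (nu * Rpower (f x) (nu - 1) * l).
Proof.
  intros Hf Hp. apply (is_derive_Rcomp (fun z => Rpower z nu) f); [|assumption].
  apply is_derive_Reals. now apply derivable_pt_lim_power.
Qed.

Lemma Rpower_pos x nu : 0 < Rpower x nu.
Proof. apply exp_pos. Qed.

Lemma Rpower_pred x nu : 0 < x -> Rpower x nu = Rpower x (nu - 1) * x.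
Proof.
  intros H. rewrite <- (Rpower_1 x) at 3 by assumption. rewrite <- Rpower_plus.
  f_equal; ring.
Qed.

(** * Smoothness of antiderivatives of real powers *)

Inductive span (gen : (R -> R) -> Prop) : (R -> R) -> Prop :=
| span_gen f : gen f -> span gen f
| span_plus f g : span gen f -> span gen g -> span gen (fun x => f x + g x)
| span_scal c f : span gen f -> span gen (fun x => c * f x).

(** The span is closed under differentiation as soon as its generators have derivatives in it. Hence
    every iterated derivative of [F], from the first on, agrees on the interval with an element of
    the span and is differentiable. *)
Lemma smooth_span a b (gen : (R -> R) -> Prop) :
  (forall f, gen f -> exists g, span gen g /\ forall x, oo a b x -> is_derive f x (g x)) ->
  forall F F', span gen F' -> (forall x, oo a b x -> is_derive F x (F' x)) ->
  smooth_on (oo a b) F.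
Proof.
  intros Hgen.
  assert (Hspan : forall f, span gen f ->
    exists g, span gen g /\ forall x, oo a b x -> is_derive f x (g x)).
  { intros f Hf. induction Hf as [f Hf|f g _ [f' [Sf Df]] _ [g' [Sg Dg]]|c f _ [f' [Sf Df]]].
    - now apply Hgen.
    - exists (fun x => f' x + g' x). split; [now constructor|].
      intros x Hx. apply is_derive_Rplus; auto.
    - exists (fun x => c * f' x). split; [now constructor|].
      intros x Hx. apply is_derive_scal. auto. }
  intros F F' SF DF.
  assert (Hn : forall n, exists g, span gen g /\
                forall x, oo a b x -> is_derive (Derive_n F n) x (g x)).
  { induction n as [|n [g [Sg Dg]]].
    - exists F'. auto.
    - destruct (Hspan g Sg) as [g' [Sg' Dg']]. exists g'. split; [assumption|].
      intros x Hx. apply is_derive_ext_loc with g; [|now apply Dg'].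
      generalize (locally_oo a b x Hx). apply filter_imp. intros u Hu.
      symmetry. now apply is_derive_unique, Dg. }
  intros [|n] x Hx; [exact I|].
  destruct (Hn n) as [g [_ Dg]]. eexists. now apply Dg.
Qed.

Lemma smooth_on_twice I f x : smooth_on I f -> I x ->
  ex_derive f x /\ ex_derive (Derive f) x.
Proof. intros H Hx. split; [apply (H 1%nat x Hx)|apply (H 2%nat x Hx)]. Qed.

(** The Riccati equation makes the derivative of [h^nu] a combination of [h^(nu - 1)] and
    [h^(nu + 1)], so the real powers of [h] span a space closed under differentiation. *)
Lemma smooth_Rpower_riccati a b (h : R -> R) kappa sigma F lam :
  (forall t, oo a b t -> 0 < h t) ->
  (forall t, oo a b t -> is_derive h t (kappa * (1 + sigma * (h t) ^ 2))) ->
  antiderivative_on (oo a b) (fun t => Rpower (h t) lam) F -> smooth_on (oo a b) F.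
Proof.
  intros Hp Hd HF.
  set (gen f := exists nu, f = fun t => Rpower (h t) nu).
  apply (smooth_span a b gen) with (fun t => Rpower (h t) lam).
  - intros f [nu ->].
    exists (fun t => nu * kappa * Rpower (h t) (nu - 1) + nu * kappa * sigma * Rpower (h t) (nu + 1)).
    split.
    + apply span_plus; apply span_scal, span_gen; eexists; reflexivity.
    + intros t Ht. eapply is_derive_eq.
      * apply is_derive_Rpower; auto.
      * rewrite (Rpower_pred (h t) (nu + 1)), (Rpower_pred (h t) (nu + 1 - 1)) by auto.
        replace (nu + 1 - 1 - 1) with (nu - 1) by ring. ring.
  - apply span_gen. now exists lam.
  - exact HF.
Qed.

(** Since [s'' = c2 * s], the products of a real power of [s] and a natural power of [s'] span a
    space closed under differentiation. The exponent of [s'] is natural because [s'] may change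
    sign. *)
Lemma smooth_Rpower_linear2 a b (s ds : R -> R) c2 G nu :
  (forall x, oo a b x -> 0 < s x) -> (forall x, is_derive s x (ds x)) ->
  (forall x, is_derive ds x (c2 * s x)) ->
  antiderivative_on (oo a b) (fun x => Rpower (s x) nu) G -> smooth_on (oo a b) G.
Proof.
  intros Hp Hs Hds HG.
  set (gen f := exists nu (n : nat), f = fun t => Rpower (s t) nu * ds t ^ n).
  apply (smooth_span a b gen) with (fun t => Rpower (s t) nu).
  - intros f [mu [n ->]].
    (* For [n = 0] the factor [INR n] removes the second term, so the value of [pred n] is
       harmless. *)
    exists (fun t => mu * (Rpower (s t) (mu - 1) * ds t ^ (S n))
                     + INR n * c2 * (Rpower (s t) (mu + 1) * ds t ^ (pred n))).
    split.
    + apply span_plus; apply span_scal, span_gen; do 2 eexists; reflexivity.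
    + intros t Ht. eapply is_derive_eq.
      * apply is_derive_Rmult; [apply is_derive_Rpower; auto|].
        apply (is_derive_pow ds n t _ (Hds t)).
      * rewrite (Rpower_pred (s t) (mu + 1)) by auto.
        replace (mu + 1 - 1) with mu by ring. simpl. ring.
  - replace (fun t => Rpower (s t) nu) with (fun t => Rpower (s t) nu * ds t ^ 0)
      by (extensionality t; simpl; ring).
    apply span_gen. now exists nu, O.
  - exact HG.
Qed.

Lemma closed_on_ext D w w' : open_dom D -> eq_form_on D w w' ->
  closed_on D w' -> closed_on D w.
Proof.
  intros HD E Hc r Dr.
  assert (L : forall i j, locally (r j) (fun x => w' (upd r j x) i = w (upd r j x) i)).
  { intros i j. generalize (open_upd D r j HD Dr). apply filter_imp.
    intros x Dx. symmetry. now apply E. }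
  intros i j. destruct (Hc r Dr i j) as [Hex Heq]. split.
  - unfold ex_partial in *. eapply ex_derive_ext_loc; [|exact Hex]. exact (L i j).
  - unfold partial in *.
    transitivity (Derive (fun x => w' (upd r j x) i) (r j)).
    + symmetry. exact (Derive_ext_loc _ _ _ (L i j)).
    + rewrite Heq. exact (Derive_ext_loc _ _ _ (L j i)).
Qed.

(** * Closed separated forms under an abstract cosine law *)

Section Classification.

Variables (D : vec -> Prop) (y : form) (ia ib ja jb : Rbar).
Variables (h s ds : R -> R) (kappa sigma c2 : R).
Variables (q : vec -> R) (B : vec -> idx -> idx -> R) (Q : vec -> idx -> R).
Variable G : (R -> Prop) -> Prop.

Let I := oo ia ib.
Let J := oo ja jb.
Let dh t := kappa * (1 + sigma * (h t) ^ 2).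

Hypothesis h_pos : forall t, I t -> 0 < h t.
Hypothesis h_derive : forall t, I t -> is_derive h t (dh t).
Hypothesis dh_neq0 : forall t, I t -> dh t <> 0.
Hypothesis s_pos : forall x, J x -> 0 < s x.
Hypothesis s_derive : forall x, is_derive s x (ds x).
Hypothesis ds_derive : forall x, is_derive ds x (c2 * s x).
Hypothesis J_1 : J 1.
Hypothesis D_open : open_dom D.
Hypothesis D_J : forall r i, D r -> J (r i).
Hypothesis D_I : forall r i, D r -> I (y r i).
Hypothesis h_y : forall r i, D r -> h (y r i) = s (r i) * q r.
Hypothesis q_pos : forall r, D r -> 0 < q r.
Hypothesis y_grad : forall i, grad_on D (fun r => y r i) (fun r j => s (r i) * B r i j).
Hypothesis B_sym : forall r i j, D r -> B r i j = B r j i.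
(** Differentiating [h (y i) = s (r i) * q] in [r k] with [k <> i] touches only [q]. Thus [Q r k]
    stands for the [r k]-derivative of [q], which explains its independence of [i]. *)
Hypothesis B_Q : forall r i k, D r -> i <> k -> dh (y r i) * B r i k = Q r k.
Hypothesis Q_neq0 : forall r k, D r -> Q r k <> 0.
Hypothesis I_hit : forall t, I t -> exists r i, D r /\ y r i = t.
Hypothesis J_hit : forall x, J x -> exists r i, D r /\ r i = x.
Hypothesis G_filter : ProperFilter G.
Hypothesis connected : forall r i, D r ->
  G (fun x => exists r', D r' /\ r' i1 = r i /\ r' i2 = x /\ q r' = q r).
(** A property of the values [q0 * s x] that holds near the end of the range holds there for
    [q1 * s x] too: multiplying [s] by a constant amounts to a change of variable preserving the
    end. *)
Hypothesis G_scale : forall (P : R -> Prop) q0 q1, 0 < q0 -> 0 < q1 ->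
  G (fun x => P (q0 * s x)) -> G (fun x => P (q1 * s x)).

Lemma h_injective t t' : I t -> I t' -> h t = h t' -> t = t'.
Proof.
  intros Ht Ht' E. destruct (oo_MVT ia ib h dh t t') as [c [Hc M]]; auto.
  rewrite E in M. assert (N := dh_neq0 c Hc).
  assert (t' - t = 0) by (apply (Rmult_eq_reg_l (dh c)); [lra|assumption]). lra.
Qed.

Lemma separated_partial f g r i j : D r ->
  ex_derive f (y r i) -> ex_derive (Derive g) (r i) ->
  is_derive (fun x => separated_form y f g (upd r j x) i) (r j)
    (Derive f (y r i) * (s (r i) * B r i j) * Derive g (r i)
     + f (y r i) * (Derive (Derive g) (r i) * kron j i)).
Proof.
  intros Dr Hf Hg. unfold separated_form.
  assert (Hf' := Derive_correct _ _ Hf). assert (Hg' := Derive_correct _ _ Hg).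
  assert (Hy := grad_partial D _ _ r j (y_grad i) Dr).
  assert (Hu := is_derive_upd r j (r j) i).
  eapply is_derive_eq.
  - apply is_derive_Rmult.
    + apply (is_derive_Rcomp f (fun x => y (upd r j x) i)); [|exact Hy].
      rewrite upd_id. exact Hf'.
    + apply (is_derive_Rcomp (Derive g) (fun x => upd r j x i)); [|exact Hu].
      rewrite upd_id. exact Hg'.
  - cbv beta. rewrite !upd_id. reflexivity.
Qed.

Lemma separated_closed f g :
  (forall r i, D r -> ex_derive f (y r i) /\ ex_derive (Derive g) (r i)) ->
  (closed_on D (separated_form y f g) <->
   forall r i j, D r -> Derive f (y r i) * Derive g (r i) * s (r i)
                      = Derive f (y r j) * Derive g (r j) * s (r j)).
Proof.
  intros Hfg.
  assert (P : forall r i j, D r -> is_derive (fun x => separated_form y f g (upd r j x) i) (r j)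
    (Derive f (y r i) * (s (r i) * B r i j) * Derive g (r i)
     + f (y r i) * (Derive (Derive g) (r i) * kron j i)))
    by (intros; apply separated_partial; try apply Hfg; assumption).
  assert (P' : forall r i j, D r -> partial j (fun p => separated_form y f g p i) r =
    Derive f (y r i) * (s (r i) * B r i j) * Derive g (r i)
     + f (y r i) * (Derive (Derive g) (r i) * kron j i))
    by (intros; apply is_derive_unique; auto).
  split.
  - intros Hc r i j Dr. destruct (idx_eq_dec i j) as [->|n]; [reflexivity|].
    destruct (Hc r Dr i j) as [_ E]. rewrite !P' in E by assumption.
    rewrite !kron_neq, (B_sym r j i Dr) in E by congruence.
    (* The off-diagonal entry [B r i j] is nonzero because its multiple [Q r j] is. *)
    apply (Rmult_eq_reg_r (B r i j)); [lra|].
    intros Z. apply (Q_neq0 r j Dr). rewrite <- (B_Q r i j Dr n), Z. ring.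
  - intros E r Dr i j. split; [eexists; now apply P|]. rewrite !P' by assumption.
    destruct (idx_eq_dec i j) as [->|n]; [reflexivity|].
    rewrite !kron_neq, (B_sym r j i Dr) by congruence.
    transitivity (Derive f (y r i) * Derive g (r i) * s (r i) * B r i j); [ring|].
    rewrite (E r i j Dr). ring.
Qed.

(** * From a closed form to powers of [h] and [s] *)

Section Forward.

Variables f g : R -> R.
Hypothesis f_smooth : smooth_on I f.
Hypothesis g_smooth : smooth_on J g.
Hypothesis balanced : forall r i j, D r ->
  Derive f (y r i) * Derive g (r i) * s (r i) = Derive f (y r j) * Derive g (r j) * s (r j).
Hypothesis fg_interacting : interacting D y f g.

Lemma y_from_q r r' i i' : D r -> D r' -> r' i' = r i -> q r' = q r -> y r' i' = y r i.
Proof.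
  intros Dr Dr' Er Eq. apply h_injective; auto. now rewrite !h_y, Er, Eq by assumption.
Qed.

(** At the interacting point the common product is nonzero; connecting it to the end of the range
    shows [f'] and [g'] to be nonzero there. Rescaling passes from the factor [q r0] to [q r], and
    the balance at a point connected to [r] brings the nonvanishing back to [y r i] and [r i]. *)
Lemma derivatives_neq0 r i : D r -> Derive f (y r i) <> 0 /\ Derive g (r i) <> 0.
Proof.
  intros Dr. destruct fg_interacting as [r0 [i0 [D0 [Hf0 Hg0]]]].
  (* Nonvanishing of [f'] is stated at the value [z] of [h] and not at the argument of [f], which is
     the shape that [G_scale] can move between factors. *)
  set (P z := exists t, I t /\ h t = z /\ Derive f t <> 0).
  assert (step : G (fun x => P (q r0 * s x) /\ Derive g x <> 0)).
  { generalize (connected r0 i0 D0). apply filter_imp.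
    intros x [r' [D' [E1 [E2 Eq]]]].
    assert (Ey := y_from_q r0 r' i0 i1 D0 D' E1 Eq).
    assert (N : Derive f (y r' i1) * Derive g (r' i1) * s (r' i1) <> 0).
    { rewrite Ey, E1. repeat apply Rmult_integral_contrapositive_currified; try assumption.
      apply Rgt_not_eq, s_pos, D_J, D0. }
    rewrite (balanced r' i1 i2 D') in N. split.
    - exists (y r' i2). split; [|split].
      + now apply D_I.
      + rewrite h_y, E2, Eq by assumption. ring.
      + intros Z. apply N. rewrite Z. ring.
    - intros Z. apply N. rewrite E2, Z. ring. }
  assert (stepP : G (fun x => P (q r * s x))).
  { apply G_scale with (q r0); auto.
    revert step. apply filter_imp. intros x [H _]. exact H. }
  destruct (filter_ex _ (filter_and _ _ stepP (filter_and _ _ step (connected r i Dr))))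
    as [x [[t [It [Et Ft]]] [[_ Gx] [r' [D' [E1 [E2 Eq]]]]]]].
  assert (Ey := y_from_q r r' i i1 Dr D' E1 Eq).
  assert (t = y r' i2).
  { apply h_injective; auto. rewrite Et, h_y, E2, Eq by assumption. ring. }
  subst t.
  assert (N : Derive f (y r' i2) * Derive g (r' i2) * s (r' i2) <> 0).
  { rewrite E2 in *. repeat apply Rmult_integral_contrapositive_currified; try assumption.
    apply Rgt_not_eq, s_pos. rewrite <- E2. now apply D_J. }
  rewrite (balanced r' i2 i1 D'), Ey, E1 in N.
  split; intros Z; apply N; rewrite Z; ring.
Qed.

(* The logarithmic derivative of [f'] with respect to [log h]. *)
Let L t := Derive (Derive f) t / Derive f t * (h t / dh t).

Lemma L_balanced r : D r -> L (y r i1) = L (y r i2).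
Proof.
  intros Dr.
  assert (H : forall i, i <> i3 ->
    is_derive (fun x => Derive f (y (upd r i3 x) i) * (Derive g (r i) * s (r i))) (r i3)
      (Derive (Derive f) (y r i) * (s (r i) * B r i i3) * (Derive g (r i) * s (r i)))).
  { intros i _. eapply is_derive_eq.
    - apply is_derive_Rmult; [|apply (is_derive_const (V := R_NormedModule))].
      apply (is_derive_Rcomp (Derive f) (fun x => y (upd r i3 x) i)).
      + rewrite upd_id. apply Derive_correct, (smooth_on_twice I f); auto.
      + exact (grad_partial D _ _ r i3 (y_grad i) Dr).
    - unfold zero; simpl. ring. }
  assert (E : Derive (Derive f) (y r i1) * (s (r i1) * B r i1 i3) * (Derive g (r i1) * s (r i1))
            = Derive (Derive f) (y r i2) * (s (r i2) * B r i2 i3) * (Derive g (r i2) * s (r i2))).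
  { rewrite <- (is_derive_unique _ _ _ (H i2 ltac:(discriminate))).
    symmetry. apply is_derive_unique.
    eapply is_derive_ext_loc; [|exact (H i1 ltac:(discriminate))].
    generalize (open_upd D r i3 D_open Dr). apply filter_imp. intros x Dx.
    generalize (balanced _ i1 i2 Dx). simpl. lra. }
  destruct (derivatives_neq0 r i1 Dr) as [F1 G1]. destruct (derivatives_neq0 r i2 Dr) as [F2 G2].
  assert (W := balanced r i1 i2 Dr).
  assert (B1 := B_Q r i1 i3 Dr ltac:(discriminate)).
  assert (B2 := B_Q r i2 i3 Dr ltac:(discriminate)).
  assert (N := Q_neq0 r i3 Dr).
  assert (d1 := dh_neq0 _ (D_I r i1 Dr)). assert (d2 := dh_neq0 _ (D_I r i2 Dr)).
  assert (s1 := s_pos _ (D_J r i1 Dr)). assert (s2 := s_pos _ (D_J r i2 Dr)).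
  unfold L. rewrite !h_y by assumption.
  replace (B r i1 i3) with (Q r i3 / dh (y r i1)) in E by (rewrite <- B1; field; assumption).
  replace (B r i2 i3) with (Q r i3 / dh (y r i2)) in E by (rewrite <- B2; field; assumption).
  (* Besides the derivative [Q r i3] of [q], the balanced product itself is divided out. It is the
     same for [i1] and [i2], and nonzero. *)
  apply (Rmult_eq_reg_r (Q r i3 * (Derive f (y r i1) * Derive g (r i1) * s (r i1)))).
  2:{ repeat apply Rmult_integral_contrapositive_currified; lra. }
  rewrite W at 2.
  transitivity (q r * (Derive (Derive f) (y r i1) * (s (r i1) * (Q r i3 / dh (y r i1))) *
    (Derive g (r i1) * s (r i1)))); [field; auto|].
  rewrite E. field; auto.
Qed.

Lemma L_constant t t' : I t -> I t' -> L t = L t'.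
Proof.
  intros It It'.
  assert (far : forall t, I t -> exists q0, 0 < q0 /\
    G (fun x => exists t2, I t2 /\ h t2 = q0 * s x /\ L t2 = L t)).
  { clear t t' It It'. intros t It. destruct (I_hit t It) as [r [i [Dr Et]]].
    exists (q r). split; [auto|].
    generalize (connected r i Dr). apply filter_imp. intros x [r' [D' [E1 [E2 Eq]]]].
    exists (y r' i2). split; [auto|]. split.
    - rewrite h_y, E2, Eq by assumption. ring.
    - rewrite <- (L_balanced r' D'), <- Et. f_equal. now apply y_from_q. }
  destruct (far t It) as [q0 [q0p F0]]. destruct (far t' It') as [q1 [q1p F1]].
  (* After rescaling, both tails are described by the same values of [h], so they share a point, and
     there injectivity of [h] identifies the two arguments of [L]. *)
  apply (G_scale (fun z => exists t2, I t2 /\ h t2 = z /\ L t2 = L t) q0 q1) in F0; auto.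
  destruct (filter_ex _ (filter_and _ _ F0 F1)) as [x [[t2 [I2 [H2 L2]]] [t3 [I3 [H3 L3]]]]].
  rewrite <- L2, <- L3. f_equal. apply h_injective; auto. congruence.
Qed.

Lemma f_is_power : exists lam c, c <> 0 /\ forall t, I t -> Derive f t = c * Rpower (h t) lam.
Proof.
  destruct fg_interacting as [r0 [i0 [D0 _]]].
  set (t0 := y r0 i0). assert (It0 : I t0) by now apply D_I.
  assert (F0 : forall t, I t -> Derive f t <> 0).
  { intros t It. destruct (I_hit t It) as [r [i [Dr <-]]]. now apply derivatives_neq0. }
  set (lam := L t0).
  (* [h^(-lam)] is the integrating factor: [L = lam] says exactly that the derivative of this
     product vanishes. *)
  set (u t := Derive f t * Rpower (h t) (- lam)).
  assert (Hu : forall t, I t -> is_derive u t 0).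
  { intros t It. eapply is_derive_eq.
    - apply is_derive_Rmult.
      + apply Derive_correct, (smooth_on_twice I f); auto.
      + apply is_derive_Rpower; auto.
    - assert (E : L t = lam) by now apply L_constant.
      assert (N := F0 t It). assert (d := dh_neq0 t It). assert (p := h_pos t It).
      cbv beta. rewrite (Rpower_pred (h t) (- lam)) by assumption.
      generalize (Rpower (h t) (- lam - 1)). intros P. rewrite <- E. unfold L.
      field. auto. }
  exists lam, (u t0). split.
  - apply Rmult_integral_contrapositive_currified; [auto|apply Rgt_not_eq, Rpower_pos].
  - intros t It. rewrite (oo_constant ia ib u t0 t Hu It0 It). unfold u.
    rewrite Rmult_assoc, <- Rpower_plus, Rplus_opp_l, Rpower_O by auto. ring.
Qed.

Lemma g_is_power lam c : c <> 0 -> (forall t, I t -> Derive f t = c * Rpower (h t) lam) ->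
  exists c', c' <> 0 /\ forall x, J x -> Derive g x = c' / Rpower (s x) (lam + 1).
Proof.
  intros Hc Hf.
  (* With [f' = c * h^lam] the balanced product becomes [c * q^lam * M (r i)]. Hence [M] agrees at
     all coordinates of one point, and any two values of [M] are compared with a third near the end
     of the range. *)
  set (M x := Derive g x * Rpower (s x) (lam + 1)).
  assert (HM : forall r i, D r -> Derive f (y r i) * Derive g (r i) * s (r i)
                 = c * Rpower (q r) lam * M (r i)).
  { intros r i Dr. unfold M. assert (sp := s_pos _ (D_J r i Dr)).
    rewrite Hf by auto. rewrite h_y by assumption.
    rewrite <- Rpower_mult_distr by auto.
    rewrite (Rpower_pred _ (lam + 1)) by assumption.
    replace (lam + 1 - 1) with lam by ring. ring. }
  assert (far : forall x, J x -> G (fun x2 => M x = M x2)).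
  { intros x Jx. destruct (J_hit x Jx) as [r [i [Dr <-]]].
    generalize (connected r i Dr). apply filter_imp. intros x2 [r' [D' [E1 [E2 Eq]]]].
    assert (E := balanced r' i1 i2 D'). rewrite !HM, E1, E2 in E by assumption.
    apply (Rmult_eq_reg_l (c * Rpower (q r') lam)); [exact E|].
    apply Rmult_integral_contrapositive_currified; [auto|apply Rgt_not_eq, Rpower_pos]. }
  assert (MC : forall x x', J x -> J x' -> M x = M x').
  { intros x x' Jx Jx'. destruct (filter_ex _ (filter_and _ _ (far x Jx) (far x' Jx'))) as [z [-> ->]].
    reflexivity. }
  exists (M 1). split.
  - apply Rmult_integral_contrapositive_currified; [|apply Rgt_not_eq, Rpower_pos].
    destruct (J_hit 1 J_1) as [r [i [Dr E]]]. rewrite <- E. now apply derivatives_neq0.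
  - intros x Jx. rewrite (MC 1 x J_1 Jx). unfold M. field. apply Rgt_not_eq, Rpower_pos.
Qed.

End Forward.

Definition u_primitive lam x := RInt (fun t => Rpower (s t) (- lam - 1)) 1 x.

Lemma u_primitive_derive lam x : J x -> is_derive (u_primitive lam) x (Rpower (s x) (- lam - 1)).
Proof.
  intros Jx.
  assert (C : forall x, J x -> continuous (fun t => Rpower (s t) (- lam - 1)) x).
  { intros z Jz. apply (ex_derive_continuous (V := R_NormedModule)).
    eexists. apply is_derive_Rpower; auto. }
  apply (is_derive_RInt (V := R_NormedModule) (fun t => Rpower (s t) (- lam - 1)) _ 1 x); [|auto].
  generalize (locally_oo ja jb x Jx). apply filter_imp. intros z Jz.
  apply (RInt_correct (V := R_CompleteNormedModule)).
  apply (ex_RInt_continuous (V := R_CompleteNormedModule)). intros t Ht. apply C.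
  revert Ht. unfold Rmin, Rmax. destruct (Rle_dec 1 z); intros Ht.
  - now apply (oo_between ja jb 1 z).
  - now apply (oo_between ja jb z 1).
Qed.

Lemma Rpower_opp_inv x nu : Rpower x (- nu - 1) = / Rpower x (nu + 1).
Proof. rewrite <- Rpower_Ropp. f_equal. ring. Qed.

Lemma nonconstant_of_derive a b (f df : R -> R) x : oo a b x ->
  (forall t, oo a b t -> is_derive f t (df t)) -> (forall t, oo a b t -> df t <> 0) ->
  nonconstant_on (oo a b) f.
Proof.
  intros Hx Hf N.
  assert (locr := locally_oo a b x Hx).
  destruct locr as [eps He].
  assert (Hy : oo a b (x + eps / 2)).
  { apply He. unfold ball; simpl; unfold AbsRing_ball, abs, minus, plus, opp; simpl.
    destruct eps as [e pe]; simpl. rewrite Rabs_pos_eq; lra. }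
  exists x, (x + eps / 2). repeat split; try assumption; try apply Hx; try apply Hy.
  intros E. destruct (oo_MVT a b f df x (x + eps / 2) Hf Hx Hy) as [t [Ht M]].
  apply (N t Ht). apply (Rmult_eq_reg_r (x + eps / 2 - x)); destruct eps as [e pe]; simpl in *; lra.
Qed.

Variable A : (R -> R) -> (R -> R) -> Prop.
Hypothesis A_weak : forall f g, interacting D y f g -> A f g.
Hypothesis A_strong : forall f g, smooth_on I f -> smooth_on J g ->
  nonconstant_on I f -> nonconstant_on J g -> A f g -> interacting D y f g.

(** [A] stays abstract so that both versions of the list follow: the hypotheses say that for smooth
    non-constant pairs it amounts to having an interacting point. *)
Theorem classification : list_of_closed_forms A D y I J h s.
Proof.
  intros w. split.
  - intros [Hc [f [g [Sf [Sg [Nf [Ng [Afg E]]]]]]]].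
    assert (inter := A_strong f g Sf Sg Nf Ng Afg).
    assert (Hfg : forall r i, D r -> ex_derive f (y r i) /\ ex_derive (Derive g) (r i)).
    { intros r i Dr. split.
      - apply (smooth_on_twice I f); auto.
      - apply (smooth_on_twice J g); auto. }
    assert (bal : forall r i j, D r -> Derive f (y r i) * Derive g (r i) * s (r i)
                      = Derive f (y r j) * Derive g (r j) * s (r j)).
    { apply (separated_closed f g Hfg). eapply closed_on_ext; [exact D_open| |exact Hc].
      intros r Dr i. symmetry. now apply E. }
    destruct (f_is_power f g Sf bal inter) as [lam [c [c0 Hf]]].
    destruct (g_is_power f g bal inter lam c c0 Hf) as [c' [c0' Hg]].
    (* [f / c] is an antiderivative of [h^lam]; the constants of [f'] and of [g'] both go into the
       scale. *)
    exists lam, (c * c'), (fun t => f t / c). split; [|split].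
    + now apply Rmult_integral_contrapositive_currified.
    + intros t It. eapply is_derive_ext; [intros; apply Rmult_comm|].
      eapply is_derive_eq.
      * apply is_derive_scal. apply Derive_correct, (smooth_on_twice I f); auto.
      * rewrite Hf by assumption. field. assumption.
    + intros r Dr i. rewrite E by assumption. unfold separated_form, eta.
      rewrite Hg by auto. field. repeat split; try assumption; apply Rgt_not_eq, Rpower_pos.
  - intros [lam [c [F [c0 [HF E]]]]].
    assert (DF : forall t, I t -> is_derive (fun t => c * F t) t (c * Rpower (h t) lam)).
    { intros t It. apply is_derive_scal. now apply HF. }
    assert (DF' : forall t, I t -> Derive (fun t => c * F t) t = c * Rpower (h t) lam)
      by (intros; apply is_derive_unique; auto).
    (* The coordinate [u i] is itself a valid [g], having derivative [s^(-lam - 1)]; the scale is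
       absorbed by [f = c * F]. *)
    set (g := u_primitive lam).
    assert (Dg : forall x, J x -> Derive g x = Rpower (s x) (- lam - 1)).
    { intros x Jx. now apply is_derive_unique, u_primitive_derive. }
    assert (SF : smooth_on I (fun t => c * F t)).
    { intros n x Ix. apply ex_derive_n_scal_l.
      now apply (smooth_Rpower_riccati ia ib h kappa sigma F lam). }
    assert (SG : smooth_on J g).
    { apply (smooth_Rpower_linear2 ja jb s ds c2 g (- lam - 1)); auto.
      intros x Jx. now apply u_primitive_derive. }
    assert (Eq : eq_form_on D w (separated_form y (fun t => c * F t) g)).
    { intros r Dr i. rewrite E by assumption. unfold separated_form, eta.
      rewrite Dg, Rpower_opp_inv by auto. unfold Rdiv; ring. }
    assert (DF0 : forall t, I t -> c * Rpower (h t) lam <> 0).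
    { intros. apply Rmult_integral_contrapositive_currified; [auto|apply Rgt_not_eq, Rpower_pos]. }
    destruct (J_hit 1 J_1) as [r0 [i0 [D0 _]]].
    split.
    + apply (closed_on_ext D _ _ D_open Eq). apply separated_closed.
      * intros r i Dr. split.
        -- eexists. apply DF. auto.
        -- apply (smooth_on_twice J g); auto.
      * intros r i j Dr.
        assert (H : forall i, Derive (fun t => c * F t) (y r i) * Derive g (r i) * s (r i)
                     = c * Rpower (q r) lam).
        { clear i j. intros i. rewrite DF', Dg by auto.
          rewrite h_y by assumption. assert (sp := s_pos _ (D_J r i Dr)).
          rewrite <- Rpower_mult_distr by auto.
          transitivity (c * Rpower (q r) lam * (Rpower (s (r i)) lam *
             (Rpower (s (r i)) (- lam - 1) * s (r i)))); [ring|].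
          replace (- lam - 1) with (- lam - 1) by ring.
          rewrite <- Rpower_pred by assumption.
          rewrite <- Rpower_plus, Rplus_opp_r, Rpower_O by assumption. ring. }
        now rewrite !H.
    + exists (fun t => c * F t), g. repeat split; try assumption.
      * apply (nonconstant_of_derive ia ib _ (fun t => c * Rpower (h t) lam) (y r0 i0)); auto.
        now apply D_I.
      * apply (nonconstant_of_derive ja jb _ (fun x => Rpower (s x) (- lam - 1)) 1); auto.
        -- intros x Jx. now apply u_primitive_derive.
        -- intros. apply Rgt_not_eq, Rpower_pos.
      * apply A_weak. exists r0, i0. split; [assumption|]. split.
        -- rewrite DF' by auto. auto.
        -- rewrite Dg by auto. apply Rgt_not_eq, Rpower_pos.
Qed.

End Classification.

(** * The Hessian in the coordinate u *)

Lemma oo_increasing a b (f df : R -> R) x y : (forall t, oo a b t -> is_derive f t (df t)) ->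
  (forall t, oo a b t -> 0 < df t) -> oo a b x -> oo a b y -> x < y -> f x < f y.
Proof.
  intros Hf Hp Hx Hy L. destruct (oo_MVT a b f df x y Hf Hx Hy) as [t [Ht E]].
  assert (0 < df t * (y - x)) by (apply Rmult_lt_0_compat; [auto|lra]). lra.
Qed.

(** Only [g (f t) = t] is assumed. The intermediate value theorem on a closed interval around [x]
    shows that a neighbourhood of [f x] consists of values of [f], so there [g] is a two-sided
    inverse and the theorem on inverse functions applies. *)
Lemma inverse_derive a b (f df g : R -> R) x :
  (forall t, oo a b t -> is_derive f t (df t)) -> (forall t, oo a b t -> 0 < df t) ->
  (forall t, oo a b t -> g (f t) = t) -> oo a b x ->
  locally (f x) (fun z => oo a b (g z) /\ f (g z) = z) /\ is_derive g (f x) (/ df x).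
Proof.
  intros Hf Hp Hg Hx.
  destruct (locally_oo a b x Hx) as [eps He].
  set (d := eps / 2). assert (dp : 0 < d) by (destruct eps; unfold d; simpl; lra).
  assert (Hd : forall t, x - d <= t <= x + d -> oo a b t).
  { intros t Ht. apply He. unfold ball; simpl; unfold AbsRing_ball, abs, minus, plus, opp; simpl.
    apply Rabs_def1; unfold d in *; destruct eps; simpl in *; lra. }
  assert (C : forall t, x - d <= t <= x + d -> continuity_pt f t).
  { intros t Ht. apply continuity_pt_filterlim, (ex_derive_continuous f).
    eexists. apply Hf. auto. }
  assert (inc : forall u v, x - d <= u -> u < v -> v <= x + d -> f u < f v).
  { intros. apply (oo_increasing a b f df); auto; apply Hd; lra. }
  assert (surj : forall z, f (x - d) <= z <= f (x + d) ->
             x - d <= g z <= x + d /\ f (g z) = z).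
  { intros z Hz. destruct (Ranalysis5.f_interv_is_interv f (x - d) (x + d) z) as [t [Ht E]]; auto.
    - lra.
    - rewrite <- E, Hg by auto. auto. }
  assert (lo : f (x - d) < f x) by (apply inc; lra).
  assert (hi : f x < f (x + d)) by (apply inc; lra).
  assert (gx : g (f x) = x) by auto.
  split.
  - apply filter_imp with (fun z => f (x - d) < z /\ z < f (x + d)).
    + intros z Hz. destruct (surj z) as [H1 H2]; [lra|]. auto.
    + apply filter_and.
      * exact (open_gt _ _ lo).
      * exact (open_lt _ _ hi).
  - assert (Cg : continuity_pt g (f x)).
    { apply (Ranalysis5.continuity_pt_recip_interv f g (x - d) (x + d)); auto; try lra;
        intros z H1 H2; apply (surj z); lra. }
    set (lb := f (x - d)) in *. set (ub := f (x + d)) in *.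
    assert (Prf : forall t, g lb <= t <= g ub -> derivable_pt f t).
    { unfold lb, ub. rewrite !Hg by (apply Hd; lra). intros t Ht.
      exists (df t). apply is_derive_Reals, Hf, Hd, Ht. }
    assert (Prg : g lb <= g (f x) <= g ub).
    { unfold lb, ub. rewrite !Hg by (apply Hd; lra). lra. }
    assert (E : derive_pt f (g (f x)) (Prf (g (f x)) Prg) = df x).
    { apply derive_pt_eq. rewrite gx. apply is_derive_Reals. auto. }
    assert (H := Ranalysis5.derivable_pt_lim_recip_interv f g lb ub (f x) Prf Cg).
    apply is_derive_Reals. replace (/ df x) with (1 / derive_pt f (g (f x)) (Prf (g (f x)) Prg)).
    + apply H; [lra|lra| |].
      * intros z Hz. apply surj. exact Hz.
      * rewrite E. apply Rgt_not_eq, Hp, Hx.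
    + rewrite E. unfold Rdiv. ring.
Qed.

Lemma cont_on_comp D G f : cont_on D G ->
  (forall r, D r -> continuous f (G r)) -> cont_on D (fun r => f (G r)).
Proof.
  intros HG Hf X m z Dz Hm. apply (continuous_comp (fun z => G (m z)) f).
  - now apply HG.
  - now apply Hf.
Qed.

Lemma cont_on_coord D i : cont_on D (fun r => r i).
Proof. intros X m z _ Hm. apply Hm. Qed.

Lemma cont_on_const D c : cont_on D (fun _ => c).
Proof. intros X m z _ _. apply continuous_const. Qed.

Lemma cont_on_plus D G H : cont_on D G -> cont_on D H -> cont_on D (fun r => G r + H r).
Proof. intros HG HH X m z Dz Hm. apply continuous_Rplus; [now apply HG|now apply HH]. Qed.

Lemma cont_on_mult D G H : cont_on D G -> cont_on D H -> cont_on D (fun r => G r * H r).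
Proof. intros HG HH X m z Dz Hm. apply continuous_Rmult; [now apply HG|now apply HH]. Qed.

Lemma cont_on_div D G H : cont_on D G -> cont_on D H -> (forall r, D r -> H r <> 0) ->
  cont_on D (fun r => G r / H r).
Proof.
  intros HG HH N. apply cont_on_mult; [assumption|].
  apply cont_on_comp; [assumption|]. intros r Dr. now apply continuous_Rinv, N.
Qed.

Lemma continuous_Rpower nu x : 0 < x -> continuous (fun x => Rpower x nu) x.
Proof.
  intros H. apply (ex_derive_continuous (V := R_NormedModule)). eexists.
  apply (is_derive_Rpower (fun x => x) nu x 1); [|assumption]. apply (is_derive_id x).
Qed.

Section Integration.

Variables (D : vec -> Prop) (y : form) (ia ib ja jb : Rbar).
Variables (h s ds : R -> R) (c2 : R).
Variables (q : vec -> R) (B : vec -> idx -> idx -> R) (a : vec).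

Let I := oo ia ib.
Let J := oo ja jb.

Hypothesis h_pos : forall t, I t -> 0 < h t.
Hypothesis s_pos : forall x, J x -> 0 < s x.
Hypothesis s_derive : forall x, is_derive s x (ds x).
Hypothesis ds_derive : forall x, is_derive ds x (c2 * s x).
Hypothesis J_1 : J 1.
Hypothesis D_open : open_dom D.
Hypothesis D_star : forall r t, D r -> 0 <= t <= 1 ->
  D (fun i => a i + t * (r i - a i)).
Hypothesis D_J : forall r i, D r -> J (r i).
Hypothesis D_I : forall r i, D r -> I (y r i).
Hypothesis h_y : forall r i, D r -> h (y r i) = s (r i) * q r.
Hypothesis q_pos : forall r, D r -> 0 < q r.
Hypothesis y_grad : forall i, grad_on D (fun r => y r i) (fun r j => s (r i) * B r i j).
Hypothesis B_sym : forall r i j, D r -> B r i j = B r j i.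
Hypothesis y_cont : forall i, cont_on D (fun r => y r i).
Hypothesis q_cont : cont_on D q.
Hypothesis B_cont : forall i j, cont_on D (fun r => B r i j).

Variables (lam : R) (F : R -> R).
Hypothesis F_derive : antiderivative_on I (fun t => Rpower (h t) lam) F.

Let u := u_coord s lam.
Let Ui := u_primitive s lam.

Let Ui_derive x : J x -> is_derive Ui x (Rpower (s x) (- lam - 1)).
Proof. apply (u_primitive_derive ja jb s ds s_pos s_derive J_1). Qed.

(** A chosen inverse of one coordinate of [u], total so that it can be composed with any function;
    its values outside the image of the range are arbitrary. *)
Definition u_inverse (z : R) : R :=
  epsilon (inhabits 0) (fun x => oo ja jb x /\ u_primitive s lam x = z).

Lemma u_inverse_primitive x : J x -> u_inverse (Ui x) = x.
Proof.
  intros Jx.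
  destruct (epsilon_spec (inhabits 0) (fun z => oo ja jb z /\ u_primitive s lam z = Ui x)
    (ex_intro _ x (conj Jx eq_refl))) as [H1 H2].
  fold (u_inverse (Ui x)) in H1, H2.
  assert (inc := fun u v => oo_increasing ja jb Ui _ u v Ui_derive (fun t _ => Rpower_pos _ _)).
  destruct (Rtotal_order (u_inverse (Ui x)) x) as [L|[E|L]]; [|exact E|];
    apply inc in L; trivial; unfold Ui in *; lra.
Qed.

Lemma eta_closed_primitive : exists V : vec -> R, forall r, D r -> forall i,
  is_derive (fun x => V (upd r i x)) (r i) (eta y s F lam r i).
Proof.
  (* The term from differentiating the denominator. It sits on the diagonal, so the symmetry of the
     Jacobian rests on [B] alone, provided that all powers of [s] cancel in front of [B]; this is
     the next claim and the reason for the exponent [lam + 1]. *)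
  set (dw r i := F (y r i) * ((- lam - 1) * Rpower (s (r i)) (- lam - 1 - 1) * ds (r i))).
  assert (hl : forall r i, D r -> Rpower (h (y r i)) lam * s (r i) * Rpower (s (r i)) (- lam - 1)
               = Rpower (q r) lam).
  { intros r i Dr. assert (sp := s_pos _ (D_J r i Dr)). rewrite h_y by assumption.
    rewrite <- Rpower_mult_distr by auto.
    transitivity (Rpower (q r) lam * (Rpower (s (r i)) lam *
       (Rpower (s (r i)) (- lam - 1) * s (r i)))); [ring|].
    rewrite <- Rpower_pred by assumption.
    rewrite <- Rpower_plus, Rplus_opp_r, Rpower_O by assumption. ring. }
  assert (sc : forall i, cont_on D (fun r => s (r i))).
  { intros i. apply (cont_on_comp D (fun r => r i) s (cont_on_coord D i)). intros r Dr.
    apply (ex_derive_continuous (V := R_NormedModule)). eexists. apply s_derive. }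
  assert (Fc : forall i, cont_on D (fun r => F (y r i))).
  { intros i. apply cont_on_comp; [auto|]. intros r Dr.
    apply (ex_derive_continuous (V := R_NormedModule)). eexists. apply F_derive, D_I, Dr. }
  assert (pc : forall i nu, cont_on D (fun r => Rpower (s (r i)) nu)).
  { intros i nu. apply (cont_on_comp D (fun r => s (r i)) (fun z => Rpower z nu)); [auto|].
    intros r Dr. apply continuous_Rpower. auto. }
  destruct (poincare D a (fun r i => F (y r i) * Rpower (s (r i)) (- lam - 1))
    (fun r i j => Rpower (q r) lam * B r i j + kron i j * dw r i)) as [V HV]; auto.
  - intros i m t v Dm Hm.
    assert (sp := s_pos _ (D_J (m t) i Dm)).
    eapply is_derive_eq.
    + apply is_derive_Rmult.
      * apply (is_derive_Rcomp F (fun t => y (m t) i)).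
        -- apply F_derive, D_I, Dm.
        -- apply (y_grad i m t v Dm Hm).
      * apply is_derive_Rpower; [|exact sp].
        apply (is_derive_Rcomp s (fun t => m t i)); [apply s_derive|apply Hm].
    + cbv beta. simpl.
      transitivity (Rpower (h (y (m t) i)) lam * s (m t i) * Rpower (s (m t i)) (- lam - 1)
         * sum3 (fun j => B (m t) i j * v j) + dw (m t) i * v i).
      * unfold dw, sum3. ring.
      * rewrite hl by assumption. rewrite <- (sum3_kron v i). unfold sum3.
        unfold kron; destruct i; ring.
  - intros i. apply cont_on_mult; auto.
  - intros i j. apply cont_on_plus; apply cont_on_mult; auto.
    + apply (cont_on_comp D q (fun z => Rpower z lam)); [auto|].
      intros. apply continuous_Rpower; auto.
    + apply cont_on_const.
    + unfold dw. apply cont_on_mult; [auto|].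
      apply cont_on_mult; [apply cont_on_mult; [apply cont_on_const|auto]|].
      apply (cont_on_comp D (fun r => r i) ds (cont_on_coord D i)). intros r Dr.
      apply (ex_derive_continuous (V := R_NormedModule)). eexists. apply ds_derive.
  - intros r i j Dr. rewrite (B_sym r i j Dr). f_equal. destruct i, j; simpl; ring.
  - exists V. intros r Dr i. unfold eta. unfold Rdiv.
    rewrite <- Rpower_opp_inv. auto.
Qed.

Lemma primitive_exists : exists W, primitive_in u D (eta y s F lam) W.
Proof.
  destruct eta_closed_primitive as [V HV].
  exists (fun p => V (fun i => u_inverse (p i))). intros r Dr i.
  eapply is_derive_ext_loc; [|exact (HV r Dr i)].
  generalize (open_upd D r i D_open Dr). apply filter_imp. intros x Dx.
  f_equal. extensionality j. symmetry. apply u_inverse_primitive. now apply D_J.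
Qed.

Variable W : vec -> R.
Hypothesis W_primitive : primitive_in u D (eta y s F lam) W.

(** Since [u] acts on each coordinate separately, moving the [j]-th coordinate of [u r] a little is
    the same as moving [r j] alone. This converts partial derivatives in [u] into partial
    derivatives in [r]. *)
Lemma locally_inverse r j : D r -> locally (u r j) (fun z =>
  D (upd r j (u_inverse z)) /\ upd (u r) j z = u (upd r j (u_inverse z))).
Proof.
  intros Dr.
  destruct (inverse_derive ja jb Ui _ u_inverse (r j) Ui_derive (fun t _ => Rpower_pos _ _)
    u_inverse_primitive (D_J r j Dr)) as [L dU].
  assert (L2 : locally (u r j) (fun z => D (upd r j (u_inverse z)))).
  { apply (D_open R_UniformSpace (fun z => upd r j (u_inverse z)) (u r j)).
    - change (u r j) with (Ui (r j)). rewrite u_inverse_primitive, upd_id by auto. exact Dr.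
    - intros i. apply (continuous_comp u_inverse (fun x => upd r j x i)).
      + apply (ex_derive_continuous (V := R_NormedModule)). eexists. exact dU.
      + apply continuous_upd. }
  generalize (filter_and _ _ L L2). apply filter_imp. intros z [[_ Hz] Dz].
  split; [exact Dz|]. extensionality i. destruct (idx_eq_dec j i) as [<-|n].
  - rewrite upd_eq. unfold u, u_coord. rewrite upd_eq. symmetry. exact Hz.
  - rewrite upd_neq by assumption. unfold u, u_coord. now rewrite upd_neq.
Qed.

Lemma u_inverse_derive r j : D r ->
  is_derive u_inverse (u r j) (Rpower (s (r j)) (lam + 1)).
Proof.
  intros Dr.
  destruct (inverse_derive ja jb Ui _ u_inverse (r j) Ui_derive (fun t _ => Rpower_pos _ _)
    u_inverse_primitive (D_J r j Dr)) as [_ dU].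
  eapply is_derive_eq; [exact dU|]. rewrite Rpower_opp_inv. apply Rinv_inv.
Qed.

(** The inverse coordinate has derivative [s^(lam + 1)], which cancels the denominator of [eta] and
    leaves the antiderivative [F (y r j)] alone. *)
Lemma W_partial r j : D r ->
  is_derive (fun z => W (upd (u r) j z)) (u r j) (F (y r j)).
Proof.
  intros Dr. apply is_derive_ext_loc with (fun z => W (u (upd r j (u_inverse z)))).
  - generalize (locally_inverse r j Dr). apply filter_imp. intros z [_ ->]. reflexivity.
  - eapply is_derive_eq.
    + apply (is_derive_Rcomp (fun x => W (u (upd r j x))) u_inverse);
        [|now apply u_inverse_derive].
      change (u r j) with (Ui (r j)). rewrite u_inverse_primitive by auto. now apply W_primitive.
    + unfold eta. field. apply Rgt_not_eq, Rpower_pos.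
Qed.

Lemma W_partial2 r i j : D r ->
  is_derive (fun z => partial j W (upd (u r) i z)) (u r i)
    (Rpower (q r) lam * B r j i * Rpower (s (r j)) (lam + 1) * Rpower (s (r i)) (lam + 1)).
Proof.
  intros Dr. apply is_derive_ext_loc with (fun z => F (y (upd r i (u_inverse z)) j)).
  - generalize (locally_inverse r i Dr). apply filter_imp. intros z [Dz ->].
    symmetry. now apply is_derive_unique, W_partial.
  - assert (Ei : u_inverse (u r i) = r i) by (apply u_inverse_primitive; auto).
    eapply is_derive_eq.
    + apply (is_derive_Rcomp (fun x => F (y (upd r i x) j)) u_inverse);
        [|now apply u_inverse_derive].
      rewrite Ei.
      apply (is_derive_Rcomp F (fun x => y (upd r i x) j)).
      * rewrite upd_id. apply F_derive, D_I, Dr.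
      * exact (grad_partial D _ _ r i (y_grad j) Dr).
    + cbv beta. assert (sp := s_pos _ (D_J r j Dr)).
      rewrite h_y by assumption. rewrite <- Rpower_mult_distr by auto.
      rewrite (Rpower_pred (s (r j)) (lam + 1)) by assumption.
      replace (lam + 1 - 1) with lam by ring. ring.
Qed.

Lemma hessian_in_u p : image_of u D p -> ex_hessian W p /\ exists r, D r /\
  forall v, hessian_form W p v = Rpower (q r) lam *
    sum3 (fun i => sum3 (fun j => B r i j * (v i * Rpower (s (r i)) (lam + 1))
                                          * (v j * Rpower (s (r j)) (lam + 1)))).
Proof.
  intros [r [Dr ->]]. split.
  - intros i j. split; eexists; [now apply W_partial | now apply W_partial2].
  - exists r. split; [assumption|]. intros v. unfold hessian_form.
    assert (E : forall i j, partial i (partial j W) (u r) =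
      Rpower (q r) lam * B r i j * Rpower (s (r j)) (lam + 1) * Rpower (s (r i)) (lam + 1)).
    { intros i j. rewrite (B_sym r i j Dr). now apply is_derive_unique, W_partial2. }
    unfold sum3. rewrite !E. ring.
Qed.

End Integration.

(** * Derivatives of the opposite quantities *)

Definition total (r : vec) : R := r i1 + r i2 + r i3.

(* [s] is the function of [r] in the theorem and [ds] its derivative; [st] and
   [ct] are sine and cosine for the quantities [r i + r j]. The numbers
   [kappa], [sigma] come from the equation [h' = kappa * (1 + sigma * h^2)],
   and [eps] is the sign of [s (r i1 + r i2 + r i3)]. *)
Record trig (s ds st ct : R -> R) (c2 kappa sigma eps beta K : R) : Prop := {
  trig_s_derive : forall x, is_derive s x (ds x);
  trig_ds_derive : forall x, is_derive ds x (c2 * s x);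
  trig_st_continuous : forall x, continuous st x;
  trig_st_add : forall x z, st (x + z) = st x * ct z + ct x * st z;
  trig_sub : forall x z, ds (x + z) * s x - s (x + z) * ds x = 2 * kappa * beta * K * st z;
  trig_add : forall x z, ds (x + z) * s x + s (x + z) * ds x = - 2 * kappa * beta * st (x + (x + z));
  trig_mul : forall a b c, s b * s c + sigma * eps * s a * s (a + b + c)
                           = beta * st (a + b) * st (a + c);
  trig_const : kappa * beta * K <> 0
}.

Arguments trig_s_derive {s ds st ct c2 kappa sigma eps beta K}.
Arguments trig_ds_derive {s ds st ct c2 kappa sigma eps beta K}.
Arguments trig_st_continuous {s ds st ct c2 kappa sigma eps beta K}.
Arguments trig_st_add {s ds st ct c2 kappa sigma eps beta K}.
Arguments trig_sub {s ds st ct c2 kappa sigma eps beta K}.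
Arguments trig_add {s ds st ct c2 kappa sigma eps beta K}.
Arguments trig_mul {s ds st ct c2 kappa sigma eps beta K}.
Arguments trig_const {s ds st ct c2 kappa sigma eps beta K}.

Definition inradius_factor (s : R -> R) (eps : R) (r : vec) : R :=
  sqrt (eps * s (total r) / (s (r i1) * s (r i2) * s (r i3))).

Lemma inradius_arg_pos (s : R -> R) eps r :
  (forall i, 0 < s (r i)) -> 0 < eps * s (total r) ->
  0 < eps * s (total r) / (s (r i1) * s (r i2) * s (r i3)).
Proof.
  intros sp tp. apply Rdiv_lt_0_compat; [assumption|]. repeat apply Rmult_lt_0_compat; auto.
Qed.

Lemma inradius_factor_spec (s : R -> R) eps r :
  (forall i, 0 < s (r i)) -> 0 < eps * s (total r) ->
  0 < inradius_factor s eps r /\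
  forall i, inradius_factor s eps r ^ 2 * (s (r i) * s (r (nxt i)) * s (r (nxt (nxt i))))
            = eps * s (total r).
Proof.
  intros sp tp. assert (ap := inradius_arg_pos s eps r sp tp).
  split; [now apply sqrt_lt_R0|]. intros i. unfold inradius_factor. rewrite pow2_sqrt by lra.
  assert (n : forall j, s (r j) <> 0) by (intros j; apply Rgt_not_eq, sp).
  destruct i; simpl; field; repeat split; auto.
Qed.

(** * Jacobian of the opposite quantities and gradient of the inradius factor *)

Section Angles.

Variables (D : vec -> Prop) (y : form) (ia ib ja jb : Rbar).
Variables (h s ds st ct : R -> R) (c2 kappa sigma eps beta K sgn : R).

Let I := oo ia ib.
Let J := oo ja jb.
Let dh t := kappa * (1 + sigma * (h t) ^ 2).
Let q := inradius_factor s eps.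

Hypothesis T : trig s ds st ct c2 kappa sigma eps beta K.
Hypothesis h_derive : forall t, I t -> is_derive h t (dh t).
Hypothesis dh_sign : forall t, I t -> 0 < sgn * dh t.
Hypothesis s_pos : forall x, J x -> 0 < s x.
Hypothesis D_open : open_dom D.
Hypothesis D_J : forall r i, D r -> J (r i).
Hypothesis D_I : forall r i, D r -> I (y r i).
Hypothesis D_total : forall r, D r -> 0 < eps * s (total r).
Hypothesis D_st : forall r i j, D r -> i <> j -> st (r i + r j) <> 0.
Hypothesis h_y : forall r i, D r -> h (y r i) = s (r i) * q r.

(** The entries of [B], solved from the chain rule for [h (y i) = s (r i) * q r]. For [k <> i],
    [h' * B i k] is the [r k]-derivative of [q]; the diagonal entry also collects the derivative of
    [s (r i)]. *)
Definition off_diagonal (r : vec) (a b c : R) : R :=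
  K * q r * s c / (s (total r) * st (a + b)).

Definition diagonal (r : vec) (a b c : R) : R :=
  - q r * s b * s c * st (total r + a) / (s a * s (total r) * st (a + b) * st (a + c)).

Definition y_jacobian (r : vec) (i j : idx) : R :=
  match i, j with
  | i1, i1 => diagonal r (r i1) (r i2) (r i3)
  | i2, i2 => diagonal r (r i2) (r i3) (r i1)
  | i3, i3 => diagonal r (r i3) (r i1) (r i2)
  | i1, i2 | i2, i1 => off_diagonal r (r i1) (r i2) (r i3)
  | i2, i3 | i3, i2 => off_diagonal r (r i2) (r i3) (r i1)
  | i3, i1 | i1, i3 => off_diagonal r (r i3) (r i1) (r i2)
  end.

Definition q_gradient (r : vec) (j : idx) : R :=
  kappa * beta * K * q r * st (total r - r j) / (s (total r) * s (r j)).

Let S r i : D r -> 0 < s (r i).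
Proof. intros. auto. Qed.

Let S0 r i : D r -> s (r i) <> 0.
Proof. intros. apply Rgt_not_eq. apply S. assumption. Qed.

Let Stot r : D r -> s (total r) <> 0.
Proof. intros Dr Z. assert (H := D_total r Dr). rewrite Z in H. lra. Qed.

Let arg_pos r : D r -> 0 < eps * s (total r) / (s (r i1) * s (r i2) * s (r i3)).
Proof. intros Dr. apply inradius_arg_pos; auto. Qed.

Lemma q_pos r : D r -> 0 < q r.
Proof. intros. now apply sqrt_lt_R0, arg_pos. Qed.

Lemma q_sqr r : D r -> (q r) ^ 2 = eps * s (total r) / (s (r i1) * s (r i2) * s (r i3)).
Proof. intros. apply pow2_sqrt. now apply Rlt_le, arg_pos. Qed.

Lemma y_jacobian_sym r i j : y_jacobian r i j = y_jacobian r j i.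
Proof. now destruct i, j. Qed.

(** Inserting [h^2 = s (r i)^2 * q^2] turns [1 + sigma * h^2] into the left-hand side of [trig_mul]
    divided by [s (r j) * s (r k)]. *)
Let dh_product r i j k : D r -> i <> j -> j <> k -> k <> i ->
  dh (y r i) = kappa * beta * st (r i + r j) * st (r i + r k) / (s (r j) * s (r k)).
Proof.
  intros Dr n1 n2 n3. unfold dh. rewrite h_y, Rpow_mult_distr, q_sqr by assumption.
  assert (M := trig_mul T (r i) (r j) (r k)).
  assert (E : r i + r j + r k = total r)
    by (unfold total; destruct i, j, k; congruence || ring).
  rewrite E in M.
  replace (kappa * beta * st (r i + r j) * st (r i + r k) / (s (r j) * s (r k)))
    with (kappa * (s (r j) * s (r k) + sigma * eps * s (r i) * s (total r)) / (s (r j) * s (r k)))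
    by (rewrite M; field; repeat split; auto).
  assert (s (r i1) * s (r i2) * s (r i3) = s (r i) * s (r j) * s (r k)) as ->
    by (destruct i, j, k; congruence || ring).
  field. repeat split; auto.
Qed.

Lemma dh_y_jacobian r i k : D r -> i <> k -> dh (y r i) * y_jacobian r i k = q_gradient r k.
Proof.
  intros Dr n. unfold q_gradient.
  assert (P := dh_product r i). assert (s0 := S0 r). assert (t0 := Stot r Dr).
  assert (d12 := D_st r i1 i2 Dr ltac:(discriminate)).
  assert (d23 := D_st r i2 i3 Dr ltac:(discriminate)).
  assert (d31 := D_st r i3 i1 Dr ltac:(discriminate)).
  assert (R1 : total r - r i1 = r i2 + r i3) by (unfold total; ring).
  assert (R2 : total r - r i2 = r i3 + r i1) by (unfold total; ring).
  assert (R3 : total r - r i3 = r i1 + r i2) by (unfold total; ring).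
  destruct i, k; try congruence; unfold y_jacobian, off_diagonal;
    rewrite ?R1, ?R2, ?R3;
    [ rewrite (P i2 i3) | rewrite (P i2 i3) | rewrite (P i3 i1)
    | rewrite (P i3 i1) | rewrite (P i1 i2) | rewrite (P i1 i2)]; try assumption; try discriminate;
    rewrite ?(Rplus_comm (r i2) (r i1)), ?(Rplus_comm (r i3) (r i2)), ?(Rplus_comm (r i1) (r i3));
    field; repeat split; auto.
Qed.

(** The right-hand side is the [r i]-derivative of [s (r i) * q r]. By [trig_sub] the gradient of
    [q] is half a difference of logarithmic derivatives of [s]; adding [ds (r i) * q r] turns that
    difference into a sum, which [trig_add] evaluates. *)
Lemma dh_y_jacobian_diag r i : D r ->
  dh (y r i) * (s (r i) * y_jacobian r i i) = ds (r i) * q r + s (r i) * q_gradient r i.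
Proof.
  intros Dr.
  assert (key : forall j k, i <> j -> j <> k -> k <> i ->
    dh (y r i) * (s (r i) * diagonal r (r i) (r j) (r k))
      = ds (r i) * q r + s (r i) * q_gradient r i).
  { intros j k n1 n2 n3. unfold diagonal, q_gradient. rewrite (dh_product r i j k) by assumption.
    assert (A := trig_sub T (r i) (total r - r i)).
    assert (A' := trig_add T (r i) (total r - r i)).
    replace (r i + (total r - r i)) with (total r) in A, A' by ring.
    rewrite (Rplus_comm (r i)) in A'.
    assert (s0 := S0 r). assert (t0 := Stot r Dr).
    assert (d1 := D_st r i j Dr n1). assert (d2 := D_st r i k Dr (not_eq_sym n3)).
    replace (kappa * beta * K * q r * st (total r - r i) / (s (total r) * s (r i)))
      with (q r * (2 * kappa * beta * K * st (total r - r i)) / (2 * s (total r) * s (r i)))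
      by (field; repeat split; auto).
    rewrite <- A.
    match goal with |- ?lhs = _ => replace lhs with
      (q r * (- 2 * kappa * beta * st (total r + r i)) / (2 * s (total r))) by (field; repeat split; auto) end.
    rewrite <- A'. field. repeat split; auto. }
  destruct i.
  - apply (key i2 i3); discriminate.
  - apply (key i3 i1); discriminate.
  - apply (key i1 i2); discriminate.
Qed.

Lemma q_gradient_neq0 r j : D r -> q_gradient r j <> 0.
Proof.
  intros Dr. unfold q_gradient, Rdiv.
  assert (N := trig_const T). assert (Q := q_pos r Dr).
  repeat apply Rmult_integral_contrapositive_currified; auto.
  - intros Z; apply N; rewrite Z; ring.
  - intros Z; apply N; rewrite Z; ring.
  - intros Z; apply N; rewrite Z; ring.
  - lra.
  - destruct j.
    + replace (total r - r i1) with (r i2 + r i3) by (unfold total; ring).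
      apply D_st; [assumption|discriminate].
    + replace (total r - r i2) with (r i1 + r i3) by (unfold total; ring).
      apply D_st; [assumption|discriminate].
    + replace (total r - r i3) with (r i1 + r i2) by (unfold total; ring).
      apply D_st; [assumption|discriminate].
  - apply Rinv_neq_0_compat, Rmult_integral_contrapositive_currified; auto.
Qed.

(** Logarithmic differentiation: the [r j]-derivative of [ln q] is half of [ds / s] at [total r]
    minus half of [ds / s] at [r j], and [trig_sub] puts this difference over a common
    denominator. *)
Lemma q_grad : grad_on D q q_gradient.
Proof.
  intros m t v Dm Hm. unfold q, inradius_factor.
  assert (sd : forall i, is_derive (fun t => s (m t i)) t (ds (m t i) * v i)).
  { intros i. apply (is_derive_Rcomp s (fun t => m t i)); [|auto]. apply T. }
  assert (std : is_derive (fun t => s (total (m t))) t (ds (total (m t)) * sum3 v)).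
  { apply (is_derive_Rcomp s (fun t => total (m t))); [apply T|]. exact (is_derive_sum3 (fun i t => m t i) t v Hm). }
  eapply is_derive_eq.
  - apply is_derive_sqrt.
    + apply is_derive_div.
      * apply is_derive_scal. exact std.
      * apply is_derive_Rmult; [apply is_derive_Rmult|]; apply sd.
      * repeat apply Rmult_integral_contrapositive_currified; auto.
    + now apply arg_pos.
  - cbv beta. change (sqrt (eps * s (total (m t)) / (s (m t i1) * s (m t i2) * s (m t i3)))) with (q (m t)).
    set (r := m t) in *.
    assert (Q := q_pos r Dm). assert (Q2 := q_sqr r Dm).
    assert (G : forall j, q_gradient r j = q r / 2 * (ds (total r) / s (total r) - ds (r j) / s (r j))).
    { intros j. unfold q_gradient.
      assert (A := trig_sub T (r j) (total r - r j)).
      replace (r j + (total r - r j)) with (total r) in A by ring.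
      transitivity (q r * (2 * kappa * beta * K * st (total r - r j)) / (2 * s (total r) * s (r j)));
        [field; repeat split; auto|].
      rewrite <- A. field. repeat split; auto. }
    unfold sum3. rewrite !G.
    apply (Rmult_eq_reg_r (2 * q r)); [|lra].
    match goal with |- ?lhs = ?rhs => transitivity
      ((q r)^2 * ((ds (total r) / s (total r) - ds (r i1) / s (r i1)) * v i1 +
      (ds (total r) / s (total r) - ds (r i2) / s (r i2)) * v i2 +
      (ds (total r) / s (total r) - ds (r i3) / s (r i3)) * v i3)); [|field; repeat split; auto] end.
    rewrite Q2. field. repeat split; auto. lra.
Qed.

(** The map [y] carries no regularity assumption. The sign [sgn] makes [sgn * h] increasing, and
    [y r i] becomes a differentiable inverse evaluated at [sgn * (s (r i) * q r)]. *)
Let y_inverse := fun z => epsilon (inhabits 0) (fun t => I t /\ sgn * h t = z).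

Let sgn_h_derive t : I t -> is_derive (fun t => sgn * h t) t (sgn * dh t).
Proof. intros It. apply is_derive_scal. auto. Qed.

Let y_inverse_h t : I t -> y_inverse (sgn * h t) = t.
Proof.
  intros It. unfold y_inverse.
  set (P x := I x /\ sgn * h x = sgn * h t).
  destruct (epsilon_spec (inhabits 0) P (ex_intro P t (conj It eq_refl))) as [H1 H2].
  fold P. set (t' := epsilon (inhabits 0) P) in *.
  assert (inc := fun u v => oo_increasing ia ib (fun t => sgn * h t) _ u v sgn_h_derive dh_sign).
  destruct (Rtotal_order t' t) as [L|[E|L]]; [|exact E|]; apply inc in L; trivial; lra.
Qed.

Let y_E r i : D r -> y_inverse (sgn * (s (r i) * q r)) = y r i.
Proof. intros Dr. rewrite <- h_y by assumption. apply y_inverse_h. auto. Qed.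

Let y_inverse_derive r i : D r ->
  is_derive y_inverse (sgn * (s (r i) * q r)) (/ (sgn * dh (y r i))).
Proof.
  intros Dr.
  destruct (inverse_derive ia ib (fun t => sgn * h t) _ y_inverse (y r i) sgn_h_derive dh_sign
    y_inverse_h (D_I r i Dr)) as [_ H].
  now rewrite <- h_y.
Qed.

Lemma y_grad i : grad_on D (fun r => y r i) (fun r j => s (r i) * y_jacobian r i j).
Proof.
  intros m t v Dm Hm.
  apply is_derive_ext_loc with (fun t => y_inverse (sgn * (s (m t i) * q (m t)))).
  - apply filter_imp with (fun t => D (m t)).
    + intros t' Dt'. now apply y_E.
    + apply (D_open R_UniformSpace m t Dm). intros j.
      apply (ex_derive_continuous (V := R_NormedModule)). eexists. apply Hm.
  - eapply is_derive_eq.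
    + apply (is_derive_Rcomp y_inverse (fun t => sgn * (s (m t i) * q (m t)))).
      * now apply y_inverse_derive.
      * apply is_derive_scal. apply is_derive_Rmult.
        -- apply (is_derive_Rcomp s (fun t => m t i)); [apply T|auto].
        -- now apply q_grad.
    + cbv beta. set (r := m t) in *.
      assert (P := dh_sign _ (D_I r i Dm)).
      assert (sgn <> 0) by (intros Z; rewrite Z in P; lra).
      assert (dh (y r i) <> 0) by (intros Z; rewrite Z in P; lra).
      apply (Rmult_eq_reg_l (dh (y r i))); [|assumption].
      assert (E : dh (y r i) * sum3 (fun j => s (r i) * y_jacobian r i j * v j)
        = ds (r i) * v i * q r + s (r i) * sum3 (fun j => q_gradient r j * v j)).
      { unfold sum3.
        assert (Od := dh_y_jacobian r i). assert (Di := dh_y_jacobian_diag r i Dm).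
        destruct i.
        - transitivity (dh (y r i1) * (s (r i1) * y_jacobian r i1 i1) * v i1
            + s (r i1) * (dh (y r i1) * y_jacobian r i1 i2) * v i2
            + s (r i1) * (dh (y r i1) * y_jacobian r i1 i3) * v i3); [ring|].
          rewrite Di, !Od by (assumption || discriminate). ring.
        - transitivity (dh (y r i2) * (s (r i2) * y_jacobian r i2 i2) * v i2
            + s (r i2) * (dh (y r i2) * y_jacobian r i2 i1) * v i1
            + s (r i2) * (dh (y r i2) * y_jacobian r i2 i3) * v i3); [ring|].
          rewrite Di, !Od by (assumption || discriminate). ring.
        - transitivity (dh (y r i3) * (s (r i3) * y_jacobian r i3 i3) * v i3
            + s (r i3) * (dh (y r i3) * y_jacobian r i3 i1) * v i1
            + s (r i3) * (dh (y r i3) * y_jacobian r i3 i2) * v i2); [ring|].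
          rewrite Di, !Od by (assumption || discriminate). ring. }
      rewrite E. field. repeat split; auto.
Qed.

Let s_cont i : cont_on D (fun r => s (r i)).
Proof.
  apply (cont_on_comp D (fun r => r i) s (cont_on_coord D i)). intros r Dr.
  apply (ex_derive_continuous (V := R_NormedModule)). eexists. apply T.
Qed.

Let total_cont : cont_on D total.
Proof. apply cont_on_plus; [apply cont_on_plus|]; apply cont_on_coord. Qed.

Let s_total_cont : cont_on D (fun r => s (total r)).
Proof.
  apply (cont_on_comp D total s total_cont). intros r Dr.
  apply (ex_derive_continuous (V := R_NormedModule)). eexists. apply T.
Qed.

Let st_cont G : cont_on D G -> cont_on D (fun r => st (G r)).
Proof. intros HG. apply cont_on_comp; [assumption|]. intros. apply T. Qed.

Lemma q_cont : cont_on D q.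
Proof.
  unfold q, inradius_factor.
  apply (cont_on_comp D (fun r => eps * s (total r) / (s (r i1) * s (r i2) * s (r i3))) sqrt).
  - apply cont_on_div.
    + apply cont_on_mult; [apply cont_on_const|auto].
    + apply cont_on_mult; [apply cont_on_mult|]; auto.
    + intros. repeat apply Rmult_integral_contrapositive_currified; auto.
  - intros r Dr. apply continuous_sqrt.
Qed.

Lemma y_cont i : cont_on D (fun r => y r i).
Proof.
  intros X m z Dz Hm.
  apply continuous_ext_loc with (fun z => y_inverse (sgn * (s (m z i) * q (m z)))).
  - apply filter_imp with (fun z => D (m z)).
    + intros z' Dz'. now apply y_E.
    + now apply D_open.
  - apply (continuous_comp (fun z => sgn * (s (m z i) * q (m z))) y_inverse).
    + apply (cont_on_mult D (fun _ => sgn) (fun r => s (r i) * q r)); try assumption.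
      * apply cont_on_const.
      * apply cont_on_mult; [auto|apply q_cont].
    + apply (ex_derive_continuous (V := R_NormedModule)). eexists. now apply y_inverse_derive.
Qed.

Lemma y_jacobian_cont i j : cont_on D (fun r => y_jacobian r i j).
Proof.
  assert (N := Rmult_integral_contrapositive_currified).
  assert (O : forall i j k, i <> j -> cont_on D (fun r => off_diagonal r (r i) (r j) (r k))).
  { clear i j. intros i j k n. apply cont_on_div.
    - apply cont_on_mult; [apply cont_on_mult|]; auto; [apply cont_on_const|apply q_cont].
    - apply cont_on_mult; auto. apply st_cont, cont_on_plus; apply cont_on_coord.
    - intros r Dr. apply N; auto. }
  assert (Di : forall i j k, i <> j -> i <> k -> cont_on D (fun r => diagonal r (r i) (r j) (r k))).
  { clear i j O. intros i j k n1 n2. apply cont_on_div.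
    - apply cont_on_mult; [apply cont_on_mult; [apply cont_on_mult|]|]; auto.
      + apply (cont_on_comp D q Ropp q_cont). intros r Dr.
        apply (continuous_opp (V := R_NormedModule) (fun x => x)), continuous_id.
      + apply st_cont, cont_on_plus; [auto|apply cont_on_coord].
    - apply cont_on_mult; [apply cont_on_mult; [apply cont_on_mult|]|]; auto;
        apply st_cont, cont_on_plus; apply cont_on_coord.
    - intros r Dr. repeat apply N; auto. }
  assert (D1 := Di i1 i2 i3 ltac:(discriminate) ltac:(discriminate)).
  assert (D2 := Di i2 i3 i1 ltac:(discriminate) ltac:(discriminate)).
  assert (D3 := Di i3 i1 i2 ltac:(discriminate) ltac:(discriminate)).
  assert (O1 := O i1 i2 i3 ltac:(discriminate)).
  assert (O2 := O i2 i3 i1 ltac:(discriminate)).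
  assert (O3 := O i3 i1 i2 ltac:(discriminate)).
  destruct i, j; assumption.
Qed.

Definition angle_form (r X : vec) : R :=
  let Z x z t := (ct t * (x ^ 2 + z ^ 2) - 2 * K * x * z) / st t in
  Z (X i1) (X i2) (r i1 + r i2) + Z (X i2) (X i3) (r i2 + r i3) + Z (X i3) (X i1) (r i3 + r i1).

(** [total r + r i] is the sum of the two pair sums containing [r i], so the addition formula splits
    each diagonal entry into one term [ct / st] per pair. Dividing [x i] by [s (r i)] removes the
    remaining weights. *)
Lemma jacobian_form r x : D r ->
  sum3 (fun i => sum3 (fun j => y_jacobian r i j * x i * x j))
  = - (q r * (s (r i1) * s (r i2) * s (r i3)) / s (total r))
      * angle_form r (fun i => x i / s (r i)).
Proof.
  intros Dr. unfold sum3, angle_form; simpl. unfold diagonal, off_diagonal.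
  assert (s0 := S0 r). assert (t0 := Stot r Dr).
  assert (d12 := D_st r i1 i2 Dr ltac:(discriminate)).
  assert (d23 := D_st r i2 i3 Dr ltac:(discriminate)).
  assert (d31 := D_st r i3 i1 Dr ltac:(discriminate)).
  replace (total r + r i1) with ((r i1 + r i2) + (r i3 + r i1)) by (unfold total; ring).
  replace (total r + r i2) with ((r i1 + r i2) + (r i2 + r i3)) by (unfold total; ring).
  replace (total r + r i3) with ((r i2 + r i3) + (r i3 + r i1)) by (unfold total; ring).
  rewrite !(trig_st_add T (_ + _) (_ + _)).
  rewrite ?(Rplus_comm (r i2) (r i1)), ?(Rplus_comm (r i3) (r i2)), ?(Rplus_comm (r i1) (r i3)).
  field. repeat split; auto.
Qed.

End Angles.

(** * The data common to the six geometries *)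

Section Family.

Context {D : vec -> Prop} {y : form} {ia ib ja jb : Rbar}.
Context {h s ds st ct : R -> R} {c2 kappa sigma eps beta K sgn : R}.

Record trig_family : Prop := {
  fam_trig : trig s ds st ct c2 kappa sigma eps beta K;
  fam_h_pos : forall t, oo ia ib t -> 0 < h t;
  fam_h_derive : forall t, oo ia ib t -> is_derive h t (kappa * (1 + sigma * (h t) ^ 2));
  fam_dh_sign : forall t, oo ia ib t -> 0 < sgn * (kappa * (1 + sigma * (h t) ^ 2));
  fam_s_pos : forall x, oo ja jb x -> 0 < s x;
  fam_J_1 : oo ja jb 1;
  fam_open : open_dom D;
  fam_J : forall r i, D r -> oo ja jb (r i);
  fam_I : forall r i, D r -> oo ia ib (y r i);
  fam_total : forall r, D r -> 0 < eps * s (total r);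
  fam_st : forall r i j, D r -> i <> j -> st (r i + r j) <> 0;
  fam_h_y : forall r i, D r -> h (y r i) = s (r i) * inradius_factor s eps r
}.

(* [reach x Q] says that some [r] in [D] has [r i = x] and inradius factor [Q];
   the other coordinates can then be pushed towards the end of the range given
   by the filter [G]. *)
Record reachable (G : (R -> Prop) -> Prop) (reach : R -> R -> Prop) : Prop := {
  reach_filter : ProperFilter G;
  reach_scale : forall (P : R -> Prop) q0 q1, 0 < q0 -> 0 < q1 ->
    G (fun x => P (q0 * s x)) -> G (fun x => P (q1 * s x));
  reach_far : forall x Q, reach x Q ->
    G (fun x2 => exists r, D r /\ r i1 = x /\ r i2 = x2 /\ inradius_factor s eps r = Q);
  reach_self : forall r i, D r -> reach (r i) (inradius_factor s eps r);
  reach_J : forall x, oo ja jb x -> exists Q, reach x Q;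
  reach_I : forall t, oo ia ib t -> exists x, oo ja jb x /\ reach x (h t / s x)
}.

Hypothesis Fam : trig_family.

Let dh_neq0 t : oo ia ib t -> kappa * (1 + sigma * (h t) ^ 2) <> 0.
Proof. intros It Z. assert (H := fam_dh_sign Fam t It). rewrite Z in H. lra. Qed.

Section Classify.

Variables (G : (R -> Prop) -> Prop) (reach : R -> R -> Prop).
Hypothesis Re : reachable G reach.

Lemma reach_point x Q : reach x Q ->
  exists r, D r /\ r i1 = x /\ inradius_factor s eps r = Q.
Proof.
  intros H. assert (PF := reach_filter _ _ Re).
  destruct (filter_ex _ (reach_far _ _ Re x Q H)) as [x2 [r [Dr [E1 [_ Eq]]]]]. eauto.
Qed.

(** The cosine law leaves [h t / s x] as the only factor with which [t] can face [x]; conversely,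
    injectivity of [h] recovers [t] from that factor. *)
Lemma hit_pair t x : oo ia ib t -> oo ja jb x -> reach x (h t / s x) ->
  exists r, D r /\ y r i1 = t /\ r i1 = x.
Proof.
  intros It Jx Rx. destruct (reach_point _ _ Rx) as [r [Dr [E1 Eq]]].
  exists r. split; [assumption|]. split; [|assumption].
  apply (h_injective ia ib h kappa sigma (fam_h_derive Fam)); auto.
  - now apply (fam_I Fam).
  - rewrite (fam_h_y Fam) by assumption. rewrite E1, Eq. field.
    now apply Rgt_not_eq, (fam_s_pos Fam).
Qed.

Variable A : (R -> R) -> (R -> R) -> Prop.
Hypothesis A_weak : forall f g, interacting D y f g -> A f g.
Hypothesis A_strong : forall f g, smooth_on (oo ia ib) f -> smooth_on (oo ja jb) g ->
  nonconstant_on (oo ia ib) f -> nonconstant_on (oo ja jb) g -> A f g -> interacting D y f g.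

Lemma family_classification : list_of_closed_forms A D y (oo ia ib) (oo ja jb) h s.
Proof.
  set (q := inradius_factor s eps).
  apply (classification D y ia ib ja jb h s ds kappa sigma c2 q
    (y_jacobian s st eps K) (q_gradient s st kappa eps beta K) G); try apply Fam; auto.
  - intros r Dr. apply (q_pos D ja jb s eps); try apply Fam; auto.
  - intros i. apply (y_grad D y ia ib ja jb h s ds st ct c2 kappa sigma eps beta K sgn); apply Fam.
  - intros r i j Dr. apply y_jacobian_sym.
  - intros r i k Dr n. apply (dh_y_jacobian D y ja jb h s ds st ct c2 kappa sigma eps beta K); try apply Fam; auto.
  - intros r k Dr. apply (q_gradient_neq0 D ja jb s ds st ct c2 kappa sigma eps beta K); try apply Fam; auto.
  - intros t It. destruct (reach_I _ _ Re t It) as [x [Jx Rx]].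
    destruct (hit_pair t x It Jx Rx) as [r [Dr [E _]]]. eauto.
  - intros x Jx. destruct (reach_J _ _ Re x Jx) as [Q Rx].
    destruct (reach_point x Q Rx) as [r [Dr [E _]]]. eauto.
  - apply Re.
  - intros r i Dr. apply (reach_far _ _ Re). now apply (reach_self _ _ Re).
  - apply Re.
Qed.

End Classify.

Lemma nonconstant_derive a b f : smooth_on (oo a b) f -> nonconstant_on (oo a b) f ->
  exists x, oo a b x /\ Derive f x <> 0.
Proof.
  intros Sf [x [z [Hx [Hz n]]]]. apply Classical_Prop.NNPP. intros H. apply n.
  apply (oo_constant a b f); auto. intros t Ht.
  eapply is_derive_eq; [apply Derive_correct, (smooth_on_twice _ _ _ Sf Ht)|].
  apply Classical_Prop.NNPP. intros H'. apply H. eauto.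
Qed.

Lemma family_interacting_classification G reach : reachable G reach ->
  all_interacting_closed_forms D y (oo ia ib) (oo ja jb) h s.
Proof. intros Re. apply (family_classification G reach Re); auto. Qed.

(** When every pair occurs as [(y r i, r i)], a point where [f'] is nonzero and an unrelated point
    where [g'] is nonzero can be realised together, which gives an interacting point. *)
Lemma family_all_classification G reach : reachable G reach ->
  (forall t x, oo ia ib t -> oo ja jb x -> reach x (h t / s x)) ->
  all_closed_forms D y (oo ia ib) (oo ja jb) h s.
Proof.
  intros Re all. apply (family_classification G reach Re); auto.
  intros f g Sf Sg Nf Ng _.
  destruct (nonconstant_derive _ _ f Sf Nf) as [t [It Ft]].
  destruct (nonconstant_derive _ _ g Sg Ng) as [x [Jx Gx]].
  destruct (hit_pair G reach Re t x It Jx (all t x It Jx)) as [r [Dr [E1 E2]]].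
  exists r, i1. rewrite E1, E2. auto.
Qed.

Section Integrate.

Variable a : vec.
Hypothesis D_star : forall r t, D r -> 0 <= t <= 1 ->
  D (fun i => a i + t * (r i - a i)).
Hypothesis eps_1 : eps = 1.

(** The sign of the Hessian depends on that of [s (total r)], which is the sign of [eps]. With
    [eps = 1] the factor in [jacobian_form] is negative, and only the sign of [angle_form] is left
    to decide. The positive weights [k] come from [s] and from the change to the coordinates [u]. *)
Lemma family_hessian lam F : antiderivative_on (oo ia ib) (fun t => Rpower (h t) lam) F ->
  (exists W, primitive_in (u_coord s lam) D (eta y s F lam) W) /\
  (forall W, primitive_in (u_coord s lam) D (eta y s F lam) W ->
   forall p, image_of (u_coord s lam) D p -> ex_hessian W p /\
     exists r c (k : vec), D r /\ 0 < c /\ (forall i, 0 < k i) /\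
       forall v, hessian_form W p v = - c * angle_form st ct K r (fun i => k i * v i)).
Proof.
  intros HF. set (q := inradius_factor s eps).
  assert (ygrad : forall i, grad_on D (fun r => y r i) (fun r j => s (r i) * y_jacobian s st eps K r i j)).
  { intros i. apply (y_grad D y ia ib ja jb h s ds st ct c2 kappa sigma eps beta K sgn); apply Fam. }
  assert (ycont : forall i, cont_on D (fun r => y r i)).
  { intros i. apply (y_cont D y ia ib ja jb h s ds st ct c2 kappa sigma eps beta K sgn); apply Fam. }
  assert (qcont : cont_on D q).
  { apply (q_cont D ja jb s ds st ct c2 kappa sigma eps beta K); apply Fam. }
  assert (Bcont : forall i j, cont_on D (fun r => y_jacobian s st eps K r i j)).
  { intros i j. apply (y_jacobian_cont D ja jb s ds st ct c2 kappa sigma eps beta K); apply Fam. }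
  assert (qpos : forall r, D r -> 0 < q r).
  { intros r Dr. apply (q_pos D ja jb s eps); try apply Fam; auto. }
  assert (sd := trig_s_derive (fam_trig Fam)).
  assert (dsd := trig_ds_derive (fam_trig Fam)).
  split.
  - apply (primitive_exists D y ia ib ja jb h s ds c2 q (y_jacobian s st eps K) a); try apply Fam; auto.
    intros; apply y_jacobian_sym.
  - intros W HW p Hp.
    destruct (hessian_in_u D y ia ib ja jb h s ds q (y_jacobian s st eps K))
      with (lam := lam) (F := F) (W := W) (p := p) as [H1 [r [Dr E]]]; try apply Fam; auto.
    { intros; apply y_jacobian_sym. }
    split; [assumption|].
    assert (sp : forall i, 0 < s (r i)) by (intros; apply (fam_s_pos Fam), (fam_J Fam), Dr).
    assert (tp : 0 < s (total r)).
    { assert (H := fam_total Fam r Dr). rewrite eps_1 in H. lra. }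
    exists r, (Rpower (q r) lam * (q r * (s (r i1) * s (r i2) * s (r i3)) / s (total r))),
      (fun i => Rpower (s (r i)) (lam + 1) / s (r i)).
    split; [assumption|]. split; [|split].
    + apply Rmult_lt_0_compat; [apply Rpower_pos|]. apply Rdiv_lt_0_compat; [|assumption].
      repeat apply Rmult_lt_0_compat; auto.
    + intros i. apply Rdiv_lt_0_compat; [apply Rpower_pos|auto].
    + intros v. rewrite E.
      rewrite (jacobian_form D ja jb s ds st ct c2 kappa sigma eps beta K) with
        (x := fun i => v i * Rpower (s (r i)) (lam + 1)); try apply Fam; auto.
      fold q.
      assert (X : (fun i => v i * Rpower (s (r i)) (lam + 1) / s (r i))
              = (fun i => Rpower (s (r i)) (lam + 1) / s (r i) * v i))
        by (extensionality i; unfold Rdiv; ring).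
      rewrite X. ring.
Qed.

Lemma family_concave :
  (forall r X, D r -> 0 <= angle_form st ct K r X) ->
  integration_is locally_concave D y (oo ia ib) h s.
Proof.
  intros H lam F HF. destruct (family_hessian lam F HF) as [Hex HW].
  split; [exact Hex|]. intros W PW p Hp.
  destruct (HW W PW p Hp) as [H1 [r [c [k [Dr [cp [kp E]]]]]]].
  split; [exact H1|]. intros v. rewrite E.
  assert (N := H r (fun i => k i * v i) Dr). nra.
Qed.

Lemma family_strictly_concave :
  (forall r X, D r -> (exists i, X i <> 0) -> 0 < angle_form st ct K r X) ->
  integration_is locally_strictly_concave D y (oo ia ib) h s.
Proof.
  intros H lam F HF. destruct (family_hessian lam F HF) as [Hex HW].
  split; [exact Hex|]. intros W PW p Hp.
  destruct (HW W PW p Hp) as [H1 [r [c [k [Dr [cp [kp E]]]]]]].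
  split; [exact H1|]. intros v [i vi]. rewrite E.
  assert (N : 0 < angle_form st ct K r (fun i => k i * v i)).
  { apply H; [assumption|]. exists i. apply Rmult_integral_contrapositive_currified; [|assumption].
    apply Rgt_not_eq, kp. }
  nra.
Qed.

End Integrate.

End Family.

Arguments trig_family : clear implicits.
Arguments reachable : clear implicits.

(** * Hyperbolic and trigonometric identities *)

Lemma cosh_plus x z : cosh (x + z) = cosh x * cosh z + sinh x * sinh z.
Proof. unfold cosh, sinh. rewrite Ropp_plus_distr, !exp_plus. field. Qed.

Lemma sinh_plus x z : sinh (x + z) = sinh x * cosh z + cosh x * sinh z.
Proof. unfold cosh, sinh. rewrite Ropp_plus_distr, !exp_plus. field. Qed.

Lemma cosh_sqr x : cosh x ^ 2 = 1 + sinh x ^ 2.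
Proof.
  assert (H : exp x * exp (- x) = 1) by (rewrite <- exp_plus, Rplus_opp_r; apply exp_0).
  unfold cosh, sinh. nra.
Qed.

Lemma cosh_pos x : 0 < cosh x.
Proof. unfold cosh. assert (H1 := exp_pos x). assert (H2 := exp_pos (- x)). lra. Qed.

Lemma sinh_pos x : 0 < x -> 0 < sinh x.
Proof. intros H. rewrite <- sinh_0. now apply sinh_lt. Qed.

Lemma sinh_opp x : sinh (- x) = - sinh x.
Proof. unfold sinh. rewrite Ropp_involutive. field. Qed.

Lemma cosh_opp x : cosh (- x) = cosh x.
Proof. unfold cosh. rewrite Ropp_involutive. field. Qed.

Lemma cosh_minus x z : cosh (x - z) = cosh x * cosh z - sinh x * sinh z.
Proof. unfold Rminus at 1. rewrite cosh_plus, cosh_opp, sinh_opp. ring. Qed.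

Lemma sin_mul_sin x z : sin x * sin z = (cos (x - z) - cos (x + z)) / 2.
Proof. rewrite cos_minus, cos_plus. field. Qed.

Lemma cos_mul_cos x z : cos x * cos z = (cos (x - z) + cos (x + z)) / 2.
Proof. rewrite cos_minus, cos_plus. field. Qed.

Lemma sinh_mul_sinh x z : sinh x * sinh z = (cosh (x + z) - cosh (x - z)) / 2.
Proof. rewrite cosh_minus, cosh_plus. field. Qed.

Lemma cosh_mul_cosh x z : cosh x * cosh z = (cosh (x + z) + cosh (x - z)) / 2.
Proof. rewrite cosh_minus, cosh_plus. field. Qed.

Lemma is_derive_cosh x : is_derive cosh x (sinh x).
Proof. apply is_derive_Reals, derivable_pt_lim_cosh. Qed.

Lemma is_derive_sinh x : is_derive sinh x (cosh x).
Proof. apply is_derive_Reals, derivable_pt_lim_sinh. Qed.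

Lemma derive_continuous (f : R -> R) x l : is_derive f x l -> continuous f x.
Proof. intros H. apply (ex_derive_continuous (V := R_NormedModule)). eexists. exact H. Qed.

Lemma trig_id : trig (fun r => r) (fun _ => 1) (fun r => r) (fun _ => 1) 0 (- (1 / 2)) 1 1 1 1.
Proof.
  constructor; intros; try (ring || field || lra).
  - apply (is_derive_id x).
  - eapply is_derive_eq; [apply (is_derive_const (V := R_NormedModule))|]. unfold zero; simpl; ring.
  - apply continuous_id.
Qed.

Lemma trig_sinh : trig sinh cosh sinh cosh 1 (- (1 / 2)) 1 1 1 1.
Proof.
  constructor; intros; try (ring || lra).
  - apply is_derive_sinh.
  - eapply is_derive_eq; [apply is_derive_cosh|ring].
  - eapply derive_continuous, is_derive_sinh.
  - apply sinh_plus.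
  - rewrite cosh_plus, sinh_plus.
    transitivity ((sinh x ^ 2 - cosh x ^ 2) * sinh z); [ring|rewrite cosh_sqr; field].
  - rewrite !sinh_plus, !cosh_plus. field.
  - rewrite !Rmult_1_l, !sinh_mul_sinh.
    replace (a + (a + b + c)) with (a + b + (a + c)) by ring.
    replace (a - (a + b + c)) with (- (b + c)) by ring.
    replace (a + b - (a + c)) with (b - c) by ring.
    rewrite cosh_opp. field.
Qed.

Lemma trig_sin : trig sin cos sin cos (-1) (- (1 / 2)) 1 1 1 1.
Proof.
  constructor; intros; try (ring || lra).
  - apply is_derive_sin.
  - eapply is_derive_eq; [apply is_derive_cos|ring].
  - eapply derive_continuous, is_derive_sin.
  - apply sin_plus.
  - rewrite cos_plus, sin_plus.
    transitivity (- ((sin x)² + (cos x)²) * sin z); [unfold Rsqr; ring|rewrite sin2_cos2; field].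
  - rewrite !sin_plus, !cos_plus. field.
  - rewrite !Rmult_1_l, !sin_mul_sin.
    replace (a + (a + b + c)) with (a + b + (a + c)) by ring.
    replace (a - (a + b + c)) with (- (b + c)) by ring.
    replace (a + b - (a + c)) with (b - c) by ring.
    rewrite cos_neg. field.
Qed.

(** [trig_mul] sees only the product [sigma * eps], which is [-1] in both geometries with prescribed
    angles: [tanh] has [sigma = -1] with [eps = 1], and [tan] has [sigma = 1] with [eps = -1]. *)
Lemma trig_cos sigma eps : sigma * eps = -1 ->
  trig cos (fun x => - sin x) sin cos (-1) (1 / 2) sigma eps 1 (-1).
Proof.
  intros H1. constructor; intros; try (ring || lra).
  - apply is_derive_cos.
  - eapply is_derive_eq; [apply (is_derive_opp (V := R_NormedModule)), is_derive_sin|].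
    unfold opp; simpl; ring.
  - eapply derive_continuous, is_derive_sin.
  - apply sin_plus.
  - rewrite cos_plus, sin_plus.
    transitivity (- ((sin x)² + (cos x)²) * sin z); [unfold Rsqr; ring|rewrite sin2_cos2; field].
  - rewrite !sin_plus, !cos_plus. field.
  - rewrite H1. rewrite Rmult_1_l, sin_mul_sin.
    replace (-1 * cos a * cos (a + b + c)) with (- (cos a * cos (a + b + c))) by ring.
    rewrite !cos_mul_cos.
    replace (a + (a + b + c)) with (a + b + (a + c)) by ring.
    replace (a - (a + b + c)) with (- (b + c)) by ring.
    replace (a + b - (a + c)) with (b - c) by ring.
    rewrite cos_neg. field.
Qed.

Lemma trig_cosh : trig cosh sinh sinh cosh 1 (1 / 2) (-1) 1 (-1) (-1).
Proof.
  constructor; intros; try (ring || lra).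
  - apply is_derive_cosh.
  - eapply is_derive_eq; [apply is_derive_sinh|ring].
  - eapply derive_continuous, is_derive_sinh.
  - apply sinh_plus.
  - rewrite cosh_plus, sinh_plus.
    transitivity ((cosh x ^ 2 - sinh x ^ 2) * sinh z); [ring|rewrite cosh_sqr; field].
  - rewrite !sinh_plus, !cosh_plus. field.
  - replace (-1 * sinh (a + b) * sinh (a + c)) with (- (sinh (a + b) * sinh (a + c))) by ring.
    replace (-1 * 1 * cosh a * cosh (a + b + c)) with (- (cosh a * cosh (a + b + c))) by ring.
    rewrite sinh_mul_sinh, !cosh_mul_cosh.
    replace (a + (a + b + c)) with (a + b + (a + c)) by ring.
    replace (a - (a + b + c)) with (- (b + c)) by ring.
    replace (a + b - (a + c)) with (b - c) by ring.
    rewrite cosh_opp. field.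
Qed.

Lemma oo_fin (a b x : R) : oo a b x -> a < x < b.
Proof. trivial. Qed.

Lemma oo_fin_intro (a b x : R) : a < x < b -> oo a b x.
Proof. trivial. Qed.

Lemma oo_pos x : oo 0 p_infty x -> 0 < x.
Proof. now intros [H _]. Qed.

Lemma oo_pos_intro x : 0 < x -> oo 0 p_infty x.
Proof. intros H. now split. Qed.

Lemma is_derive_half t : is_derive (fun t => t / 2) t (1 / 2).
Proof. auto_derive; [exact I|field]. Qed.

Lemma half_sin_pos t : 0 < t < PI -> 0 < sin (t / 2).
Proof. intros. apply sin_gt_0; lra. Qed.

Lemma half_cos_pos t : 0 < t < PI -> 0 < cos (t / 2).
Proof. intros. apply cos_gt_0; lra. Qed.

Lemma half_cot_pos t : oo 0 PI t -> 0 < cot (t / 2).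
Proof.
  intros Ht%oo_fin. apply Rdiv_lt_0_compat; [now apply half_cos_pos|now apply half_sin_pos].
Qed.

Lemma half_cot_derive t : oo 0 PI t ->
  is_derive (fun t => cot (t / 2)) t (- (1 / 2) * (1 + 1 * cot (t / 2) ^ 2)).
Proof.
  intros Ht%oo_fin. assert (p := half_sin_pos t Ht). unfold cot.
  eapply is_derive_eq.
  - apply is_derive_div.
    + apply (is_derive_Rcomp cos (fun t => t / 2)); [apply is_derive_cos|apply is_derive_half].
    + apply (is_derive_Rcomp sin (fun t => t / 2)); [apply is_derive_sin|apply is_derive_half].
    + lra.
  - cbv beta. field. lra.
Qed.

Lemma half_cot_sign t : 0 < -1 * (- (1 / 2) * (1 + 1 * cot (t / 2) ^ 2)).
Proof. nra. Qed.

Lemma half_tan_pos t : oo 0 PI t -> 0 < tan (t / 2).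
Proof.
  intros Ht%oo_fin. apply Rdiv_lt_0_compat; [now apply half_sin_pos|now apply half_cos_pos].
Qed.

Lemma half_tan_derive t : oo 0 PI t ->
  is_derive (fun t => tan (t / 2)) t (1 / 2 * (1 + 1 * tan (t / 2) ^ 2)).
Proof.
  intros Ht%oo_fin. assert (p := half_cos_pos t Ht). unfold tan.
  eapply is_derive_eq.
  - apply is_derive_div.
    + apply (is_derive_Rcomp sin (fun t => t / 2)); [apply is_derive_sin|apply is_derive_half].
    + apply (is_derive_Rcomp cos (fun t => t / 2)); [apply is_derive_cos|apply is_derive_half].
    + lra.
  - cbv beta. field. lra.
Qed.

Lemma half_tan_sign t : 0 < 1 * (1 / 2 * (1 + 1 * tan (t / 2) ^ 2)).
Proof. nra. Qed.

Lemma tanh_lt_1 x : tanh x < 1.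
Proof.
  apply Rlt_div_l; [apply cosh_pos|]. unfold sinh, cosh. assert (e := exp_pos (- x)). lra.
Qed.

Lemma half_tanh_pos t : oo 0 p_infty t -> 0 < tanh (t / 2).
Proof.
  intros Ht%oo_pos. apply Rdiv_lt_0_compat; [apply sinh_pos; lra|apply cosh_pos].
Qed.

Lemma half_tanh_derive t :
  is_derive (fun t => tanh (t / 2)) t (1 / 2 * (1 + -1 * tanh (t / 2) ^ 2)).
Proof.
  assert (p := cosh_pos (t / 2)). unfold tanh.
  eapply is_derive_eq.
  - apply is_derive_div.
    + apply (is_derive_Rcomp sinh (fun t => t / 2)); [apply is_derive_sinh|apply is_derive_half].
    + apply (is_derive_Rcomp cosh (fun t => t / 2)); [apply is_derive_cosh|apply is_derive_half].
    + lra.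
  - cbv beta. field. lra.
Qed.

Lemma half_tanh_sign t : 0 < 1 * (1 / 2 * (1 + -1 * tanh (t / 2) ^ 2)).
Proof.
  assert (p := cosh_pos (t / 2)). assert (C := cosh_sqr (t / 2)).
  replace (1 * (1 / 2 * (1 + -1 * tanh (t / 2) ^ 2)))
    with ((cosh (t / 2) ^ 2 - sinh (t / 2) ^ 2) / (2 * cosh (t / 2) ^ 2))
    by (unfold tanh; field; lra).
  apply Rdiv_lt_0_compat; nra.
Qed.

Lemma half_coth_pos t : oo 0 p_infty t -> 0 < coth (t / 2).
Proof.
  intros Ht%oo_pos. apply Rdiv_lt_0_compat; [apply cosh_pos|apply sinh_pos; lra].
Qed.

Lemma half_coth_derive t : oo 0 p_infty t ->
  is_derive (fun t => coth (t / 2)) t (1 / 2 * (1 + -1 * coth (t / 2) ^ 2)).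
Proof.
  intros Ht%oo_pos. assert (p : 0 < sinh (t / 2)) by (apply sinh_pos; lra). unfold coth.
  eapply is_derive_eq.
  - apply is_derive_div.
    + apply (is_derive_Rcomp cosh (fun t => t / 2)); [apply is_derive_cosh|apply is_derive_half].
    + apply (is_derive_Rcomp sinh (fun t => t / 2)); [apply is_derive_sinh|apply is_derive_half].
    + lra.
  - cbv beta. field. lra.
Qed.

Lemma half_coth_sign t : oo 0 p_infty t -> 0 < -1 * (1 / 2 * (1 + -1 * coth (t / 2) ^ 2)).
Proof.
  intros Ht%oo_pos. assert (p : 0 < sinh (t / 2)) by (apply sinh_pos; lra).
  assert (C := cosh_sqr (t / 2)).
  replace (-1 * (1 / 2 * (1 + -1 * coth (t / 2) ^ 2)))
    with ((cosh (t / 2) ^ 2 - sinh (t / 2) ^ 2) / (2 * sinh (t / 2) ^ 2))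
    by (unfold coth; field; lra).
  apply Rdiv_lt_0_compat; nra.
Qed.

(** * The cosine laws in half-angle form *)

Lemma total_cyclic r i : r i + r (nxt i) + r (nxt (nxt i)) = total r.
Proof. unfold total; destruct i; simpl; ring. Qed.

Lemma nxt3 i : nxt (nxt (nxt i)) = i.
Proof. now destruct i. Qed.

Lemma h_from_square (s : R -> R) eps r i z :
  (forall j, 0 < s (r j)) -> 0 < eps * s (total r) -> 0 < z ->
  z ^ 2 = eps * (s (r i) * s (total r)) / (s (r (nxt i)) * s (r (nxt (nxt i)))) ->
  z = s (r i) * inradius_factor s eps r.
Proof.
  intros sp tp zp E.
  destruct (inradius_factor_spec s eps r sp tp) as [qp q2].
  apply Rsqr_inj; [lra|apply Rmult_le_pos; [apply Rlt_le, sp|lra]|].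
  assert (n : forall j, s (r j) <> 0) by (intros j; apply Rgt_not_eq, sp).
  rewrite !Rsqr_pow2, E. rewrite (Rmult_comm (s (r i)) (s (total r))), <- Rmult_assoc, <- (q2 i).
  field. split; auto.
Qed.

Lemma half_angle_cos t : cos t = 2 * cos (t / 2) ^ 2 - 1 /\ cos t = 1 - 2 * sin (t / 2) ^ 2.
Proof.
  replace t with (2 * (t / 2)) at 1 3 by field. split.
  - rewrite cos_2a_cos. ring.
  - rewrite cos_2a_sin. ring.
Qed.

Lemma half_angle_cosh t : cosh t = 2 * cosh (t / 2) ^ 2 - 1 /\ cosh t = 1 + 2 * sinh (t / 2) ^ 2.
Proof.
  assert (C := cosh_sqr (t / 2)).
  replace t with (t / 2 + t / 2) at 1 3 by field. rewrite cosh_plus. split; nra.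
Qed.

Lemma cos_between t : 0 < t < PI -> -1 < cos t < 1.
Proof.
  intros Ht. destruct (half_angle_cos t) as [E1 E2].
  assert (H1 := half_cos_pos t Ht). assert (H2 := half_sin_pos t Ht).
  assert (H3 := pow_lt _ 2 H1). assert (H4 := pow_lt _ 2 H2). lra.
Qed.

Lemma cosh_gt_1 t : 0 < t -> 1 < cosh t.
Proof.
  intros Ht. destruct (half_angle_cosh t) as [_ E2].
  assert (H2 : 0 < sinh (t / 2)) by (apply sinh_pos; lra).
  assert (H4 := pow_lt _ 2 H2). lra.
Qed.

(** The quotient of the two equations is the half-angle formula. [P] is the product of sines in a
    cosine law. The signs of [X] and [Y] are kept because the constraints on [r] are read off from
    them. *)
Lemma half_cot_ratio t P X Y : 0 < t < PI -> 0 < P ->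
  (1 + cos t) * P = 2 * X -> (1 - cos t) * P = 2 * Y ->
  0 < X /\ 0 < Y /\ cot (t / 2) ^ 2 = X / Y.
Proof.
  intros Ht Pp EX EY. assert (B := cos_between t Ht).
  assert (Xp : 0 < X) by nra. assert (Yp : 0 < Y) by nra.
  split; [assumption|]. split; [assumption|].
  destruct (half_angle_cos t) as [E1 E2]. assert (H2 := half_sin_pos t Ht).
  replace X with ((1 + cos t) * P / 2) by lra. replace Y with ((1 - cos t) * P / 2) by lra.
  rewrite E1 at 1. rewrite E2. unfold cot. field. split; nra.
Qed.

Lemma half_tan_ratio t P X Y : 0 < t < PI -> 0 < P ->
  (1 + cos t) * P = 2 * X -> (1 - cos t) * P = 2 * Y ->
  0 < X /\ 0 < Y /\ tan (t / 2) ^ 2 = Y / X.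
Proof.
  intros Ht Pp EX EY. assert (B := cos_between t Ht).
  assert (Xp : 0 < X) by nra. assert (Yp : 0 < Y) by nra.
  split; [assumption|]. split; [assumption|].
  destruct (half_angle_cos t) as [E1 E2]. assert (H2 := half_cos_pos t Ht).
  replace X with ((1 + cos t) * P / 2) by lra. replace Y with ((1 - cos t) * P / 2) by lra.
  rewrite E2 at 1. rewrite E1. unfold tan. field. split; nra.
Qed.

Lemma half_cosh_ratio t P X Y : 0 < t -> 0 < P ->
  (cosh t + 1) * P = 2 * X -> (cosh t - 1) * P = 2 * Y ->
  0 < X /\ 0 < Y /\ tanh (t / 2) ^ 2 = Y / X /\ coth (t / 2) ^ 2 = X / Y.
Proof.
  intros Ht Pp EX EY. assert (B := cosh_gt_1 t Ht).
  assert (Xp : 0 < X) by nra. assert (Yp : 0 < Y) by nra.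
  split; [assumption|]. split; [assumption|].
  destruct (half_angle_cosh t) as [E1 E2].
  assert (H1 := cosh_pos (t / 2)). assert (H2 : 0 < sinh (t / 2)) by (apply sinh_pos; lra).
  replace X with ((cosh t + 1) * P / 2) by lra. replace Y with ((cosh t - 1) * P / 2) by lra.
  split.
  - rewrite E2 at 1. rewrite E1. unfold tanh. field. split; nra.
  - rewrite E1 at 1. rewrite E2. unfold coth. field. split; nra.
Qed.

Definition arcosh (v : R) : R := arcsinh (sqrt (v ^ 2 - 1)).

Lemma arcosh_pos v : 1 < v -> 0 < arcosh v.
Proof.
  intros H. rewrite <- arcsinh_0. apply arcsinh_lt, sqrt_lt_R0. nra.
Qed.

Lemma cosh_arcosh v : 1 < v -> cosh (arcosh v) = v.
Proof.
  intros H. apply Rsqr_inj; [apply Rlt_le, cosh_pos|lra|].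
  rewrite !Rsqr_pow2, cosh_sqr. unfold arcosh.
  rewrite sinh_arcsinh, pow2_sqrt by nra. ring.
Qed.

(** The arising [r], described by inequalities. [total r] is half the sum of the three pair sums,
    and [r i] is half of two of them minus the third. So [0 < r i] is a triangle inequality,
    [total r < PI] bounds a spherical perimeter by [2 * PI], comparing [total r] with [PI / 2]
    compares an angle sum with [PI], and [r i < PI / 2] is the triangle inequality of the polar
    triangle. *)
Definition dom_pos (r : vec) : Prop := forall i, 0 < r i.
Definition dom_sph (r : vec) : Prop := (forall i, 0 < r i) /\ total r < PI.
Definition dom_hyp_angles (r : vec) : Prop := (forall i, 0 < pair_sum r i) /\ total r < PI / 2.
Definition dom_sph_angles (r : vec) : Prop := (forall i, r i < PI / 2) /\ PI / 2 < total r.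
Definition dom_hex (r : vec) : Prop := forall i, 0 < pair_sum r i.

Lemma pair_sum_nxt r i : pair_sum r (nxt i) = r (nxt (nxt i)) + r i.
Proof. unfold pair_sum. now rewrite nxt3. Qed.

Lemma pair_sum_nxt2 r i : pair_sum r (nxt (nxt i)) = r i + r (nxt i).
Proof. unfold pair_sum. now rewrite !nxt3. Qed.

Lemma pair_sum_total r i : pair_sum r i = total r - r i.
Proof. rewrite <- (total_cyclic r i). unfold pair_sum. ring. Qed.

(** [total r] is the semiperimeter and [r i] the semiperimeter minus the side opposite [y i], which
    makes this the classical formula for the half-angle cotangent. *)
Lemma euclidean_half r y i : euclidean_triangle (pair_sum r) y ->
  0 < r i /\ cot (y i / 2) ^ 2 = r i * total r / (r (nxt i) * r (nxt (nxt i))).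
Proof.
  intros H. destruct (H i) as [li [ti E]].
  destruct (H (nxt i)) as [lj _]. destruct (H (nxt (nxt i))) as [lk _].
  rewrite pair_sum_nxt in lj, E. rewrite pair_sum_nxt2 in lk, E. unfold pair_sum in li, E.
  assert (tot := total_cyclic r i).
  set (a := r i) in *. set (b := r (nxt i)) in *. set (c := r (nxt (nxt i))) in *.
  destruct (half_cot_ratio (y i) ((c + a) * (a + b)) (a * (a + b + c)) (b * c)) as [X [Y R]];
    [assumption|now apply Rmult_lt_0_compat|nra|nra|].
  (* [X] bounds below the product of [r i] and the semiperimeter, and the latter is half a sum of
     positive sides. *)
  split; [|now rewrite <- tot]. nra.
Qed.

Lemma euclidean_exists r : dom_pos r -> arising euclidean_triangle r.
Proof.
  intros P.
  exists (fun i => acos (1 - 2 * (r (nxt i) * r (nxt (nxt i)))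
                         / ((r (nxt (nxt i)) + r i) * (r i + r (nxt i))))).
  intros i. simpl. rewrite pair_sum_nxt, pair_sum_nxt2. unfold pair_sum.
  assert (ap := P i). assert (bp := P (nxt i)). assert (cp := P (nxt (nxt i))).
  set (a := r i) in *. set (b := r (nxt i)) in *. set (c := r (nxt (nxt i))) in *.
  assert (V : -1 < 1 - 2 * (b * c) / ((c + a) * (a + b)) < 1).
  { assert (0 < 2 * (b * c) / ((c + a) * (a + b)) < 2); [|lra]. split.
    - apply Rdiv_lt_0_compat; nra.
    - apply Rlt_div_l; nra. }
  split; [lra|]. split; [now apply acos_bound_lt|].
  rewrite cos_acos by lra. field. nra.
Qed.

(** Product-to-sum formulas arranged around the pair sums: by the cosine law the right-hand sides
    are [1 + cos] and [1 - cos] of the opposite angle, each times [sinh (c + a) * sinh (a + b)]. *)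
Lemma sinh_products a b c :
  2 * (sinh a * sinh (a + b + c))
    = cosh (c + a) * cosh (a + b) + sinh (c + a) * sinh (a + b) - cosh (b + c) /\
  2 * (sinh b * sinh c)
    = cosh (b + c) - (cosh (c + a) * cosh (a + b) - sinh (c + a) * sinh (a + b)).
Proof.
  rewrite <- cosh_plus, <- cosh_minus. split; rewrite sinh_mul_sinh.
  - replace (a - (a + b + c)) with (- (b + c)) by ring.
    rewrite cosh_opp. replace (a + (a + b + c)) with ((c + a) + (a + b)) by ring. field.
  - replace (c + a - (a + b)) with (- (b - c)) by ring. rewrite cosh_opp. field.
Qed.

Lemma cosh_products a b c :
  2 * (cosh a * cosh (a + b + c))
    = cosh (b + c) + (cosh (c + a) * cosh (a + b) + sinh (c + a) * sinh (a + b)) /\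
  2 * (cosh b * cosh c)
    = cosh (b + c) + (cosh (c + a) * cosh (a + b) - sinh (c + a) * sinh (a + b)).
Proof.
  rewrite <- cosh_plus, <- cosh_minus. split; rewrite cosh_mul_cosh.
  - replace (a - (a + b + c)) with (- (b + c)) by ring.
    rewrite cosh_opp. replace (a + (a + b + c)) with ((c + a) + (a + b)) by ring. field.
  - replace (c + a - (a + b)) with (- (b - c)) by ring. rewrite cosh_opp. field.
Qed.

Lemma sin_products a b c :
  2 * (sin a * sin (a + b + c))
    = cos (b + c) - (cos (c + a) * cos (a + b) - sin (c + a) * sin (a + b)) /\
  2 * (sin b * sin c)
    = cos (c + a) * cos (a + b) + sin (c + a) * sin (a + b) - cos (b + c).
Proof.
  rewrite <- cos_plus, <- cos_minus. split; rewrite sin_mul_sin.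
  - replace (a - (a + b + c)) with (- (b + c)) by ring.
    rewrite cos_neg. replace (a + (a + b + c)) with ((c + a) + (a + b)) by ring. field.
  - replace (c + a - (a + b)) with (- (b - c)) by ring. rewrite cos_neg. field.
Qed.

Lemma cos_products a b c :
  2 * (cos a * cos (a + b + c))
    = cos (b + c) + (cos (c + a) * cos (a + b) - sin (c + a) * sin (a + b)) /\
  2 * (cos b * cos c)
    = cos (b + c) + (cos (c + a) * cos (a + b) + sin (c + a) * sin (a + b)).
Proof.
  rewrite <- cos_plus, <- cos_minus. split; rewrite cos_mul_cos.
  - replace (a - (a + b + c)) with (- (b + c)) by ring.
    rewrite cos_neg. replace (a + (a + b + c)) with ((c + a) + (a + b)) by ring. field.
  - replace (c + a - (a + b)) with (- (b - c)) by ring. rewrite cos_neg. field.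
Qed.

Lemma hyperbolic_half r y i : hyperbolic_triangle (pair_sum r) y ->
  0 < r i /\ cot (y i / 2) ^ 2 = sinh (r i) * sinh (total r) / (sinh (r (nxt i)) * sinh (r (nxt (nxt i)))).
Proof.
  intros H. destruct (H i) as [li [ti E]].
  destruct (H (nxt i)) as [lj _]. destruct (H (nxt (nxt i))) as [lk _].
  rewrite pair_sum_nxt in lj, E. rewrite pair_sum_nxt2 in lk, E. unfold pair_sum in li, E.
  assert (tot := total_cyclic r i).
  set (a := r i) in *. set (b := r (nxt i)) in *. set (c := r (nxt (nxt i))) in *.
  assert (sj := sinh_pos _ lj). assert (sk := sinh_pos _ lk).
  destruct (sinh_products a b c) as [E1 E2].
  destruct (half_cot_ratio (y i) (sinh (c + a) * sinh (a + b)) (sinh a * sinh (a + b + c)) (sinh b * sinh c))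
    as [X [Y R]]; [assumption|now apply Rmult_lt_0_compat|lra|lra|].
  split; [|now rewrite <- tot].
  assert (tp : 0 < sinh (a + b + c)) by (apply sinh_pos; lra).
  assert (0 < sinh a) by nra. rewrite <- sinh_0 in H0.
  apply Rnot_le_lt. intros L. destruct L as [L|L].
  - apply sinh_lt in L. lra.
  - rewrite L in H0. lra.
Qed.

Lemma hyperbolic_exists r : dom_pos r -> arising hyperbolic_triangle r.
Proof.
  intros P.
  exists (fun i => acos ((cosh (r (nxt (nxt i)) + r i) * cosh (r i + r (nxt i))
                          - cosh (r (nxt i) + r (nxt (nxt i))))
                         / (sinh (r (nxt (nxt i)) + r i) * sinh (r i + r (nxt i))))).
  intros i. simpl. rewrite pair_sum_nxt, pair_sum_nxt2. unfold pair_sum.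
  assert (ap := P i). assert (bp := P (nxt i)). assert (cp := P (nxt (nxt i))).
  set (a := r i) in *. set (b := r (nxt i)) in *. set (c := r (nxt (nxt i))) in *.
  assert (sj : 0 < sinh (c + a)) by (apply sinh_pos; lra).
  assert (sk : 0 < sinh (a + b)) by (apply sinh_pos; lra).
  destruct (sinh_products a b c) as [E1 E2].
  assert (0 < sinh a * sinh (a + b + c)) by (apply Rmult_lt_0_compat; apply sinh_pos; lra).
  assert (0 < sinh b * sinh c) by (apply Rmult_lt_0_compat; apply sinh_pos; lra).
  assert (PP : 0 < sinh (c + a) * sinh (a + b)) by now apply Rmult_lt_0_compat.
  assert (V : -1 < (cosh (c + a) * cosh (a + b) - cosh (b + c)) / (sinh (c + a) * sinh (a + b)) < 1).
  { split; [apply Rlt_div_r|apply Rlt_div_l]; lra. }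
  split; [lra|]. split; [now apply acos_bound_lt|].
  rewrite cos_acos by lra. field. lra.
Qed.

Lemma spherical_half r y i : spherical_triangle (pair_sum r) y ->
  0 < sin (r i) * sin (total r) /\ 0 < sin (r (nxt i)) * sin (r (nxt (nxt i))) /\
  cot (y i / 2) ^ 2 = sin (r i) * sin (total r) / (sin (r (nxt i)) * sin (r (nxt (nxt i)))).
Proof.
  intros H. destruct (H i) as [li [ti E]].
  destruct (H (nxt i)) as [lj _]. destruct (H (nxt (nxt i))) as [lk _].
  rewrite pair_sum_nxt in lj, E. rewrite pair_sum_nxt2 in lk, E. unfold pair_sum in li, E.
  rewrite <- (total_cyclic r i).
  destruct (sin_products (r i) (r (nxt i)) (r (nxt (nxt i)))) as [E1 E2].
  set (a := r i) in *. set (b := r (nxt i)) in *. set (c := r (nxt (nxt i))) in *.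
  assert (sj : 0 < sin (c + a)) by (apply sin_gt_0; lra).
  assert (sk : 0 < sin (a + b)) by (apply sin_gt_0; lra).
  apply (half_cot_ratio (y i) (sin (c + a) * sin (a + b)));
    [assumption|now apply Rmult_lt_0_compat|lra|lra].
Qed.

(** The half-angle formula only says that each [sin (r i)] has the sign of [sin (total r)]. Pair
    sums in [(0, PI)] force every [r i] below [PI], so negative sines would make all [r i] negative,
    against positive pair sums. With positive sines the bounds on the pair sums locate [r i] and
    [total r]. *)
Lemma spherical_dom r y : spherical_triangle (pair_sum r) y -> dom_sph r.
Proof.
  intros H.
  assert (L : forall i, 0 < pair_sum r i < PI) by (intros i; apply (H i)).
  assert (PP : forall i, 0 < sin (r i) * sin (total r)) by (intros i; apply (spherical_half r y i H)).
  assert (L1 := L i1). assert (L2 := L i2). assert (L3 := L i3).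
  assert (tot := total_cyclic r). unfold pair_sum in *; simpl in *. assert (t1 := tot i1). simpl in t1.
  assert (pi := PI_RGT_0).
  assert (Tp : 0 < sin (total r)).
  { apply Rnot_le_lt. intros N.
    assert (neg : forall i, sin (r i) < 0) by (intros i; specialize (PP i); nra).
    assert (le0 : forall i, r i < PI -> r i < 0).
    { intros i Hi. apply Rnot_le_lt. intros Hp. specialize (neg i).
      assert (0 <= sin (r i)) by (apply sin_ge_0; lra). lra. }
    assert (r i1 < 0) by (apply le0; lra). assert (r i2 < 0) by (apply le0; lra). lra. }
  assert (pos : forall i, 0 < sin (r i)) by (intros i; specialize (PP i); nra).
  assert (rp : forall i, - PI <= r i -> 0 < r i).
  { intros i Hi. apply Rnot_le_lt. intros Hn. specialize (pos i).
    assert (0 <= sin (- r i)) by (apply sin_ge_0; lra). rewrite sin_neg in H0. lra. }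
  split.
  - intros i. apply rp. destruct i; lra.
  - apply Rnot_le_lt. intros Hn.
    assert (sin (total r) <= 0) by (apply sin_le_0; lra). lra.
Qed.

Lemma spherical_exists r : dom_sph r -> arising spherical_triangle r.
Proof.
  intros [P TP].
  exists (fun i => acos ((cos (r (nxt i) + r (nxt (nxt i)))
                          - cos (r (nxt (nxt i)) + r i) * cos (r i + r (nxt i)))
                         / (sin (r (nxt (nxt i)) + r i) * sin (r i + r (nxt i))))).
  intros i. simpl. rewrite pair_sum_nxt, pair_sum_nxt2. unfold pair_sum.
  assert (ap := P i). assert (bp := P (nxt i)). assert (cp := P (nxt (nxt i))).
  rewrite <- (total_cyclic r i) in TP.
  destruct (sin_products (r i) (r (nxt i)) (r (nxt (nxt i)))) as [E1 E2].
  set (a := r i) in *. set (b := r (nxt i)) in *. set (c := r (nxt (nxt i))) in *.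
  assert (sj : 0 < sin (c + a)) by (apply sin_gt_0; lra).
  assert (sk : 0 < sin (a + b)) by (apply sin_gt_0; lra).
  assert (0 < sin a * sin (a + b + c)) by (apply Rmult_lt_0_compat; apply sin_gt_0; lra).
  assert (0 < sin b * sin c) by (apply Rmult_lt_0_compat; apply sin_gt_0; lra).
  assert (PP : 0 < sin (c + a) * sin (a + b)) by now apply Rmult_lt_0_compat.
  assert (V : -1 < (cos (b + c) - cos (c + a) * cos (a + b)) / (sin (c + a) * sin (a + b)) < 1).
  { split; [apply Rlt_div_r|apply Rlt_div_l]; lra. }
  split; [lra|]. split; [now apply acos_bound_lt|].
  rewrite cos_acos by lra. field. lra.
Qed.

(* Passes from the cosine law to its dual in the hyperbolic ([nu = 1]) and
   spherical ([nu = -1]) cases, in either direction: [S], [T] play the sines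
   of the quantities with cosines [x], [z]. *)
Lemma dual_law (x S z T : vec) mu nu rho :
  mu ^ 2 = 1 -> nu ^ 2 = 1 -> rho ^ 2 = 1 ->
  (forall i, 0 < S i) -> (forall i, S i ^ 2 = nu * (x i ^ 2 - 1)) ->
  (forall i, z i * S (nxt i) * S (nxt (nxt i)) = mu * (x (nxt i) * x (nxt (nxt i)) - x i)) ->
  (forall i, 0 < T i) -> (forall i, T i ^ 2 = rho * (z i ^ 2 - 1)) ->
  forall i, mu * nu * z i + z (nxt i) * z (nxt (nxt i)) = - rho * x i * T (nxt i) * T (nxt (nxt i)).
Proof.
  intros mu2 nu2 rho2 Sp S2 Hz Tp T2 i.
  (* The Gram determinant of the symmetric matrix with unit diagonal and off-diagonal entries
     [x i1], [x i2], [x i3]. *)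
  set (Delta := 1 + 2 * x i1 * x i2 * x i3 - x i1 ^ 2 - x i2 ^ 2 - x i3 ^ 2).
  assert (W2 : forall i, (T i * S (nxt i) * S (nxt (nxt i))) ^ 2 = - rho * Delta).
  { clear i. intros i.
    transitivity (rho * ((z i * S (nxt i) * S (nxt (nxt i))) ^ 2
                         - S (nxt i) ^ 2 * S (nxt (nxt i)) ^ 2)).
    - rewrite !Rpow_mult_distr, T2. ring.
    - rewrite Hz, !S2, Rpow_mult_distr, mu2.
      transitivity (rho * (1 * (x (nxt i) * x (nxt (nxt i)) - x i) ^ 2
        - nu ^ 2 * (x (nxt i) ^ 2 - 1) * (x (nxt (nxt i)) ^ 2 - 1))); [ring|].
      rewrite nu2. unfold Delta. destruct i; simpl; ring. }
  (* The sine law: the squares agree, being [- rho * Delta], and all factors are positive. *)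
  assert (W : forall i j, T i * S (nxt i) * S (nxt (nxt i)) = T j * S (nxt j) * S (nxt (nxt j))).
  { intros k l. apply Rsqr_inj; try (repeat apply Rmult_le_pos; apply Rlt_le; auto).
    now rewrite !Rsqr_pow2, !W2. }
  assert (Wi := W2 i). assert (Wj := W (nxt i) i). assert (Wk := W (nxt (nxt i)) i).
  assert (Zi := Hz i). assert (Zj := Hz (nxt i)). assert (Zk := Hz (nxt (nxt i))).
  rewrite !nxt3 in *.
  assert (Si := Sp i). assert (Sj := Sp (nxt i)). assert (Sk := Sp (nxt (nxt i))).
  assert (S2i := S2 i).
  assert (D : Delta = 1 + 2 * x i * x (nxt i) * x (nxt (nxt i)) - x i ^ 2 - x (nxt i) ^ 2 - x (nxt (nxt i)) ^ 2)
    by (unfold Delta; destruct i; simpl; ring).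
  (* After multiplication by this positive factor both sides equal [x i * Delta]. *)
  apply (Rmult_eq_reg_r (S i ^ 2 * S (nxt i) * S (nxt (nxt i)))).
  2:{ apply Rgt_not_eq. apply Rmult_lt_0_compat; [apply Rmult_lt_0_compat|]; auto. now apply pow_lt. }
  transitivity (x i * Delta).
  - transitivity (mu * nu * (z i * S (nxt i) * S (nxt (nxt i))) * S i ^ 2
      + (z (nxt i) * S (nxt (nxt i)) * S i) * (z (nxt (nxt i)) * S i * S (nxt i))); [ring|].
    rewrite Zi, Zj, Zk, S2i.
    transitivity (mu ^ 2 * nu ^ 2 * (x (nxt i) * x (nxt (nxt i)) - x i) * (x i ^ 2 - 1)
      + mu ^ 2 * (x (nxt (nxt i)) * x i - x (nxt i)) * (x i * x (nxt i) - x (nxt (nxt i)))); [ring|].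
    rewrite mu2, nu2, D. ring.
  - symmetry. transitivity (- rho * x i * ((T (nxt i) * S (nxt (nxt i)) * S i) *
      (T (nxt (nxt i)) * S i * S (nxt i)))); [ring|].
    rewrite Wj, Wk.
    transitivity (- rho * x i * (T i * S (nxt i) * S (nxt (nxt i))) ^ 2); [ring|].
    rewrite Wi. transitivity (rho ^ 2 * x i * Delta); [ring|]. rewrite rho2. ring.
Qed.

Lemma sinh_sqr x : sinh x ^ 2 = cosh x ^ 2 - 1.
Proof. rewrite cosh_sqr. ring. Qed.

Lemma sin_sqr x : sin x ^ 2 = 1 - cos x ^ 2.
Proof. assert (H := sin2_cos2 x). rewrite !Rsqr_pow2 in H. lra. Qed.

Lemma hyperbolic_dual l th : hyperbolic_triangle l th -> forall i,
  cos (th i) + cos (th (nxt i)) * cos (th (nxt (nxt i)))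
    = cosh (l i) * sin (th (nxt i)) * sin (th (nxt (nxt i))).
Proof.
  intros H i.
  assert (E := dual_law (fun i => cosh (l i)) (fun i => sinh (l i)) (fun i => cos (th i))
    (fun i => sin (th i)) 1 1 (-1)). simpl in E.
  transitivity (1 * 1 * cos (th i) + cos (th (nxt i)) * cos (th (nxt (nxt i)))); [ring|].
  rewrite E; try ring; clear i; intros i; destruct (H i) as [lp [tp Hi]].
  - now apply sinh_pos.
  - assert (C := sinh_sqr (l i)). lra.
  - lra.
  - apply sin_gt_0; lra.
  - assert (C := sin_sqr (th i)). lra.
Qed.

Lemma spherical_dual l th : spherical_triangle l th -> forall i,
  cos (th i) + cos (th (nxt i)) * cos (th (nxt (nxt i)))
    = cos (l i) * sin (th (nxt i)) * sin (th (nxt (nxt i))).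
Proof.
  intros H i.
  assert (E := dual_law (fun i => cos (l i)) (fun i => sin (l i)) (fun i => cos (th i))
    (fun i => sin (th i)) (-1) (-1) (-1)). simpl in E.
  transitivity (-1 * -1 * cos (th i) + cos (th (nxt i)) * cos (th (nxt (nxt i)))); [ring|].
  rewrite E; try ring; clear i; intros i; destruct (H i) as [lp [tp Hi]].
  - apply sin_gt_0; lra.
  - assert (C := sin_sqr (l i)). lra.
  - lra.
  - apply sin_gt_0; lra.
  - assert (C := sin_sqr (th i)). lra.
Qed.

Lemma hyperbolic_angles_half r y i : hyperbolic_triangle y (pair_sum r) ->
  0 < cos (r i) * cos (total r) /\ 0 < cos (r (nxt i)) * cos (r (nxt (nxt i))) /\
  tanh (y i / 2) ^ 2 = cos (r i) * cos (total r) / (cos (r (nxt i)) * cos (r (nxt (nxt i)))).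
Proof.
  intros H. destruct (H i) as [li _]. assert (E := hyperbolic_dual _ _ H i).
  destruct (H (nxt i)) as [_ [tj _]]. destruct (H (nxt (nxt i))) as [_ [tk _]].
  rewrite pair_sum_nxt in tj, E. rewrite pair_sum_nxt2 in tk, E. unfold pair_sum in E.
  rewrite <- (total_cyclic r i).
  destruct (cos_products (r i) (r (nxt i)) (r (nxt (nxt i)))) as [E1 E2].
  set (a := r i) in *. set (b := r (nxt i)) in *. set (c := r (nxt (nxt i))) in *.
  assert (sj : 0 < sin (c + a)) by (apply sin_gt_0; lra).
  assert (sk : 0 < sin (a + b)) by (apply sin_gt_0; lra).
  destruct (half_cosh_ratio (y i) (sin (c + a) * sin (a + b)) (cos b * cos c) (cos a * cos (a + b + c)))
    as [X [Y [R _]]]; [assumption|now apply Rmult_lt_0_compat|lra|lra|auto].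
Qed.

Lemma spherical_angles_half r y i : spherical_triangle y (pair_sum r) ->
  0 < - (cos (r i) * cos (total r)) /\ 0 < cos (r (nxt i)) * cos (r (nxt (nxt i))) /\
  tan (y i / 2) ^ 2 = - (cos (r i) * cos (total r)) / (cos (r (nxt i)) * cos (r (nxt (nxt i)))).
Proof.
  intros H. destruct (H i) as [li _]. assert (E := spherical_dual _ _ H i).
  destruct (H (nxt i)) as [_ [tj _]]. destruct (H (nxt (nxt i))) as [_ [tk _]].
  rewrite pair_sum_nxt in tj, E. rewrite pair_sum_nxt2 in tk, E. unfold pair_sum in E.
  rewrite <- (total_cyclic r i).
  destruct (cos_products (r i) (r (nxt i)) (r (nxt (nxt i)))) as [E1 E2].
  set (a := r i) in *. set (b := r (nxt i)) in *. set (c := r (nxt (nxt i))) in *.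
  assert (sj : 0 < sin (c + a)) by (apply sin_gt_0; lra).
  assert (sk : 0 < sin (a + b)) by (apply sin_gt_0; lra).
  destruct (half_tan_ratio (y i) (sin (c + a) * sin (a + b)) (cos b * cos c) (- (cos a * cos (a + b + c))))
    as [X [Y R]]; [assumption|now apply Rmult_lt_0_compat|lra|lra|auto].
Qed.

Lemma hexagon_half r y i : right_angled_hexagon y (pair_sum r) ->
  coth (y i / 2) ^ 2 = cosh (r i) * cosh (total r) / (cosh (r (nxt i)) * cosh (r (nxt (nxt i)))).
Proof.
  intros H. destruct (H i) as [li [ti E]].
  destruct (H (nxt i)) as [_ [tj _]]. destruct (H (nxt (nxt i))) as [_ [tk _]].
  rewrite pair_sum_nxt in tj, E. rewrite pair_sum_nxt2 in tk, E. unfold pair_sum in E.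
  rewrite <- (total_cyclic r i).
  destruct (cosh_products (r i) (r (nxt i)) (r (nxt (nxt i)))) as [E1 E2].
  set (a := r i) in *. set (b := r (nxt i)) in *. set (c := r (nxt (nxt i))) in *.
  assert (sj := sinh_pos _ tj). assert (sk := sinh_pos _ tk).
  assert (E' : cosh (y i) * (sinh (c + a) * sinh (a + b)) = cosh (b + c) + cosh (c + a) * cosh (a + b))
    by (rewrite E; field; lra).
  destruct (half_cosh_ratio (y i) (sinh (c + a) * sinh (a + b)) (cosh a * cosh (a + b + c)) (cosh b * cosh c))
    as [X [Y [_ R]]]; [assumption|now apply Rmult_lt_0_compat|lra|lra|auto].
Qed.

(** The pair sums confine each [r i] to [(- PI / 2, PI)], so a negative cosine means [PI / 2 < r i].
    The cosines share one sign, and were it negative, two coordinates would add up to more than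
    [PI]. *)
Lemma cos_signs r : (forall i, 0 < pair_sum r i < PI) ->
  (forall i, 0 < cos (r i) * cos (r (nxt i))) ->
  (forall i, - (PI / 2) < r i < PI / 2) /\ (forall i, 0 < cos (r i)).
Proof.
  intros L C. assert (L1 := L i1). assert (L2 := L i2). assert (L3 := L i3).
  assert (C1 := C i1). assert (C2 := C i2). assert (C3 := C i3).
  unfold pair_sum in *; simpl in *. assert (pi := PI_RGT_0).
  assert (lo : forall i, - (PI / 2) < r i < PI) by (intros []; lra).
  assert (big : forall i, cos (r i) < 0 -> PI / 2 < r i).
  { intros i Hi. apply Rnot_le_lt. intros N.
    assert (0 <= cos (r i)) by (apply cos_ge_0; destruct (lo i); lra). lra. }
  assert (c1 : 0 < cos (r i1)).
  { apply Rnot_le_lt. intros [N|N]; [|rewrite N in C1; lra].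
    assert (cos (r i2) < 0) by nra. assert (B1 := big i1 N). assert (B2 := big i2 H). lra. }
  assert (c2 : 0 < cos (r i2)) by nra. assert (c3 : 0 < cos (r i3)) by nra.
  assert (c : forall i, 0 < cos (r i)) by (intros []; assumption).
  split; [|exact c].
  intros i. split; [apply lo|]. apply Rnot_le_lt. intros N.
  assert (cos (r i) <= 0) by (apply cos_le_0; [|destruct (lo i)]; lra). specialize (c i). lra.
Qed.

Lemma hyperbolic_angles_dom r y : hyperbolic_triangle y (pair_sum r) -> dom_hyp_angles r.
Proof.
  intros H.
  assert (L : forall i, 0 < pair_sum r i < PI) by (intros i; apply (H i)).
  destruct (cos_signs r L) as [B C].
  { intros i. destruct (hyperbolic_angles_half r y (nxt (nxt i)) H) as [_ [Y _]].
    rewrite !nxt3 in Y. exact Y. }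
  destruct (hyperbolic_angles_half r y i1 H) as [X _].
  split; [intros i; apply L|].
  assert (L1 := L i1). assert (L2 := L i2). assert (L3 := L i3).
  assert (t := total_cyclic r i1). unfold pair_sum in *; simpl in *. assert (pi := PI_RGT_0).
  apply Rnot_le_lt. intros N. specialize (C i1).
  assert (cos (total r) <= 0) by (apply cos_le_0; lra). nra.
Qed.

Lemma spherical_angles_dom r y : spherical_triangle y (pair_sum r) -> dom_sph_angles r.
Proof.
  intros H.
  assert (L : forall i, 0 < pair_sum r i < PI) by (intros i; apply (H i)).
  destruct (cos_signs r L) as [B C].
  { intros i. destruct (spherical_angles_half r y (nxt (nxt i)) H) as [_ [Y _]].
    rewrite !nxt3 in Y. exact Y. }
  destruct (spherical_angles_half r y i1 H) as [X _].
  split; [intros i; apply B|].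
  assert (L1 := L i1). assert (L2 := L i2). assert (L3 := L i3).
  assert (t := total_cyclic r i1). unfold pair_sum in *; simpl in *. assert (pi := PI_RGT_0).
  apply Rnot_le_lt. intros N. specialize (C i1).
  assert (0 <= cos (total r)) by (apply cos_ge_0; lra). nra.
Qed.

Lemma hexagon_dom r y : right_angled_hexagon y (pair_sum r) -> dom_hex r.
Proof. intros H i. apply (H i). Qed.

Lemma dom_hyp_angles_J r i : dom_hyp_angles r -> - (PI / 2) < r i < PI / 2.
Proof.
  intros [P T]. assert (P1 := P i1). assert (P2 := P i2). assert (P3 := P i3).
  unfold pair_sum, total in *; simpl in *. destruct i; lra.
Qed.

Lemma dom_sph_angles_J r i : dom_sph_angles r -> - (PI / 2) < r i < PI / 2.
Proof.
  intros [P T]. assert (P1 := P i1). assert (P2 := P i2). assert (P3 := P i3).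
  unfold total in *; simpl in *. destruct i; lra.
Qed.

Lemma dom_sph_angles_pair r i : dom_sph_angles r -> 0 < pair_sum r i < PI.
Proof.
  intros [P T]. assert (P1 := P i1). assert (P2 := P i2). assert (P3 := P i3).
  unfold total, pair_sum in *; destruct i; simpl in *; lra.
Qed.

Lemma dom_hyp_angles_pair r i : dom_hyp_angles r -> 0 < pair_sum r i < PI.
Proof.
  intros H. split; [apply H|]. assert (J := fun i => dom_hyp_angles_J r i H).
  assert (J1 := J i1). assert (J2 := J i2). assert (J3 := J i3).
  unfold pair_sum; destruct i; simpl in *; lra.
Qed.

(** The value which the dual cosine law assigns to [cosh] or [cos] of the edge opposite the angle
    [pair_sum r i]. *)
Definition dual_cosine (r : vec) (i : idx) : R :=
  (cos (pair_sum r i) + cos (pair_sum r (nxt i)) * cos (pair_sum r (nxt (nxt i))))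
   / (sin (pair_sum r (nxt i)) * sin (pair_sum r (nxt (nxt i)))).

Lemma dual_cosine_products r i : (forall i, 0 < pair_sum r i < PI) ->
  let P := sin (pair_sum r (nxt i)) * sin (pair_sum r (nxt (nxt i))) in
  0 < P /\ (dual_cosine r i + 1) * P = 2 * (cos (r (nxt i)) * cos (r (nxt (nxt i)))) /\
  (dual_cosine r i - 1) * P = 2 * (cos (r i) * cos (total r)).
Proof.
  intros L P. assert (sj : 0 < sin (pair_sum r (nxt i))) by (apply sin_gt_0; apply L).
  assert (sk : 0 < sin (pair_sum r (nxt (nxt i)))) by (apply sin_gt_0; apply L).
  split; [now apply Rmult_lt_0_compat|].
  assert (E : dual_cosine r i * P = cos (pair_sum r i) + cos (pair_sum r (nxt i)) * cos (pair_sum r (nxt (nxt i))))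
    by (unfold dual_cosine, P; field; lra).
  destruct (cos_products (r i) (r (nxt i)) (r (nxt (nxt i)))) as [E1 E2].
  rewrite total_cyclic in E1. unfold P in *.
  rewrite pair_sum_nxt, pair_sum_nxt2 in *. unfold pair_sum in E. lra.
Qed.

Lemma hyperbolic_angles_exists r : dom_hyp_angles r ->
  arising (fun x y => hyperbolic_triangle y x) r.
Proof.
  intros H. assert (L := fun i => dom_hyp_angles_pair r i H).
  assert (J := fun i => dom_hyp_angles_J r i H).
  assert (C : forall i, 0 < cos (r i)) by (intros i; apply cos_gt_0; apply J).
  assert (Ct : 0 < cos (total r)).
  { apply cos_gt_0; [|apply H]. assert (L1 := L i1). assert (L2 := L i2). assert (L3 := L i3).
    assert (t := total_cyclic r i1). assert (pi := PI_RGT_0). unfold pair_sum in *; simpl in *. lra. }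
  assert (A1 : forall i, 1 < dual_cosine r i).
  { intros i. destruct (dual_cosine_products r i L) as [P [_ E]].
    assert (0 < cos (r i) * cos (total r)) by now apply Rmult_lt_0_compat. nra. }
  assert (S : forall i, 0 < sin (pair_sum r i)) by (intros i; apply sin_gt_0; apply L).
  exists (fun i => arcosh (dual_cosine r i)).
  (* Taking [x = - cos] absorbs the sign by which the dual cosine law differs from the law with
     [mu = 1]. *)
  assert (E := dual_law (fun i => - cos (pair_sum r i)) (fun i => sin (pair_sum r i)) (dual_cosine r)
    (fun i => sinh (arcosh (dual_cosine r i))) 1 (-1) 1). simpl in E.
  do 3 (lapply E; [clear E; intros E|ring]).
  lapply E; [clear E; intros E|exact S].
  lapply E; [clear E; intros E|].
  2:{ intros i. assert (Q := sin_sqr (pair_sum r i)). lra. }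
  lapply E; [clear E; intros E|].
  2:{ intros i. unfold dual_cosine. assert (Sj := S (nxt i)). assert (Sk := S (nxt (nxt i))). field. lra. }
  lapply E; [clear E; intros E|].
  2:{ intros i. now apply sinh_pos, arcosh_pos. }
  lapply E; [clear E; intros E|].
  2:{ intros i. assert (Q := sinh_sqr (arcosh (dual_cosine r i))). rewrite cosh_arcosh in Q by auto. lra. }
  intros i. split; [now apply arcosh_pos|]. split; [apply L|].
  rewrite !cosh_arcosh by auto.
  specialize (E i). lra.
Qed.

Lemma spherical_angles_exists r : dom_sph_angles r ->
  arising (fun x y => spherical_triangle y x) r.
Proof.
  intros H. assert (L := fun i => dom_sph_angles_pair r i H).
  assert (J := fun i => dom_sph_angles_J r i H).
  assert (C : forall i, 0 < cos (r i)) by (intros i; apply cos_gt_0; apply J).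
  assert (Ct : cos (total r) < 0).
  { apply cos_lt_0; [apply H|]. assert (L1 := J i1). assert (L2 := J i2). assert (L3 := J i3).
    unfold total. lra. }
  assert (A1 : forall i, -1 < dual_cosine r i < 1).
  { intros i. destruct (dual_cosine_products r i L) as [P [E' E]].
    assert (0 < cos (r i) * - cos (total r)) by (apply Rmult_lt_0_compat; [auto|lra]).
    assert (0 < cos (r (nxt i)) * cos (r (nxt (nxt i)))) by now apply Rmult_lt_0_compat.
    split; nra. }
  assert (S : forall i, 0 < sin (pair_sum r i)) by (intros i; apply sin_gt_0; apply L).
  exists (fun i => acos (dual_cosine r i)).
  assert (E := dual_law (fun i => - cos (pair_sum r i)) (fun i => sin (pair_sum r i)) (dual_cosine r)
    (fun i => sin (acos (dual_cosine r i))) 1 (-1) (-1)). simpl in E.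
  assert (cA : forall i, cos (acos (dual_cosine r i)) = dual_cosine r i)
    by (intros i; apply cos_acos; specialize (A1 i); lra).
  do 3 (lapply E; [clear E; intros E|ring]).
  lapply E; [clear E; intros E|exact S].
  lapply E; [clear E; intros E|].
  2:{ intros i. assert (Q := sin_sqr (pair_sum r i)). lra. }
  lapply E; [clear E; intros E|].
  2:{ intros i. unfold dual_cosine. assert (Sj := S (nxt i)). assert (Sk := S (nxt (nxt i))). field. lra. }
  lapply E; [clear E; intros E|].
  2:{ intros i. destruct (acos_bound_lt (dual_cosine r i)); [auto|]. now apply sin_gt_0. }
  lapply E; [clear E; intros E|].
  2:{ intros i. assert (Q := sin_sqr (acos (dual_cosine r i))). rewrite cA in Q. lra. }
  intros i. split; [now apply acos_bound_lt|]. split; [apply L|].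
  rewrite !cA.
  specialize (E i). lra.
Qed.

Lemma hexagon_exists r : dom_hex r -> arising (fun x y => right_angled_hexagon y x) r.
Proof.
  intros H.
  set (A i := (cosh (pair_sum r i) + cosh (pair_sum r (nxt i)) * cosh (pair_sum r (nxt (nxt i))))
     / (sinh (pair_sum r (nxt i)) * sinh (pair_sum r (nxt (nxt i))))).
  assert (A1 : forall i, 1 < A i).
  { intros i. assert (sj := sinh_pos _ (H (nxt i))). assert (sk := sinh_pos _ (H (nxt (nxt i)))).
    assert (PP := Rmult_lt_0_compat _ _ sj sk).
    unfold A. apply Rlt_div_r; [assumption|]. rewrite Rmult_1_l.
    assert (M := cosh_minus (pair_sum r (nxt i)) (pair_sum r (nxt (nxt i)))).
    assert (p1 := cosh_pos (pair_sum r (nxt i) - pair_sum r (nxt (nxt i)))).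
    assert (p2 := cosh_pos (pair_sum r i)). lra. }
  exists (fun i => arcosh (A i)). intros i. split; [now apply arcosh_pos|]. split; [apply H|].
  rewrite cosh_arcosh by auto. reflexivity.
Qed.

(** * Prescribing two coordinates and the inradius factor *)

(** Prescribing [x1], [x2] and the factor leaves a single equation for [x3], in which it occurs
    through [s (x1 + x2 + x3)] and [s x3]. The cases below solve this equation. *)
Lemma inradius_factor_mkvec (s : R -> R) eps x1 x2 x3 Q :
  0 < s x1 -> 0 < s x2 -> 0 < s x3 -> 0 < Q ->
  eps * s (x1 + x2 + x3) = Q ^ 2 * (s x1 * s x2) * s x3 ->
  inradius_factor s eps (mkvec x1 x2 x3) = Q.
Proof.
  intros p1 p2 p3 Qp E. unfold inradius_factor, total; simpl. rewrite E.
  replace (Q ^ 2 * (s x1 * s x2) * s x3 / (s x1 * s x2 * s x3)) with (Q ^ 2) by (field; lra).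
  apply sqrt_pow2. lra.
Qed.

Lemma at_right_0 (P : R -> Prop) :
  at_right 0 P <-> exists d, 0 < d /\ forall x, 0 < x < d -> P x.
Proof.
  split.
  - intros [d H]. exists d. split; [apply cond_pos|]. intros x Hx.
    apply H; [|apply Hx]. unfold ball; simpl; unfold AbsRing_ball, abs, minus, plus, opp; simpl.
    apply Rabs_def1; lra.
  - intros [d [dp H]]. exists (mkposreal d dp). intros x Hx x0.
    unfold ball in Hx; simpl in Hx; unfold AbsRing_ball, abs, minus, plus, opp in Hx; simpl in Hx.
    apply Rabs_def2 in Hx. apply H. lra.
Qed.

Lemma at_left_iff a (P : R -> Prop) :
  at_left a P <-> exists d, 0 < d /\ forall x, a - d < x < a -> P x.
Proof.
  split.
  - intros [d H]. exists d. split; [apply cond_pos|]. intros x Hx.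
    apply H; [|apply Hx]. unfold ball; simpl; unfold AbsRing_ball, abs, minus, plus, opp; simpl.
    apply Rabs_def1; lra.
  - intros [d [dp H]]. exists (mkposreal d dp). intros x Hx x0.
    unfold ball in Hx; simpl in Hx; unfold AbsRing_ball, abs, minus, plus, opp in Hx; simpl in Hx.
    apply Rabs_def2 in Hx. apply H. lra.
Qed.

Lemma IVT_decreasing_sign (g : R -> R) a b : (forall t, continuous g t) -> a < b ->
  0 < g a -> g b < 0 -> exists t, a < t < b /\ g t = 0.
Proof.
  intros C L pa pb.
  destruct (IVT_gen g a b 0) as [t [Ht E]].
  - intros t. now apply continuity_pt_filterlim, C.
  - rewrite Rmin_right, Rmax_left by lra. lra.
  - rewrite Rmin_left, Rmax_right in Ht by lra. exists t. split; [|exact E].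
    destruct Ht as [[H1|H1] [H2|H2]]; subst; lra.
Qed.

(** [q1 * sin x] equals [q0 * sin u] for [u = asin (q1 * sin x / q0)], and [u] is small when [x]
    is. *)
Lemma sin_scale (P : R -> Prop) q0 q1 d : 0 < q0 -> 0 < q1 -> 0 < d ->
  (forall x, 0 < x < d -> P (q0 * sin x)) ->
  exists d', 0 < d' /\ forall x, 0 < x < d' -> P (q1 * sin x).
Proof.
  intros p0 p1 dp H. assert (pi1 := PI2_1).
  (* Since [1 < PI / 2], sine is increasing up to [e]; then [u < e] follows from [sin u < sin e],
     which [sin x < x] turns into a bound on [x]. *)
  set (e := Rmin d 1). assert (ep : 0 < e) by (apply Rmin_glb_lt; lra).
  assert (ed : e <= d) by apply Rmin_l. assert (e1 : e <= 1) by apply Rmin_r.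
  assert (se : 0 < sin e) by (apply sin_gt_0; lra).
  exists (Rmin 1 (q0 * sin e / q1)). split.
  - apply Rmin_glb_lt; [lra|]. apply Rdiv_lt_0_compat; [now apply Rmult_lt_0_compat|assumption].
  - intros x [x0 xl]. assert (x1 : x < 1) by (eapply Rlt_le_trans; [exact xl|apply Rmin_l]).
    assert (x2 : x < q0 * sin e / q1) by (eapply Rlt_le_trans; [exact xl|apply Rmin_r]).
    assert (sx : 0 < sin x) by (apply sin_gt_0; lra). assert (sl := sin_lt_x x x0).
    assert (V : 0 < q1 * sin x / q0 < sin e).
    { split; [apply Rdiv_lt_0_compat; [now apply Rmult_lt_0_compat|assumption]|].
      apply Rlt_div_l; [assumption|]. apply (Rmult_lt_compat_r q1) in x2; [|assumption].
      unfold Rdiv in x2. rewrite Rmult_assoc, Rinv_l, Rmult_1_r in x2 by lra. nra. }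
    assert (B := SIN_bound e).
    assert (sa : sin (asin (q1 * sin x / q0)) = q1 * sin x / q0) by (apply sin_asin; lra).
    assert (Ba := asin_bound_lt (q1 * sin x / q0) ltac:(lra)).
    replace (q1 * sin x) with (q0 * sin (asin (q1 * sin x / q0))) by (rewrite sa; field; lra).
    apply H. set (u := asin (q1 * sin x / q0)) in *. split.
    + apply Rnot_le_lt. intros N. assert (0 <= sin (- u)) by (apply sin_ge_0; lra).
      rewrite sin_neg in H0. lra.
    + apply Rlt_le_trans with e; [|assumption].
      apply sin_increasing_0; try lra.
Qed.

Section Reach.

Variable D : vec -> Prop.

Lemma reachable_id : (forall r, D r <-> dom_pos r) ->
  reachable D 0 PI 0 p_infty (fun t => cot (t / 2)) (fun r => r) 1 (Rbar_locally p_infty)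
    (fun x Q => 0 < x /\ 0 < Q).
Proof.
  intros HD. constructor.
  - apply Rbar_locally_filter.
  - intros P q0 q1 p0 p1 [M H]. exists (M * q0 / q1). intros x Hx.
    replace (q1 * x) with (q0 * (q1 * x / q0)) by (field; lra). apply H.
    apply Rlt_div_r; [assumption|]. apply Rlt_div_l in Hx; [|assumption]. lra.
  (* Beyond this threshold [Q^2 * x * x2] exceeds [1], and the equation for the third coordinate,
     linear here, has a positive solution. *)
  - intros x Q [xp Qp]. exists (/ (Q ^ 2 * x)). intros x2 H2.
    assert (Qx : 0 < Q ^ 2 * x) by (apply Rmult_lt_0_compat; [now apply pow_lt|assumption]).
    assert (x2p : 0 < x2) by (eapply Rlt_trans; [|exact H2]; now apply Rinv_0_lt_compat).
    assert (m1 : 1 < Q ^ 2 * (x * x2)).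
    { apply (Rmult_lt_compat_l (Q ^ 2 * x)) in H2; [|assumption]. rewrite Rinv_r in H2; lra. }
    assert (x3p : 0 < (x + x2) / (Q ^ 2 * (x * x2) - 1)) by (apply Rdiv_lt_0_compat; lra).
    exists (mkvec x x2 ((x + x2) / (Q ^ 2 * (x * x2) - 1))). simpl. repeat split.
    + apply HD. intros []; simpl; assumption.
    + apply (inradius_factor_mkvec (fun r => r)); try assumption. field. lra.
  - intros r i Dr. apply HD in Dr. split; [apply Dr|].
    apply (inradius_factor_spec (fun r => r) 1 r Dr).
    assert (P1 := Dr i1). assert (P2 := Dr i2). assert (P3 := Dr i3). unfold total. lra.
  - intros x Jx%oo_pos. exists 1. lra.
  - intros t It. exists 1. assert (H := half_cot_pos t It). split; [apply oo_pos_intro; lra|]. split; lra.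
Qed.

(** All growth estimates at infinity come from [1 + x < exp x], which gives explicit thresholds for
    the filter. *)
Lemma exp_gt_ratio a b x : 0 < a -> 0 < b -> a / b < x ->
  exp (- x) < 1 /\ a < b * exp x.
Proof.
  intros ap bp L.
  assert (xp : 0 < x) by (eapply Rlt_trans; [|exact L]; now apply Rdiv_lt_0_compat).
  apply (Rlt_div_l _ _ b bp) in L. assert (E1 := exp_ineq1 x ltac:(lra)).
  split; [rewrite <- exp_0; apply exp_increasing; lra|nra].
Qed.

Lemma exp_far a b x : 0 < a -> a < b -> b / (b - a) < x ->
  a * exp x < b * (exp x - exp (- x)).
Proof.
  intros ap ab L. destruct (exp_gt_ratio b (b - a) x ltac:(lra) ltac:(lra) L). nra.
Qed.

Lemma exp_far_sum a b x : 0 < a -> a < b -> a / (b - a) < x ->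
  a * (exp x + exp (- x)) < b * exp x.
Proof.
  intros ap ab L. destruct (exp_gt_ratio a (b - a) x ltac:(lra) ltac:(lra) L). nra.
Qed.

Lemma exp_half_ln z : 0 < z -> exp (ln z / 2) * exp (ln z / 2) = z.
Proof. intros. rewrite <- exp_plus. replace (ln z / 2 + ln z / 2) with (ln z) by field. now apply exp_ln. Qed.

(** In terms of [exp (2 * t)] the equation is linear, with solution [Z]. The bound [exp A < m] makes
    [1 < Z], that is, [t] positive. *)
Lemma sinh_solve A m : 0 < A -> exp A < m ->
  exists t, 0 < t /\ sinh (A + t) = m * sinh t.
Proof.
  intros Ap Hm. assert (eA := exp_pos A). assert (eA' := exp_pos (- A)).
  assert (EE : exp A * exp (- A) = 1) by (rewrite <- exp_plus, Rplus_opp_r; apply exp_0).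
  assert (e1 := exp_ineq1 A ltac:(lra)).
  set (Z := (m - exp (- A)) / (m - exp A)).
  assert (Z1 : 1 < Z) by (apply Rlt_div_r; [lra|nra]).
  exists (ln Z / 2). split.
  - assert (0 < ln Z) by (rewrite <- ln_1; apply ln_increasing; lra). lra.
  - assert (S := exp_half_ln Z ltac:(lra)). set (t := ln Z / 2) in *.
    assert (et := exp_pos t).
    assert (Et : exp t * exp (- t) = 1) by (rewrite <- exp_plus, Rplus_opp_r; apply exp_0).
    unfold sinh. rewrite Ropp_plus_distr, !exp_plus.
    apply (Rmult_eq_reg_r (2 * exp t)); [|lra].
    transitivity (exp A * (exp t * exp t) - exp (- A) * (exp t * exp (- t))); [field|].
    transitivity (m * (exp t * exp t - exp t * exp (- t))); [|field].
    rewrite S, Et. unfold Z. field. lra.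
Qed.

(** The condition [2 * exp x < Q^2 * sinh x] is what the solvability condition
    [exp (x + x2) < Q^2 * sinh x * sinh x2] becomes for large [x2], where [sinh x2] behaves like
    [exp x2 / 2]. *)
Lemma reachable_sinh : (forall r, D r <-> dom_pos r) ->
  reachable D 0 PI 0 p_infty (fun t => cot (t / 2)) sinh 1 (Rbar_locally p_infty)
    (fun x Q => 0 < x /\ 0 < Q /\ 2 * exp x < Q ^ 2 * sinh x).
Proof.
  intros HD. constructor.
  - apply Rbar_locally_filter.
  - intros P q0 q1 p0 p1 [M H]. exists (arcsinh (q0 * sinh M / q1)). intros x Hx.
    replace (q1 * sinh x) with (q0 * sinh (arcsinh (q1 * sinh x / q0)))
      by (rewrite sinh_arcsinh; field; lra). apply H.
    rewrite <- (arcsinh_sinh M). apply arcsinh_lt, (Rlt_div_r _ _ q0 p0).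
    apply sinh_lt in Hx. rewrite sinh_arcsinh in Hx. apply (Rlt_div_l _ _ q1 p1) in Hx. lra.
  - intros x Q [xp [Qp H]]. exists (Q ^ 2 * sinh x / (Q ^ 2 * sinh x - 2 * exp x)). intros x2 H2.
    assert (ep := exp_pos x).
    assert (x2p : 0 < x2) by (eapply Rlt_trans; [|exact H2]; apply Rdiv_lt_0_compat; lra).
    assert (F := exp_far (2 * exp x) _ x2 ltac:(lra) H H2).
    assert (s1 := sinh_pos x xp). assert (s2 := sinh_pos x2 x2p).
    assert (m1 : exp (x + x2) < Q ^ 2 * (sinh x * sinh x2))
      by (rewrite exp_plus; unfold sinh at 2; lra).
    destruct (sinh_solve (x + x2) _ ltac:(lra) m1) as [t [tp Et]].
    exists (mkvec x x2 t). simpl. repeat split.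
    + apply HD. intros []; simpl; assumption.
    + apply (inradius_factor_mkvec sinh); try assumption; [now apply sinh_pos|]. lra.
  - intros r i Dr. apply HD in Dr.
    assert (sp : forall i, 0 < sinh (r i)) by (intros; apply sinh_pos, Dr).
    assert (tot := total_cyclic r i).
    assert (P1 := Dr i). assert (P2 := Dr (nxt i)). assert (P3 := Dr (nxt (nxt i))).
    assert (tp : 0 < sinh (total r)) by (apply sinh_pos; lra).
    destruct (inradius_factor_spec sinh 1 r sp ltac:(lra)) as [Qp Q2]. specialize (Q2 i).
    split; [apply Dr|]. split; [assumption|].
    set (Q := inradius_factor sinh 1 r) in *.
    rewrite <- tot in Q2.
    set (a := r i) in *. set (b := r (nxt i)) in *. set (c := r (nxt (nxt i))) in *.
    assert (sb := sinh_pos b P2). assert (sc := sinh_pos c P3).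
    (* The two bounds [L1] and [L2] give [Q^2 * sinh a = sinh (a + b + c) / (sinh b * sinh c) > exp
       (a + b) / sinh b > 2 * exp a]. *)
    assert (L1 : exp a * exp b * sinh c < sinh (a + b + c)).
    { unfold sinh. rewrite !Ropp_plus_distr, !exp_plus.
      assert (exp (- a) < exp a) by (apply exp_increasing; lra).
      assert (exp (- b) < exp b) by (apply exp_increasing; lra).
      assert (pa := exp_pos (- a)). assert (pb := exp_pos (- b)). assert (pc := exp_pos (- c)).
      assert (exp (- a) * exp (- b) < exp a * exp b) by nra.
      assert (exp (- a) * exp (- b) * exp (- c) < exp a * exp b * exp (- c)) by nra. lra. }
    assert (L2 : 2 * sinh b < exp b) by (unfold sinh; assert (pb := exp_pos (- b)); lra).
    assert (ea := exp_pos a).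
    apply (Rmult_lt_reg_r (sinh b * sinh c)); [now apply Rmult_lt_0_compat|].
    assert (exp a * (2 * sinh b) * sinh c < exp a * exp b * sinh c)
      by (apply Rmult_lt_compat_r; [assumption|]; now apply Rmult_lt_compat_l).
    lra.
  - intros x Jx%oo_pos. assert (sx := sinh_pos x Jx). assert (ex := exp_pos x).
    assert (p : 0 < 2 * exp x / sinh x) by (apply Rdiv_lt_0_compat; lra).
    (* With [k = 2 * exp x / sinh x] the requirement reads [k < Q^2], and [Q = 1 + k] meets it. *)
    exists (1 + 2 * exp x / sinh x). split; [assumption|]. split; [lra|].
    set (k := 2 * exp x / sinh x) in *.
    assert (E : 2 * exp x = k * sinh x) by (unfold k; field; lra). rewrite E. nra.
  - intros t It. assert (H := half_cot_pos t It). set (z := cot (t / 2)) in *.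
    assert (z2 := pow_lt z 2 H).
    (* For [Q = z / sinh x] the requirement is [exp (2 * x) - 1 < z^2]; this [x] makes the left-hand
       side [z^2 / 2]. *)
    exists (ln (1 + z ^ 2 / 2) / 2). set (x := ln (1 + z ^ 2 / 2) / 2).
    assert (xp : 0 < x).
    { assert (0 < ln (1 + z ^ 2 / 2)) by (rewrite <- ln_1; apply ln_increasing; lra). unfold x. lra. }
    assert (sx := sinh_pos x xp).
    split; [now apply oo_pos_intro|]. split; [assumption|]. split; [now apply Rdiv_lt_0_compat|].
    assert (E := exp_half_ln (1 + z ^ 2 / 2) ltac:(lra)). fold x in E.
    replace ((z / sinh x) ^ 2 * sinh x) with (z ^ 2 / sinh x) by (field; lra).
    apply (Rlt_div_r _ _ _ sx).
    assert (E2 : exp x * exp (- x) = 1) by (rewrite <- exp_plus, Rplus_opp_r; apply exp_0).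
    unfold sinh. nra.
Qed.

Lemma reachable_sin : (forall r, D r <-> dom_sph r) ->
  reachable D 0 PI 0 PI (fun t => cot (t / 2)) sin 1 (at_right 0)
    (fun x Q => 0 < x < PI /\ 0 < Q).
Proof.
  intros HD. constructor.
  - apply at_right_proper_filter.
  - intros P q0 q1 p0 p1 H. apply at_right_0 in H. destruct H as [d [dp H]].
    apply at_right_0. now apply (sin_scale P q0 q1 d).
  - intros x Q [xp Qp]. apply at_right_0. exists (PI - x). split; [lra|]. intros x2 H2.
    assert (s1 : 0 < sin x) by (apply sin_gt_0; lra).
    assert (s2 : 0 < sin x2) by (apply sin_gt_0; lra).
    set (m := Q ^ 2 * (sin x * sin x2)).
    assert (mp : 0 < m) by (repeat apply Rmult_lt_0_compat; lra).
    (* The third coordinate ranges from [0] to the value where the total reaches [PI]. *)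
    destruct (IVT_decreasing_sign (fun t => sin (x + x2 + t) - m * sin t) 0 (PI - (x + x2)))
      as [t [Ht Et]].
    + intros t. eapply derive_continuous. auto_derive; [exact I|reflexivity].
    + lra.
    + rewrite sin_0, Rplus_0_r, Rmult_0_r, Rminus_0_r. apply sin_gt_0; lra.
    + replace (x + x2 + (PI - (x + x2))) with PI by ring. rewrite sin_PI, sin_PI_x.
      assert (0 < m * sin (x + x2)); [|lra]. apply Rmult_lt_0_compat; [assumption|apply sin_gt_0; lra].
    + exists (mkvec x x2 t). simpl. repeat split.
      * apply HD. split; [intros []; simpl; lra|]. unfold total; simpl. lra.
      * apply (inradius_factor_mkvec sin); try assumption; [apply sin_gt_0; lra|]. unfold m in Et; lra.
  - intros r i Dr. apply HD in Dr. destruct Dr as [P T].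
    assert (P1 := P i1). assert (P2 := P i2). assert (P3 := P i3).
    assert (t : 0 < sin (total r)) by (apply sin_gt_0; [unfold total; lra|assumption]).
    unfold total in T.
    assert (B : forall i, 0 < r i < PI) by (intros []; lra).
    split; [apply B|]. apply inradius_factor_spec; [|lra].
    intros j; apply sin_gt_0; apply B.
  - intros x Jx%oo_fin. exists 1. lra.
  - intros t It. exists 1. assert (H := half_cot_pos t It). assert (pi := PI2_1).
    split; [apply oo_fin_intro; lra|]. split; [lra|]. apply Rdiv_lt_0_compat; [assumption|apply sin_gt_0; lra].
Qed.

Lemma cos_scale (P : R -> Prop) q0 q1 : 0 < q0 -> 0 < q1 ->
  at_left (PI / 2) (fun x => P (q0 * cos x)) -> at_left (PI / 2) (fun x => P (q1 * cos x)).
Proof.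
  intros p0 p1 H. apply at_left_iff in H. destruct H as [d [dp H]]. apply at_left_iff.
  destruct (sin_scale P q0 q1 d p0 p1 dp) as [d' [dp' H']].
  - intros x Hx. rewrite <- cos_shift. apply H. lra.
  - exists d'. split; [assumption|]. intros x Hx. rewrite <- sin_shift. apply H'. lra.
Qed.

Lemma cos_pos x : - (PI / 2) < x < PI / 2 -> 0 < cos x.
Proof. intros. apply cos_gt_0; lra. Qed.

(** [Q * cos x] is the value [tanh (l / 2)] facing [x], whence the bound by [1]. *)
Lemma reachable_cos_hyperbolic : (forall r, D r <-> dom_hyp_angles r) ->
  reachable D 0 p_infty (- (PI / 2)) (PI / 2) (fun t => tanh (t / 2)) cos 1 (at_left (PI / 2))
    (fun x Q => - (PI / 2) < x < PI / 2 /\ 0 < Q /\ Q * cos x < 1).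
Proof.
  intros HD. assert (pi := PI2_1).
  constructor.
  - apply at_left_proper_filter.
  - intros P q0 q1. apply cos_scale.
  - intros x Q [xb [Qp Q1]]. apply at_left_iff.
    (* This keeps [Rabs x < x2], so [x + x2] and [x2 - x] are both positive. *)
    exists (PI / 2 - Rabs x).
    assert (xa : Rabs x < PI / 2) by (apply Rabs_def1; lra).
    assert (x1 := Rle_abs x). assert (x1' := Rle_abs (- x)). rewrite Rabs_Ropp in x1'.
    split; [lra|]. intros x2 H2.
    assert (c1 := cos_pos x xb). assert (c2 : 0 < cos x2) by (apply cos_pos; lra).
    set (m := Q ^ 2 * (cos x * cos x2)).
    assert (mp : 0 < m) by (repeat apply Rmult_lt_0_compat; lra).
    (* At [t = - x], where a pair sum vanishes, the sign is that of [1 - Q^2 * cos x ^ 2]. At the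
       other end the total is [PI / 2]. *)
    destruct (IVT_decreasing_sign (fun t => cos (x + x2 + t) - m * cos t) (- x) (PI / 2 - (x + x2)))
      as [t [Ht Et]].
    + intros t. eapply derive_continuous. auto_derive; [exact I|reflexivity].
    + lra.
    + replace (x + x2 + - x) with x2 by ring. rewrite cos_neg. unfold m.
      assert (Q * cos x * (Q * cos x) < 1) by (assert (0 < Q * cos x) by (now apply Rmult_lt_0_compat); nra).
      replace (cos x2 - Q ^ 2 * (cos x * cos x2) * cos x) with (cos x2 * (1 - Q * cos x * (Q * cos x))) by ring.
      apply Rmult_lt_0_compat; lra.
    + replace (x + x2 + (PI / 2 - (x + x2))) with (PI / 2) by ring. rewrite cos_PI2, cos_shift.
      assert (0 < m * sin (x + x2)); [|lra]. apply Rmult_lt_0_compat; [assumption|apply sin_gt_0; lra].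
    + exists (mkvec x x2 t). simpl. repeat split.
      * apply HD. split; [intros []; unfold pair_sum; simpl; lra|]. unfold total; simpl. lra.
      * apply (inradius_factor_mkvec cos); try assumption; [apply cos_pos; lra|]. unfold m in Et; lra.
  - intros r i Dr. apply HD in Dr.
    assert (J := fun i => dom_hyp_angles_J r i Dr).
    assert (L := fun i => dom_hyp_angles_pair r i Dr).
    assert (C : forall i, 0 < cos (r i)) by (intros; apply cos_pos, J).
    assert (ct : 0 < cos (total r)).
    { apply cos_pos. split; [|apply Dr]. assert (L1 := L i1). assert (L2 := L i2). assert (L3 := L i3).
      unfold total, pair_sum in *; simpl in *. lra. }
    destruct (inradius_factor_spec cos 1 r C ltac:(lra)) as [Qp Q2]. specialize (Q2 i).
    split; [apply J|]. split; [assumption|].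
    set (Q := inradius_factor cos 1 r) in *.
    (* This writes [cos b * cos c - cos a * cos (a + b + c)] as a product of sines of pair sums; its
       positivity amounts to [Q^2 * cos a ^ 2 < 1]. *)
    assert (M := trig_mul (trig_cos (-1) 1 ltac:(lra)) (r i) (r (nxt i)) (r (nxt (nxt i)))).
    rewrite total_cyclic in M.
    assert (S1 : 0 < sin (r i + r (nxt i))) by (rewrite <- pair_sum_nxt2; apply sin_gt_0; apply L).
    assert (S2 : 0 < sin (r i + r (nxt (nxt i)))) by (rewrite Rplus_comm, <- pair_sum_nxt; apply sin_gt_0; apply L).
    assert (SS := Rmult_lt_0_compat _ _ S1 S2).
    assert (Ci := C i). assert (Cj := C (nxt i)). assert (Ck := C (nxt (nxt i))).
    assert (CC := Rmult_lt_0_compat _ _ Cj Ck).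
    apply Rnot_le_lt. intros N.
    assert (1 <= Q ^ 2 * cos (r i) ^ 2) by nra.
    assert (Q ^ 2 * cos (r i) ^ 2 * (cos (r (nxt i)) * cos (r (nxt (nxt i)))) = cos (r i) * cos (total r))
      by (transitivity (cos (r i) * (1 * cos (total r))); [rewrite <- Q2; ring|ring]).
    nra.
  - intros x Jx%oo_fin. exists (/ 2 * / cos x). assert (c := cos_pos x Jx).
    split; [assumption|]. assert (ci := Rinv_0_lt_compat _ c). split; [lra|].
    rewrite Rmult_assoc, Rinv_l; lra.
  - intros t It. exists 0. assert (H := half_tanh_pos t It). rewrite cos_0.
    split; [apply oo_fin_intro; lra|]. assert (H1 := tanh_lt_1 (t / 2)). rewrite Rdiv_1_r. lra.
Qed.

Lemma reachable_cos_spherical : (forall r, D r <-> dom_sph_angles r) ->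
  reachable D 0 PI (- (PI / 2)) (PI / 2) (fun t => tan (t / 2)) cos (-1) (at_left (PI / 2))
    (fun x Q => - (PI / 2) < x < PI / 2 /\ 0 < Q).
Proof.
  intros HD. assert (pi := PI2_1). constructor.
  - apply at_left_proper_filter.
  - intros P q0 q1. apply cos_scale.
  - intros x Q [xb Qp]. apply at_left_iff.
    exists (PI / 2 - Rabs x).
    assert (xa : Rabs x < PI / 2) by (apply Rabs_def1; lra).
    assert (x1 := Rle_abs x). assert (x1' := Rle_abs (- x)). rewrite Rabs_Ropp in x1'.
    split; [lra|]. intros x2 H2.
    assert (c1 := cos_pos x xb). assert (c2 : 0 < cos x2) by (apply cos_pos; lra).
    set (m := Q ^ 2 * (cos x * cos x2)).
    assert (mp : 0 < m) by (repeat apply Rmult_lt_0_compat; lra).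
    assert (sA : 0 < sin (x + x2)) by (apply sin_gt_0; lra).
    (* The endpoints are a total of [PI / 2] and a third coordinate of [PI / 2]. Both signs come
       from [0 < sin (x + x2)]. *)
    destruct (IVT_decreasing_sign (fun t => cos (x + x2 + t) + m * cos t) (PI / 2 - (x + x2)) (PI / 2))
      as [t [Ht Et]].
    + intros t. eapply derive_continuous. auto_derive; [exact I|reflexivity].
    + lra.
    + replace (x + x2 + (PI / 2 - (x + x2))) with (PI / 2) by ring. rewrite cos_PI2, cos_shift.
      assert (0 < m * sin (x + x2)); [|lra]. now apply Rmult_lt_0_compat.
    + rewrite cos_PI2. replace (x + x2 + PI / 2) with (PI / 2 - - (x + x2)) by ring.
      rewrite cos_shift, sin_neg. lra.
    + exists (mkvec x x2 t). simpl. repeat split.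
      * apply HD. split; [intros []; simpl; lra|]. unfold total; simpl. lra.
      * apply (inradius_factor_mkvec cos); try assumption; [apply cos_pos; lra|]. unfold m in Et; lra.
  - intros r i Dr. apply HD in Dr.
    assert (J := fun i => dom_sph_angles_J r i Dr).
    split; [apply J|]. apply inradius_factor_spec.
    + intros; apply cos_pos, J.
    + assert (cos (total r) < 0); [|lra]. apply cos_lt_0; [apply Dr|].
      assert (J1 := J i1). assert (J2 := J i2). assert (J3 := J i3). unfold total; lra.
  - intros x Jx%oo_fin. exists 1. lra.
  - intros t It. exists 0. assert (H := half_tan_pos t It). rewrite cos_0, Rdiv_1_r.
    split; [apply oo_fin_intro; lra|]. lra.
Qed.

(** The equation is again linear in [exp (2 * t)], with solution [Z]. The first bound makes [Z] well
    defined; the second, a comparison of both sides at [t = - x], gives [- x < t]. *)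
Lemma cosh_solve x x2 m : m < exp (x + x2) -> cosh x2 < m * cosh x ->
  exists t, - x < t /\ cosh (x + x2 + t) = m * cosh t.
Proof.
  intros Hm Hl. set (A := x + x2) in *.
  assert (eA := exp_pos A). assert (eA' := exp_pos (- A)). assert (ex := exp_pos x).
  assert (Ex : exp x * exp (- x) = 1) by (rewrite <- exp_plus, Rplus_opp_r; apply exp_0).
  assert (ex' := exp_pos (- x)).
  set (Z := (m - exp (- A)) / (exp A - m)).
  assert (Zl : exp (- x) * exp (- x) < Z).
  { apply (Rlt_div_r _ _ (exp A - m)); [lra|].
    unfold cosh in Hl.
    assert (E1 : exp x2 = exp A * exp (- x)) by (rewrite <- exp_plus; f_equal; unfold A; ring).
    assert (E2 : exp (- x2) = exp (- A) * exp x) by (rewrite <- exp_plus; f_equal; unfold A; ring).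
    rewrite E1, E2 in Hl.
    apply (Rmult_lt_compat_r (2 * exp (- x))) in Hl; [|lra].
    replace ((exp A * exp (- x) + exp (- A) * exp x) / 2 * (2 * exp (- x)))
      with (exp A * (exp (- x) * exp (- x)) + exp (- A) * (exp x * exp (- x))) in Hl by field.
    replace (m * ((exp x + exp (- x)) / 2) * (2 * exp (- x)))
      with (m * (exp x * exp (- x) + exp (- x) * exp (- x))) in Hl by field.
    rewrite Ex in Hl. lra. }
  assert (Zp : 0 < Z) by (eapply Rlt_trans; [|exact Zl]; now apply Rmult_lt_0_compat).
  exists (ln Z / 2). split.
  - assert (L : ln (exp (- x) * exp (- x)) < ln Z) by (apply ln_increasing; [now apply Rmult_lt_0_compat|assumption]).
    rewrite <- exp_plus, ln_exp in L. lra.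
  - assert (S := exp_half_ln Z Zp). set (t := ln Z / 2) in *.
    assert (et := exp_pos t).
    assert (Et : exp t * exp (- t) = 1) by (rewrite <- exp_plus, Rplus_opp_r; apply exp_0).
    unfold cosh. rewrite Ropp_plus_distr, !(exp_plus A t), (exp_plus (- A)).
    apply (Rmult_eq_reg_r (2 * exp t)); [|lra].
    transitivity (exp A * (exp t * exp t) + exp (- A) * (exp t * exp (- t))); [field|].
    transitivity (m * (exp t * exp t + exp t * exp (- t))); [|field].
    rewrite S, Et. unfold Z. field. lra.
Qed.

Lemma arcosh_far M v : 1 + Rabs (sinh M) < v -> M < arcosh v.
Proof.
  intros H. unfold arcosh. rewrite <- (arcsinh_sinh M) at 1. apply arcsinh_lt.
  assert (a := Rabs_pos (sinh M)). assert (l := Rle_abs (sinh M)).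
  apply Rle_lt_trans with (Rabs (sinh M)); [assumption|].
  rewrite <- (sqrt_pow2 (Rabs (sinh M))) by assumption. apply sqrt_lt_1_alt. nra.
Qed.

Lemma cosh_far x : 0 < x -> x / 2 < cosh x.
Proof.
  intros H. assert (E := exp_ineq1 x ltac:(lra)). assert (e := exp_pos (- x)). unfold cosh. lra.
Qed.

(** [1 < Q * cosh x] says that [coth] exceeds [1] and supplies the second hypothesis of
    [cosh_solve]; [Q^2 * cosh x < 2 * exp x] is what the first one becomes for large [x2]. For
    [z = Q * cosh x] the two read [1 < z] and [z^2 < exp (2 * x) + 1]. *)
Lemma reachable_cosh : (forall r, D r <-> dom_hex r) ->
  reachable D 0 p_infty m_infty p_infty (fun t => coth (t / 2)) cosh 1 (Rbar_locally p_infty)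
    (fun x Q => 0 < Q /\ 1 < Q * cosh x /\ Q ^ 2 * cosh x < 2 * exp x).
Proof.
  intros HD.
  assert (EE : forall x, exp x * exp (- x) = 1) by (intros; rewrite <- exp_plus, Rplus_opp_r; apply exp_0).
  assert (H2 : forall x, 2 * exp x * cosh x = exp x * exp x + 1).
  { intros x. rewrite <- (EE x). unfold cosh. field. }
  assert (zQ : forall z x, 1 < z -> z ^ 2 < exp x * exp x + 1 ->
     0 < z / cosh x /\ 1 < z / cosh x * cosh x /\ (z / cosh x) ^ 2 * cosh x < 2 * exp x).
  { intros z x z1 z2. assert (c := cosh_pos x).
    split; [apply Rdiv_lt_0_compat; lra|]. split.
    - replace (z / cosh x * cosh x) with z by (field; lra). assumption.
    - replace ((z / cosh x) ^ 2 * cosh x) with (z ^ 2 / cosh x) by (field; lra).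
      apply (Rlt_div_l _ _ _ c). now rewrite H2. }
  constructor.
  - apply Rbar_locally_filter.
  - intros P q0 q1 p0 p1 [M H].
    assert (a := Rabs_pos (sinh M)).
    assert (kp : 0 < 2 * ((1 + Rabs (sinh M)) * q0 / q1)).
    { apply Rmult_lt_0_compat; [lra|]. apply Rdiv_lt_0_compat; [apply Rmult_lt_0_compat; lra|assumption]. }
    (* By [x / 2 < cosh x], beyond this threshold [q1 * cosh x / q0] is so large that its [arcosh]
       exceeds [M]. *)
    exists (2 * ((1 + Rabs (sinh M)) * q0 / q1)). intros x Hx.
    assert (F := cosh_far x ltac:(lra)).
    assert (V : 1 + Rabs (sinh M) < q1 * cosh x / q0).
    { apply (Rlt_div_r _ _ _ p0).
      assert (L : (1 + Rabs (sinh M)) * q0 / q1 < cosh x) by lra.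
      apply (Rlt_div_l _ _ _ p1) in L. lra. }
    replace (q1 * cosh x) with (q0 * cosh (arcosh (q1 * cosh x / q0)))
      by (rewrite cosh_arcosh by lra; field; lra).
    apply H. now apply arcosh_far.
  - intros x Q [Qp [Q1 QL]].
    assert (c1 := cosh_pos x).
    assert (ap : 0 < Q ^ 2 * cosh x) by (apply Rmult_lt_0_compat; [now apply pow_lt|assumption]).
    exists (Rmax (Rabs x) (Q ^ 2 * cosh x / (2 * exp x - Q ^ 2 * cosh x))). intros x2 Hx2.
    assert (x2a : Rabs x < x2) by (eapply Rle_lt_trans; [apply Rmax_l|exact Hx2]).
    assert (x2b : Q ^ 2 * cosh x / (2 * exp x - Q ^ 2 * cosh x) < x2) by (eapply Rle_lt_trans; [apply Rmax_r|exact Hx2]).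
    assert (x1 := Rle_abs x). assert (x1' := Rle_abs (- x)). rewrite Rabs_Ropp in x1'.
    assert (F := exp_far_sum _ _ _ ap QL x2b).
    assert (c2 := cosh_pos x2).
    destruct (cosh_solve x x2 (Q ^ 2 * (cosh x * cosh x2))) as [t [tl Et]].
    + rewrite exp_plus. unfold cosh at 2. lra.
    + replace (Q ^ 2 * (cosh x * cosh x2) * cosh x) with (cosh x2 * (Q * cosh x * (Q * cosh x))) by ring.
      assert (1 < Q * cosh x * (Q * cosh x)) by nra. nra.
    + exists (mkvec x x2 t). simpl. repeat split.
      * apply HD. intros []; unfold pair_sum; simpl; lra.
      * apply (inradius_factor_mkvec cosh); try assumption; [apply cosh_pos|]. lra.
  - intros r i Dr. apply HD in Dr.
    destruct (inradius_factor_spec cosh 1 r) as [Qp Q2];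
      [intros; apply cosh_pos|rewrite Rmult_1_l; apply cosh_pos|]. specialize (Q2 i).
    split; [assumption|].
    set (Q := inradius_factor cosh 1 r) in *.
    assert (S1 := Dr i). assert (S2 := Dr (nxt i)). assert (S3 := Dr (nxt (nxt i))).
    rewrite pair_sum_nxt in S2. rewrite pair_sum_nxt2 in S3. unfold pair_sum in S1.
    rewrite <- (total_cyclic r i) in Q2.
    set (a := r i) in *. set (b := r (nxt i)) in *. set (c := r (nxt (nxt i))) in *.
    assert (ca := cosh_pos a). assert (cb := cosh_pos b). assert (cc := cosh_pos c).
    assert (CC := Rmult_lt_0_compat _ _ cb cc).
    split.
    + assert (M := trig_mul trig_cosh a b c).
      assert (SS := Rmult_lt_0_compat _ _ (sinh_pos _ S3) (sinh_pos (a + c) ltac:(lra))).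
      apply Rnot_le_lt. intros N.
      assert (0 < Q * cosh a) by now apply Rmult_lt_0_compat.
      assert (Q ^ 2 * cosh a ^ 2 <= 1) by nra.
      assert (Q ^ 2 * cosh a ^ 2 * (cosh b * cosh c) = cosh a * cosh (a + b + c))
        by (transitivity (cosh a * (1 * cosh (a + b + c))); [rewrite <- Q2; ring|ring]).
      nra.
    + assert (L1 : cosh (a + b + c) < exp a * exp b * cosh c).
      { unfold cosh. rewrite !Ropp_plus_distr, !exp_plus.
        assert (E : exp (- a) * exp (- b) < exp a * exp b)
          by (rewrite <- !exp_plus; apply exp_increasing; lra).
        assert (pc := exp_pos (- c)). nra. }
      assert (L2 : exp b < 2 * cosh b) by (unfold cosh; assert (pb := exp_pos (- b)); lra).
      assert (ea := exp_pos a). assert (eb := exp_pos b).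
      apply (Rmult_lt_reg_r (cosh b * cosh c)); [assumption|].
      assert (exp a * exp b * cosh c < exp a * (2 * cosh b) * cosh c)
        by (apply Rmult_lt_compat_r; [assumption|]; now apply Rmult_lt_compat_l).
      lra.
  - intros x _. exists (sqrt (1 + exp x * exp x / 2) / cosh x).
    assert (e := exp_pos x). assert (ee := Rmult_lt_0_compat _ _ e e).
    apply zQ.
    + rewrite <- sqrt_1 at 1. apply sqrt_lt_1_alt. lra.
    + rewrite pow2_sqrt; lra.
  - intros t It.
    assert (z1 : 1 < coth (t / 2)).
    { apply oo_pos in It. apply Rlt_div_r; [apply sinh_pos; lra|]. unfold sinh, cosh.
      assert (e := exp_pos (- (t / 2))). lra. }
    (* Then [exp (2 * x)] is [z^2], which satisfies the bound with room [1]. *)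
    exists (ln (coth (t / 2))). split; [split; exact I|]. apply zQ; [assumption|].
    rewrite exp_ln by lra. lra.
Qed.

End Reach.

(** * The six geometries *)

Lemma open_dom_pos G : (forall i, cont_on (fun _ => True) (G i)) ->
  open_dom (fun r => forall i : idx, 0 < G i r).
Proof.
  intros C X m z Dz Hm.
  assert (L : forall i, locally z (fun z => 0 < G i (m z))).
  { intros i. apply (C i X m z I Hm (fun u => 0 < u)). exact (open_gt 0 _ (Dz i)). }
  generalize (filter_and _ _ (L i1) (filter_and _ _ (L i2) (L i3))).
  apply filter_imp. intros w [W1 [W2 W3]] []; assumption.
Qed.

Lemma open_dom_and D D' : open_dom D -> open_dom D' -> open_dom (fun r => D r /\ D' r).
Proof. intros H H' X m z [Dz Dz'] Hm. apply filter_and; [now apply H|now apply H']. Qed.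

Lemma open_dom_iff D D' : (forall r, D r <-> D' r) -> open_dom D' -> open_dom D.
Proof.
  intros E H X m z Dz Hm. apply E in Dz. generalize (H X m z Dz Hm).
  apply filter_imp. intros w. apply E.
Qed.

Lemma open_pos : open_dom dom_pos.
Proof. apply (open_dom_pos (fun i r => r i)). intros. apply cont_on_coord. Qed.

Lemma open_hex : open_dom dom_hex.
Proof.
  apply (open_dom_pos (fun i r => pair_sum r i)). intros. apply cont_on_plus; apply cont_on_coord.
Qed.

Lemma cont_on_total D : cont_on D total.
Proof. apply cont_on_plus; [apply cont_on_plus|]; apply cont_on_coord. Qed.

Lemma cont_on_Ropp D G : cont_on D G -> cont_on D (fun r => - G r).
Proof.
  intros H. apply cont_on_comp; [assumption|]. intros r Dr.
  apply (continuous_opp (V := R_NormedModule) (fun x => x)), continuous_id.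
Qed.

Lemma open_total_lt c : open_dom (fun r => total r < c).
Proof.
  apply open_dom_iff with (fun r => forall i : idx, 0 < c + - total r).
  - intros r. split; [intros; lra|]. intros H. specialize (H i1). lra.
  - apply (open_dom_pos (fun _ r => c + - total r)). intros.
    apply cont_on_plus; [apply cont_on_const|apply cont_on_Ropp, cont_on_total].
Qed.

Lemma open_sph : open_dom dom_sph.
Proof. apply open_dom_and; [apply open_pos|apply open_total_lt]. Qed.

Lemma open_hyp_angles : open_dom dom_hyp_angles.
Proof. apply open_dom_and; [apply open_hex|apply open_total_lt]. Qed.

Lemma open_sph_angles : open_dom dom_sph_angles.
Proof.
  apply open_dom_iff with (fun r => (forall i, 0 < PI / 2 + - r i) /\ (forall i : idx, 0 < total r + - (PI / 2))).
  - intros r. unfold dom_sph_angles. split.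
    + intros [H T]. split; intros i; [specialize (H i)|]; lra.
    + intros [H T]. split; [intros i; specialize (H i); lra|specialize (T i1); lra].
  - apply open_dom_and.
    + apply (open_dom_pos (fun i r => PI / 2 + - r i)). intros i.
      apply cont_on_plus; [apply cont_on_const|apply cont_on_Ropp, cont_on_coord].
    + apply (open_dom_pos (fun _ r => total r + - (PI / 2))). intros i.
      apply cont_on_plus; [apply cont_on_total|apply cont_on_const].
Qed.

(** Each pair contributes [(x - z)^2 / t]. The form vanishes on constant [X], the direction in which
    the triangle is scaled and its angles stay fixed; hence concavity here is not strict. *)
Lemma angle_form_id r X : dom_pos r -> 0 <= angle_form (fun x => x) (fun _ => 1) 1 r X.
Proof.
  intros P. assert (P1 := P i1). assert (P2 := P i2). assert (P3 := P i3).
  unfold angle_form.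
  assert (H : forall x z t, 0 < t -> 0 <= (1 * (x ^ 2 + z ^ 2) - 2 * 1 * x * z) / t).
  { intros x z t tp. apply Rmult_le_pos; [assert (Sq := pow2_ge_0 (x - z)); lra|].
    apply Rlt_le, Rinv_0_lt_compat, tp. }
  repeat apply Rplus_le_le_0_compat; apply H; lra.
Qed.

(** Each numerator is at least [(cosh t - 1) * (x^2 + z^2)], the remainder being the square
    [(x - K * z)^2]. This serves triangles with [K = 1] and hexagons with [K = -1]. *)
Lemma angle_form_sinh K r X : K ^ 2 = 1 -> dom_hex r -> (exists i, X i <> 0) ->
  0 < angle_form sinh cosh K r X.
Proof.
  intros K2 P [i Xi]. assert (P1 := P i1). assert (P2 := P i2). assert (P3 := P i3).
  unfold pair_sum in P1, P2, P3; simpl in P1, P2, P3.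
  assert (E : forall x z t, 0 < t -> exists c, 0 < c /\
    c * (x ^ 2 + z ^ 2) <= (cosh t * (x ^ 2 + z ^ 2) - 2 * K * x * z) / sinh t).
  { intros x z t tp. assert (sp := sinh_pos t tp). assert (cp := cosh_gt_1 t tp).
    exists ((cosh t - 1) / sinh t). split; [apply Rdiv_lt_0_compat; lra|].
    assert (Sq := pow2_ge_0 (x - K * z)).
    assert (Sq' : (x - K * z) ^ 2 = x ^ 2 + z ^ 2 - 2 * K * x * z)
      by (transitivity (x ^ 2 + K ^ 2 * z ^ 2 - 2 * K * x * z); [ring|rewrite K2; ring]).
    replace ((cosh t - 1) / sinh t * (x ^ 2 + z ^ 2)) with ((cosh t - 1) * (x ^ 2 + z ^ 2) / sinh t)
      by (field; lra).
    apply Rmult_le_compat_r; [apply Rlt_le, Rinv_0_lt_compat, sp|]. lra. }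
  unfold angle_form.
  destruct (E (X i1) (X i2) (r i1 + r i2) ltac:(lra)) as [c1 [p1 L1]].
  destruct (E (X i2) (X i3) (r i2 + r i3) ltac:(lra)) as [c2 [p2 L2]].
  destruct (E (X i3) (X i1) (r i3 + r i1) ltac:(lra)) as [c3 [p3 L3]].
  assert (S := fun i => pow2_ge_0 (X i)).
  assert (S1 := S i1). assert (S2 := S i2). assert (S3 := S i3).
  assert (Sp : 0 < X i ^ 2).
  { specialize (S i). assert (X i ^ 2 <> 0) by now apply pow_nonzero. lra. }
  assert (M1 : 0 <= c1 * (X i1 ^ 2 + X i2 ^ 2)) by (apply Rmult_le_pos; lra).
  assert (M2 : 0 <= c2 * (X i2 ^ 2 + X i3 ^ 2)) by (apply Rmult_le_pos; lra).
  assert (M3 : 0 <= c3 * (X i3 ^ 2 + X i1 ^ 2)) by (apply Rmult_le_pos; lra).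
  destruct i.
  - assert (0 < c1 * (X i1 ^ 2 + X i2 ^ 2)) by (apply Rmult_lt_0_compat; lra). lra.
  - assert (0 < c1 * (X i1 ^ 2 + X i2 ^ 2)) by (apply Rmult_lt_0_compat; lra). lra.
  - assert (0 < c3 * (X i3 ^ 2 + X i1 ^ 2)) by (apply Rmult_lt_0_compat; lra). lra.
Qed.

(* With [t] the half-angle tangents and [a] the pairwise sums of the
   coordinates of [X], the form is half of
   [(1 - t1 t2 - t2 t3 - t3 t1) * sum (a^2 / t) + t1 t2 t3 * (sum (a / t))^2]. *)
Lemma angle_form_sin r X : dom_hyp_angles r -> (exists i, X i <> 0) ->
  0 < angle_form sin cos (-1) r X.
Proof.
  intros Dr [i Xi].
  assert (L := fun i => dom_hyp_angles_pair r i Dr).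
  assert (P1 := L i1). assert (P2 := L i2). assert (P3 := L i3).
  destruct Dr as [_ T]. unfold pair_sum, total in *; simpl in *.
  (* Each term is diagonal in [x + z] and [x - z], with coefficients given by the half-angle
     cotangent and minus the half-angle tangent. *)
  assert (E : forall x z t, 0 < t < PI -> 0 < tan (t / 2) /\
    (cos t * (x ^ 2 + z ^ 2) - 2 * -1 * x * z) / sin t
      = ((x + z) ^ 2 / tan (t / 2) - tan (t / 2) * (x - z) ^ 2) / 2).
  { intros x z t Ht. assert (sp := half_sin_pos t Ht). assert (cp := half_cos_pos t Ht).
    split; [now apply Rdiv_lt_0_compat|].
    assert (E1 : cos t = cos (t / 2) ^ 2 - sin (t / 2) ^ 2).
    { replace t with (2 * (t / 2)) at 1 by field. rewrite cos_2a. ring. }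
    assert (E2 : sin t = 2 * sin (t / 2) * cos (t / 2)).
    { replace t with (2 * (t / 2)) at 1 by field. apply sin_2a. }
    assert (E3 := sin_sqr (t / 2)).
    assert (E4 : 2 * -1 * x * z = - 2 * x * z * (cos (t / 2) ^ 2 + sin (t / 2) ^ 2))
      by (rewrite E3; ring).
    rewrite E4, E1, E2. unfold tan. field. lra. }
  unfold angle_form.
  destruct (E (X i1) (X i2) (r i1 + r i2) ltac:(lra)) as [p1 ->].
  destruct (E (X i2) (X i3) (r i2 + r i3) ltac:(lra)) as [p2 ->].
  destruct (E (X i3) (X i1) (r i3 + r i1) ltac:(lra)) as [p3 ->].
  clear E.
  (* The three half-angles add up to the total, below [PI / 2]; dividing the cosine of their sum by
     the product of the cosines gives this expression. *)
  assert (e1 : 0 < 1 - tan ((r i1 + r i2) / 2) * tan ((r i2 + r i3) / 2)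
    - tan ((r i2 + r i3) / 2) * tan ((r i3 + r i1) / 2) - tan ((r i3 + r i1) / 2) * tan ((r i1 + r i2) / 2)).
  { assert (C1 := half_cos_pos (r i1 + r i2) ltac:(lra)).
    assert (C2 := half_cos_pos (r i2 + r i3) ltac:(lra)).
    assert (C3 := half_cos_pos (r i3 + r i1) ltac:(lra)).
    assert (ct : 0 < cos ((r i1 + r i2) / 2 + (r i2 + r i3) / 2 + (r i3 + r i1) / 2))
      by (apply cos_gt_0; lra).
    set (a := (r i1 + r i2) / 2) in *. set (b := (r i2 + r i3) / 2) in *. set (c := (r i3 + r i1) / 2) in *.
    rewrite !cos_plus, sin_plus in ct.
    assert (CC : 0 < cos a * cos b * cos c) by (repeat apply Rmult_lt_0_compat; assumption).
    apply (Rmult_lt_reg_r (cos a * cos b * cos c)); [assumption|]. rewrite Rmult_0_l.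
    replace ((1 - tan a * tan b - tan b * tan c - tan c * tan a) * (cos a * cos b * cos c))
      with ((cos a * cos b - sin a * sin b) * cos c - (sin a * cos b + cos a * sin b) * sin c)
      by (unfold tan; field; lra).
    exact ct. }
  set (t1 := tan ((r i1 + r i2) / 2)) in *. set (t2 := tan ((r i2 + r i3) / 2)) in *.
  set (t3 := tan ((r i3 + r i1) / 2)) in *. clearbody t1 t2 t3.
  set (a1 := X i1 + X i2). set (a2 := X i2 + X i3). set (a3 := X i3 + X i1).
  (* The pairwise sums determine [X], so they do not all vanish. *)
  assert (S : 0 < a1 ^ 2 / t1 + a2 ^ 2 / t2 + a3 ^ 2 / t3).
  { assert (N : forall a t, 0 < t -> 0 <= a ^ 2 / t /\ (a <> 0 -> 0 < a ^ 2 / t)).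
    { intros a t tp. assert (q := pow2_ge_0 a). split.
      - apply Rmult_le_pos; [assumption|]. apply Rlt_le, Rinv_0_lt_compat, tp.
      - intros n. apply Rdiv_lt_0_compat; [|assumption].
        assert (a ^ 2 <> 0) by now apply pow_nonzero. lra. }
    destruct (N a1 t1 p1) as [n1 s1]. destruct (N a2 t2 p2) as [n2 s2]. destruct (N a3 t3 p3) as [n3 s3].
    destruct (Req_dec a1 0) as [z1|z1]; [|specialize (s1 z1); lra].
    destruct (Req_dec a2 0) as [z2|z2]; [|specialize (s2 z2); lra].
    destruct (Req_dec a3 0) as [z3|z3]; [|specialize (s3 z3); lra].
    exfalso. apply Xi. unfold a1, a2, a3 in *. destruct i; lra. }
  match goal with |- 0 < ?F => replace F with
    (((1 - t1 * t2 - t2 * t3 - t3 * t1) * (a1 ^ 2 / t1 + a2 ^ 2 / t2 + a3 ^ 2 / t3)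
      + t1 * t2 * t3 * (a1 / t1 + a2 / t2 + a3 / t3) ^ 2) / 2) end.
  - assert (0 < (1 - t1 * t2 - t2 * t3 - t3 * t1) * (a1 ^ 2 / t1 + a2 ^ 2 / t2 + a3 ^ 2 / t3))
      by now apply Rmult_lt_0_compat.
    assert (0 <= t1 * t2 * t3 * (a1 / t1 + a2 / t2 + a3 / t3) ^ 2).
    { apply Rmult_le_pos; [|apply pow2_ge_0]. apply Rlt_le. apply Rmult_lt_0_compat; [apply Rmult_lt_0_compat|]; assumption. }
    lra.
  (* Differences of coordinates are differences of pairwise sums, so the whole form is quadratic in
     [a1], [a2], [a3]. *)
  - replace (X i1 - X i2) with (a3 - a2) by (unfold a2, a3; ring).
    replace (X i2 - X i3) with (a1 - a3) by (unfold a1, a3; ring).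
    replace (X i3 - X i1) with (a2 - a1) by (unfold a1, a2; ring).
    field. lra.
Qed.

Lemma pair_distinct (P : R -> Prop) r i j : (forall i, P (pair_sum r i)) -> i <> j -> P (r i + r j).
Proof.
  intros H n. assert (H1 := H i1). assert (H2 := H i2). assert (H3 := H i3).
  unfold pair_sum in *; simpl in *.
  destruct i, j; try congruence; try assumption; rewrite Rplus_comm; assumption.
Qed.

(** * Domains and parameters of each geometry *)

Lemma arising_euclidean r : arising euclidean_triangle r <-> dom_pos r.
Proof.
  split; [|apply euclidean_exists]. intros [z H] i. apply (euclidean_half r z i H).
Qed.

Lemma arising_hyperbolic r : arising hyperbolic_triangle r <-> dom_pos r.
Proof.
  split; [|apply hyperbolic_exists]. intros [z H] i. apply (hyperbolic_half r z i H).
Qed.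

Lemma arising_spherical r : arising spherical_triangle r <-> dom_sph r.
Proof.
  split; [|apply spherical_exists]. intros [z H]. now apply spherical_dom with z.
Qed.

Lemma arising_hyperbolic_angles r :
  arising (fun x y => hyperbolic_triangle y x) r <-> dom_hyp_angles r.
Proof.
  split; [|apply hyperbolic_angles_exists]. intros [z H]. now apply hyperbolic_angles_dom with z.
Qed.

Lemma arising_spherical_angles r :
  arising (fun x y => spherical_triangle y x) r <-> dom_sph_angles r.
Proof.
  split; [|apply spherical_angles_exists]. intros [z H]. now apply spherical_angles_dom with z.
Qed.

Lemma arising_hexagon r :
  arising (fun x y => right_angled_hexagon y x) r <-> dom_hex r.
Proof.
  split; [|apply hexagon_exists]. intros [z H]. now apply hexagon_dom with z.
Qed.

Lemma dom_pos_total r : dom_pos r -> 0 < total r.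
Proof. intros P. assert (P1 := P i1). assert (P2 := P i2). assert (P3 := P i3). unfold total. lra. Qed.

Lemma dom_pos_hex r : dom_pos r -> dom_hex r.
Proof.
  intros P i. unfold pair_sum. assert (H1 := P (nxt i)). assert (H2 := P (nxt (nxt i))). lra.
Qed.

Lemma euclidean_family y : opposite euclidean_triangle y ->
  trig_family (arising euclidean_triangle) y 0 PI 0 p_infty (fun t => cot (t / 2))
    (fun r => r) (fun _ => 1) (fun r => r) (fun _ => 1) 0 (- (1 / 2)) 1 1 1 1 (-1).
Proof.
  intros Op. assert (HD := arising_euclidean).
  assert (JI : forall r i, arising euclidean_triangle r -> oo 0 PI (y r i)).
  { intros r i Dr. apply oo_fin_intro, (Op r Dr i). }
  constructor; auto.
  - apply trig_id.
  - apply half_cot_pos.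
  - apply half_cot_derive.
  - intros. apply half_cot_sign.
  - apply oo_pos.
  - apply oo_pos_intro; lra.
  - apply (open_dom_iff _ _ HD open_pos).
  - intros r i Dr. apply HD in Dr. apply oo_pos_intro, Dr.
  - intros r Dr. apply HD in Dr. rewrite Rmult_1_l. now apply dom_pos_total.
  - intros r i j Dr n. apply HD in Dr. apply Rgt_not_eq.
    apply (pair_distinct (fun x => 0 < x)); [|assumption]. now apply dom_pos_hex.
  - intros r i Dr. assert (P := Dr). apply HD in P.
    apply (h_from_square (fun r => r)).
    + apply P.
    + rewrite Rmult_1_l. now apply dom_pos_total.
    + apply half_cot_pos. auto.
    + destruct (euclidean_half r (y r) i (Op r Dr)) as [_ E]. rewrite E. unfold Rdiv; ring.
Qed.

Lemma hyperbolic_family y : opposite hyperbolic_triangle y ->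
  trig_family (arising hyperbolic_triangle) y 0 PI 0 p_infty (fun t => cot (t / 2))
    sinh cosh sinh cosh 1 (- (1 / 2)) 1 1 1 1 (-1).
Proof.
  intros Op. assert (HD := arising_hyperbolic).
  assert (JI : forall r i, arising hyperbolic_triangle r -> oo 0 PI (y r i)).
  { intros r i Dr. apply oo_fin_intro, (Op r Dr i). }
  constructor; auto.
  - apply trig_sinh.
  - apply half_cot_pos.
  - apply half_cot_derive.
  - intros. apply half_cot_sign.
  - intros x Jx. apply sinh_pos, oo_pos, Jx.
  - apply oo_pos_intro; lra.
  - apply (open_dom_iff _ _ HD open_pos).
  - intros r i Dr. apply HD in Dr. apply oo_pos_intro, Dr.
  - intros r Dr. apply HD in Dr. rewrite Rmult_1_l. now apply sinh_pos, dom_pos_total.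
  - intros r i j Dr n. apply HD in Dr. apply Rgt_not_eq, sinh_pos.
    apply (pair_distinct (fun x => 0 < x)); [|assumption]. now apply dom_pos_hex.
  - intros r i Dr. assert (P := Dr). apply HD in P.
    apply h_from_square.
    + intros. apply sinh_pos, P.
    + rewrite Rmult_1_l. now apply sinh_pos, dom_pos_total.
    + apply half_cot_pos. auto.
    + destruct (hyperbolic_half r (y r) i (Op r Dr)) as [_ E]. rewrite E. unfold Rdiv; ring.
Qed.

Lemma spherical_family y : opposite spherical_triangle y ->
  trig_family (arising spherical_triangle) y 0 PI 0 PI (fun t => cot (t / 2))
    sin cos sin cos (-1) (- (1 / 2)) 1 1 1 1 (-1).
Proof.
  intros Op. assert (HD := arising_spherical). assert (pi := PI2_1).
  assert (JI : forall r i, arising spherical_triangle r -> oo 0 PI (y r i)).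
  { intros r i Dr. apply oo_fin_intro, (Op r Dr i). }
  assert (J : forall r i, dom_sph r -> 0 < r i < PI).
  { intros r i [P T]. assert (P1 := P i1). assert (P2 := P i2). assert (P3 := P i3).
    unfold total in T. destruct i; lra. }
  assert (tp : forall r, dom_sph r -> 0 < 1 * sin (total r)).
  { intros r Dr. rewrite Rmult_1_l. apply sin_gt_0; [|apply Dr].
    destruct Dr as [P _]. now apply dom_pos_total. }
  constructor; auto.
  - apply trig_sin.
  - apply half_cot_pos.
  - apply half_cot_derive.
  - intros. apply half_cot_sign.
  - intros x Jx%oo_fin. apply sin_gt_0; lra.
  - apply oo_fin_intro; lra.
  - apply (open_dom_iff _ _ HD open_sph).
  - intros r i Dr. apply HD in Dr. now apply oo_fin_intro, J.
  - intros r Dr. now apply tp, HD.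
  - intros r i j Dr n. apply Rgt_not_eq, sin_gt_0.
    + apply (pair_distinct (fun x => 0 < x)); [|assumption].
      apply dom_pos_hex. exact (proj1 (proj1 (HD r) Dr)).
    + apply (pair_distinct (fun x => x < PI)); [|assumption]. apply HD in Dr. intros k.
      rewrite pair_sum_total. destruct (J r k Dr). destruct Dr. lra.
  - intros r i Dr. assert (P := Dr). apply HD in P.
    apply h_from_square.
    + intros. apply sin_gt_0; now apply J.
    + now apply tp.
    + apply half_cot_pos. auto.
    + destruct (spherical_half r (y r) i (Op r Dr)) as [_ [_ E]]. rewrite E. unfold Rdiv; ring.
Qed.

Lemma hyperbolic_angles_family y : opposite (fun x y => hyperbolic_triangle y x) y ->
  trig_family (arising (fun x y => hyperbolic_triangle y x)) y 0 p_infty (- (PI / 2)) (PI / 2)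
    (fun t => tanh (t / 2)) cos (fun x => - sin x) sin cos (-1) (1 / 2) (-1) 1 1 (-1) 1.
Proof.
  intros Op. assert (HD := arising_hyperbolic_angles). assert (pi := PI2_1).
  assert (JI : forall r i, arising (fun x y => hyperbolic_triangle y x) r -> oo 0 p_infty (y r i)).
  { intros r i Dr. apply oo_pos_intro, (Op r Dr i). }
  assert (tp : forall r, dom_hyp_angles r -> 0 < 1 * cos (total r)).
  { intros r Dr. rewrite Rmult_1_l. apply cos_pos. split; [|apply Dr].
    destruct Dr as [P T]. assert (P1 := P i1). assert (P2 := P i2). assert (P3 := P i3).
    unfold pair_sum, total in *; simpl in *. lra. }
  constructor; auto.
  - apply trig_cos; lra.
  - apply half_tanh_pos.
  - intros. apply half_tanh_derive.
  - intros. apply half_tanh_sign.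
  - intros x Jx%oo_fin. now apply cos_pos.
  - apply oo_fin_intro; lra.
  - apply (open_dom_iff _ _ HD open_hyp_angles).
  - intros r i Dr. now apply oo_fin_intro, dom_hyp_angles_J, HD.
  - intros r Dr. now apply tp, HD.
  - intros r i j Dr n. apply HD in Dr. apply Rgt_not_eq.
    apply (pair_distinct (fun x => 0 < sin x)); [|assumption]. intros k.
    apply sin_gt_0; now apply dom_hyp_angles_pair.
  - intros r i Dr. assert (P := Dr). apply HD in P.
    apply h_from_square.
    + intros. now apply cos_pos, dom_hyp_angles_J.
    + now apply tp.
    + apply half_tanh_pos. auto.
    + destruct (hyperbolic_angles_half r (y r) i (Op r Dr)) as [_ [_ E]]. rewrite E. unfold Rdiv; ring.
Qed.

Lemma spherical_angles_family y : opposite (fun x y => spherical_triangle y x) y ->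
  trig_family (arising (fun x y => spherical_triangle y x)) y 0 PI (- (PI / 2)) (PI / 2)
    (fun t => tan (t / 2)) cos (fun x => - sin x) sin cos (-1) (1 / 2) 1 (-1) 1 (-1) 1.
Proof.
  intros Op. assert (HD := arising_spherical_angles). assert (pi := PI2_1).
  assert (JI : forall r i, arising (fun x y => spherical_triangle y x) r -> oo 0 PI (y r i)).
  { intros r i Dr. apply oo_fin_intro, (Op r Dr i). }
  assert (tp : forall r, dom_sph_angles r -> 0 < -1 * cos (total r)).
  { intros r [P T]. assert (P1 := P i1). assert (P2 := P i2). assert (P3 := P i3).
    assert (cos (total r) < 0); [|lra]. apply cos_lt_0; [assumption|]. unfold total; lra. }
  constructor; auto.
  - apply trig_cos; lra.
  - apply half_tan_pos.
  - apply half_tan_derive.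
  - intros. apply half_tan_sign.
  - intros x Jx%oo_fin. now apply cos_pos.
  - apply oo_fin_intro; lra.
  - apply (open_dom_iff _ _ HD open_sph_angles).
  - intros r i Dr. now apply oo_fin_intro, dom_sph_angles_J, HD.
  - intros r Dr. now apply tp, HD.
  - intros r i j Dr n. apply HD in Dr. apply Rgt_not_eq.
    apply (pair_distinct (fun x => 0 < sin x)); [|assumption]. intros k.
    apply sin_gt_0; now apply dom_sph_angles_pair.
  - intros r i Dr. assert (P := Dr). apply HD in P.
    apply h_from_square.
    + intros. now apply cos_pos, dom_sph_angles_J.
    + now apply tp.
    + apply half_tan_pos. auto.
    + destruct (spherical_angles_half r (y r) i (Op r Dr)) as [_ [_ E]]. rewrite E. unfold Rdiv; ring.
Qed.

Lemma hexagon_family y : opposite (fun x y => right_angled_hexagon y x) y ->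
  trig_family (arising (fun x y => right_angled_hexagon y x)) y 0 p_infty m_infty p_infty
    (fun t => coth (t / 2)) cosh sinh sinh cosh 1 (1 / 2) (-1) 1 (-1) (-1) (-1).
Proof.
  intros Op. assert (HD := arising_hexagon).
  assert (JI : forall r i, arising (fun x y => right_angled_hexagon y x) r -> oo 0 p_infty (y r i)).
  { intros r i Dr. apply oo_pos_intro, (Op r Dr i). }
  constructor; auto.
  - apply trig_cosh.
  - apply half_coth_pos.
  - apply half_coth_derive.
  - intros. now apply half_coth_sign.
  - intros x _. apply cosh_pos.
  - split; exact I.
  - apply (open_dom_iff _ _ HD open_hex).
  - intros. split; exact I.
  - intros. rewrite Rmult_1_l. apply cosh_pos.
  - intros r i j Dr n. apply HD in Dr. apply Rgt_not_eq, sinh_pos.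
    now apply (pair_distinct (fun x => 0 < x)).
  - intros r i Dr. apply h_from_square.
    + intros. apply cosh_pos.
    + rewrite Rmult_1_l. apply cosh_pos.
    + apply half_coth_pos. auto.
    + rewrite (hexagon_half r (y r) i (Op r Dr)). unfold Rdiv; ring.
Qed.

(** For [t <= 1 / 2] the summand [(1 - t) * a] is positive, otherwise [t * b] is. *)
Lemma star_affine a b t : 0 < a -> 0 < b -> 0 <= t <= 1 -> 0 < a + t * (b - a).
Proof. intros. destruct (Rle_lt_dec t (1 / 2)); nra. Qed.

Lemma dom_pos_star D : (forall r, D r <-> dom_pos r) ->
  forall r t, D r -> 0 <= t <= 1 -> D (fun i => 1 + t * (r i - 1)).
Proof. intros HD r t Dr Ht. apply HD. intros i. apply star_affine; [lra|now apply HD|assumption]. Qed.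

Lemma dom_hex_star D : (forall r, D r <-> dom_hex r) ->
  forall r t, D r -> 0 <= t <= 1 -> D (fun i => 1 + t * (r i - 1)).
Proof.
  intros HD r t Dr Ht. apply HD. apply HD in Dr. intros i. specialize (Dr i). unfold pair_sum in *.
  assert (H := star_affine 2 _ t ltac:(lra) Dr Ht). lra.
Qed.

(** At the base point the pair sums are [PI / 6] and the total is [PI / 4], inside the bounds [0]
    and [PI / 2]; all constraints are affine, so the segment stays in the domain. *)
Lemma dom_hyp_angles_star D : (forall r, D r <-> dom_hyp_angles r) ->
  forall r t, D r -> 0 <= t <= 1 -> D (fun i => PI / 12 + t * (r i - PI / 12)).
Proof.
  intros HD r t Dr Ht. assert (pi := PI2_1). apply HD. apply HD in Dr. destruct Dr as [P T]. split.
  - intros i. specialize (P i). unfold pair_sum in *.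
    assert (H := star_affine (PI / 6) _ t ltac:(lra) P Ht). lra.
  - unfold total in *.
    assert (H := star_affine (PI / 4) (PI / 2 - (r i1 + r i2 + r i3)) t ltac:(lra) ltac:(lra) Ht). lra.
Qed.

Theorem theorem3p4 :
  (* (a) *)
  (forall th : vec -> vec,
    let T := fun x y => euclidean_triangle x y in
    opposite T th ->
    all_closed_forms (arising T) th (oo 0 PI) (oo 0 p_infty)
      (fun t => cot (t / 2)) (fun r => r) /\
    integration_is locally_concave (arising T) th (oo 0 PI)
      (fun t => cot (t / 2)) (fun r => r))
  /\
  (* (b) *)
  (forall th : vec -> vec,
    let T := fun x y => hyperbolic_triangle x y in
    opposite T th ->
    all_interacting_closed_forms (arising T) th (oo 0 PI) (oo 0 p_infty)
      (fun t => cot (t / 2)) sinh /\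
    integration_is locally_strictly_concave (arising T) th (oo 0 PI)
      (fun t => cot (t / 2)) sinh)
  /\
  (* (c) *)
  (forall th : vec -> vec,
    let T := fun x y => spherical_triangle x y in
    opposite T th ->
    all_closed_forms (arising T) th (oo 0 PI) (oo 0 PI)
      (fun t => cot (t / 2)) sin)
  /\
  (* (d) *)
  (forall l : vec -> vec,
    let T := fun x y => hyperbolic_triangle y x in
    opposite T l ->
    all_closed_forms (arising T) l (oo 0 p_infty) (oo (- (PI / 2)) (PI / 2))
      (fun t => tanh (t / 2)) cos /\
    integration_is locally_strictly_concave (arising T) l (oo 0 p_infty)
      (fun t => tanh (t / 2)) cos)
  /\
  (* (e) *)
  (forall l : vec -> vec,
    let T := fun x y => spherical_triangle y x in
    opposite T l ->
    all_closed_forms (arising T) l (oo 0 PI) (oo (- (PI / 2)) (PI / 2))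
      (fun t => tan (t / 2)) cos)
  /\
  (* (f) *)
  (forall l : vec -> vec,
    let T := fun x y => right_angled_hexagon y x in
    opposite T l ->
    all_interacting_closed_forms (arising T) l (oo 0 p_infty)
      (oo m_infty p_infty) (fun t => coth (t / 2)) cosh /\
    integration_is locally_strictly_concave (arising T) l (oo 0 p_infty)
      (fun t => coth (t / 2)) cosh).
Proof.
  split; [|split; [|split; [|split; [|split]]]].
  - intros th T Op. assert (Fam := euclidean_family th Op). split.
    + apply (family_all_classification Fam _ _
        (reachable_id _ arising_euclidean)).
      intros t x It Jx. assert (H := half_cot_pos t It). apply oo_pos in Jx.
      split; [assumption|now apply Rdiv_lt_0_compat].
    + apply (family_concave Fam (fun _ => 1)).
      * apply (dom_pos_star _ arising_euclidean).
      * reflexivity.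
      * intros r X Dr. now apply angle_form_id, arising_euclidean.
  - intros th T Op. assert (Fam := hyperbolic_family th Op). split.
    + apply (family_interacting_classification Fam _ _
        (reachable_sinh _ arising_hyperbolic)).
    + apply (family_strictly_concave Fam (fun _ => 1)).
      * apply (dom_pos_star _ arising_hyperbolic).
      * reflexivity.
      * intros r X Dr HX. apply angle_form_sinh; [ring| |assumption].
        now apply dom_pos_hex, arising_hyperbolic.
  - intros th T Op. assert (Fam := spherical_family th Op).
    apply (family_all_classification Fam _ _
      (reachable_sin _ arising_spherical)).
    intros t x It Jx. assert (H := half_cot_pos t It). apply oo_fin in Jx.
    split; [assumption|]. apply Rdiv_lt_0_compat; [assumption|]. apply sin_gt_0; lra.
  - intros l T Op. assert (Fam := hyperbolic_angles_family l Op). split.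
    + apply (family_all_classification Fam _ _
        (reachable_cos_hyperbolic _ arising_hyperbolic_angles)).
      intros t x It Jx. assert (H := half_tanh_pos t It). apply oo_fin in Jx.
      assert (c := cos_pos x Jx). split; [assumption|]. split; [now apply Rdiv_lt_0_compat|].
      (* For the factor [Q = tanh (t / 2) / cos x] the bound [Q * cos x < 1] always holds, so every
         pair of values occurs. *)
      replace (tanh (t / 2) / cos x * cos x) with (tanh (t / 2)) by (field; lra).
      apply tanh_lt_1.
    + apply (family_strictly_concave Fam (fun _ => PI / 12)).
      * apply (dom_hyp_angles_star _ arising_hyperbolic_angles).
      * reflexivity.
      * intros r X Dr HX. apply angle_form_sin; [|assumption]. now apply arising_hyperbolic_angles.
  - intros l T Op. assert (Fam := spherical_angles_family l Op).
    apply (family_all_classification Fam _ _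
      (reachable_cos_spherical _ arising_spherical_angles)).
    intros t x It Jx. assert (H := half_tan_pos t It). apply oo_fin in Jx.
    split; [assumption|]. apply Rdiv_lt_0_compat; [assumption|now apply cos_pos].
  - intros l T Op. assert (Fam := hexagon_family l Op). split.
    + apply (family_interacting_classification Fam _ _
        (reachable_cosh _ arising_hexagon)).
    + apply (family_strictly_concave Fam (fun _ => 1)).
      * apply (dom_hex_star _ arising_hexagon).
      * reflexivity.
      * intros r X Dr HX. apply angle_form_sinh; [ring| |assumption]. now apply arising_hexagon.
Qed.
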